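(* Let $K$ and $\varkappa$ be real functions defined in a domain $\mathcal D\subset\mathbb R^2$, satisfying $K^2-\varkappa^2>0$, and let the pair $(K,\varkappa)$ be a solution in $\mathcal D$ of the system \[ \sqrt[4]{|K^2-\varkappa^2|}\;\Delta^h\ln|K^2-\varkappa^2|=-8K,\qquad \sqrt[4]{|K^2-\varkappa^2|}\;\Delta^h\ln\left|\frac{K+\varkappa}{K-\varkappa}\right|=-4\varkappa , \] where $\Delta^h=\frac{\partial^2}{\partial u^2}-\frac{\partial^2}{\partial v^2}$. Then in a neighborhood of any point $t_0\in\mathcal D$ there exists a minimal time-like surface $\mathcal M$ of the first type in $\mathbb R^4_2$, unique up to a proper motion in $\mathbb R^4_2$, given in canonical coordinates $(u,v)$, for which the given functions $K$ and $\varkappa$ are the Gauss curvature and the curvature of the normal connection, respectively.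
   Context: All maps are smooth and domains are open and connected. $\mathbb R^4_2$ is $\mathbb R^4$ with scalar product $a\cdot b=-a_1b_1+a_2b_2-a_3b_3+a_4b_4$ and its standard orientation; $a^2=a\cdot a$. A proper motion is $x\mapsto Ax+b$ with $A\in\mathbf{SO}(2,2,\mathbb R)$ (linear, preserving the scalar product, $\det A=1$), $b\in\mathbb R^4_2$. Double numbers: $\mathbb D=\{t=u+\mathrm jv:u,v\in\mathbb R\}$, $\mathrm j^2=1$, $\bar t=u-\mathrm jv$, $|t|^2=t\bar t=u^2-v^2$; $\mathbb D_+=\{t:|t|^2>0,\ \mathrm{Re}\,t>0\}$; $\mathbb R^2$ is identified with $\mathbb D$; $\frac{\partial}{\partial t}=\frac12(\frac{\partial}{\partial u}+\mathrm j\frac{\partial}{\partial v})$. $\mathbb D^4_2$ is $\mathbb D^4$ with the $\mathbb D$-bilinear extension of the scalar product. A time-like surface $\mathcal M=(\mathcal D,x)$ in $\mathbb R^4_2$ is an immersion $x:\mathcal D\to\mathbb R^4_2$ whose induced scalar product on tangent planes is indefinite (signature $(1,1)$). Coordinates $(u,v)$ are isothermal if $x_u^2=-x_v^2$ and $x_u\cdot x_v=0$; always with $E=x_u^2<0$. Let $\sigma$ be the second fundamental form, $(X_1,X_2)$ an orthonormal tangent frame with $X_1^2=-1$, $X_2^2=1$, and $(n_1,n_2)$ an orthonormal normal frame with $n_1^2=-1$, $n_2^2=1$ such that $(X_1,X_2,n_1,n_2)$ is right (positively) oriented in $\mathbb R^4_2$. The surface is minimal if $H=\frac12(-\sigma(X_1,X_1)+\sigma(X_2,X_2))=0$.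 Gauss curvature: $K=-R(X_1,X_2)X_2\cdot X_1$; curvature of the normal connection: $\varkappa=R^N(X_1,X_2)n_2\cdot n_1$, where $R,R^N$ are the curvature tensors of the Levi-Civita and the normal connections, with $R(X,Y)=\nabla_X\nabla_Y-\nabla_Y\nabla_X-\nabla_{[X,Y]}$ (similarly $R^N$). For isothermal $t=u+\mathrm jv$ put $\Phi=x_u+\mathrm jx_v$ and $\Phi'=\partial\Phi/\partial t$; $\Phi'^\bot$ is the projection of $\Phi'$ to the complexified normal space (the $\mathbb D$-span of the normal space), along the complexified tangent space, and ${\Phi'^\bot}^2=\Phi'^\bot\cdot\Phi'^\bot\in\mathbb D$. A minimal time-like surface is of the first type if ${\Phi'^\bot}^2\in\mathbb D_+$ at all points (this does not depend on the isothermal coordinates). For such a surface, isothermal coordinates with $E<0$ are canonical if ${\Phi'^\bot}^2=1$. *)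

(* Defs.v *)
From HB Require Import structures.
From mathcomp Require Import all_boot all_order all_algebra.
From mathcomp Require Import all_classical all_reals all_analysis.
Import Order.TTheory GRing.Theory Num.Theory numFieldNormedType.Exports.

Set Implicit Arguments.
Unset Strict Implicit.
Unset Printing Implicit Defensive.

Local Open Scope classical_set_scope.
Local Open Scope ring_scope.

Record dnum (R : Type) : Type := DNum { dre : R; dim : R }.

Section DoubleNumbers.
Variable R : comNzRingType.
Implicit Types s t : dnum R.

Definition pair_of_dnum t : R * R := (dre t, dim t).
Definition dnum_of_pair (z : R * R) : dnum R := DNum z.1 z.2.
Lemma pair_of_dnumK : cancel pair_of_dnum dnum_of_pair.
Proof. by case. Qed.

HB.instance Definition _ := Choice.copy (dnum R) (can_type pair_of_dnumK).

Definition dnum0 : dnum R := DNum 0 0.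
Definition dnum1 : dnum R := DNum 1 0.
Definition dopp t : dnum R := DNum (- dre t) (- dim t).
Definition dadd s t : dnum R := DNum (dre s + dre t) (dim s + dim t).
Definition dmul s t : dnum R :=
  DNum (dre s * dre t + dim s * dim t) (dre s * dim t + dim s * dre t).

Lemma daddA : associative dadd.
Proof. by move=> [a b] [c d] [e f]; rewrite /dadd /= !addrA. Qed.
Lemma daddC : commutative dadd.
Proof. by move=> [a b] [c d]; rewrite /dadd /= addrC [b + d]addrC. Qed.
Lemma dadd0 : left_id dnum0 dadd.
Proof. by move=> [a b]; rewrite /dadd /= !add0r. Qed.
Lemma daddN : left_inverse dnum0 dopp dadd.
Proof. by move=> [a b]; rewrite /dadd /dopp /= !addNr. Qed.

HB.instance Definition _ :=
  GRing.isZmodule.Build (dnum R) daddA daddC dadd0 daddN.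

Lemma dmulA : associative dmul.
Proof.
move=> [a b] [c d] [e f]; rewrite /dmul /= !mulrDr !mulrDl !mulrA.
by congr DNum; rewrite -!addrA; congr (_ + _); rewrite addrA addrC.
Qed.
Lemma dmulC : commutative dmul.
Proof.
move=> [a b] [c d]; rewrite /dmul /=.
by rewrite ![c * _]mulrC ![d * _]mulrC [b * c + _]addrC.
Qed.
Lemma dmul1 : left_id dnum1 dmul.
Proof. by move=> [a b]; rewrite /dmul /= !mul1r !mul0r !addr0. Qed.
Lemma dmulDl : left_distributive dmul dadd.
Proof.
by move=> [a b] [c d] [e f]; rewrite /dmul /dadd /= !mulrDl; congr DNum;
  rewrite addrACA.
Qed.
Lemma dnum1_neq0 : dnum1 != dnum0.
Proof. by apply/eqP=> -[/eqP]; rewrite oner_eq0. Qed.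

HB.instance Definition _ :=
  GRing.Zmodule_isComNzRing.Build (dnum R) dmulA dmulC dmul1 dmulDl dnum1_neq0.

Definition dj : dnum R := DNum 0 1.
Definition dreal (a : R) : dnum R := DNum a 0.
Definition dconj t : dnum R := DNum (dre t) (- dim t).
(* t * dconj t has vanishing j-part; its real part is u ^+ 2 - v ^+ 2 *)
Definition dnormsq t : R := dre (t * dconj t).
End DoubleNumbers.

Definition dpos (R : realType) : set (dnum R) :=
  [set t | 0 < dnormsq t /\ 0 < dre t].

(* Over [dnum R] this is the D-bilinear extension. *)
Definition dot (A : comNzRingType) (a b : 'rV[A]_4) : A :=
  \sum_(i < 4) (- 1) ^+ i.+1 * a 0 i * b 0 i.

(* Row-vector convention: the linear part acts by [y *m A]. *)
Definition proper_motion (R : realType) (M : 'rV[R]_4 -> 'rV[R]_4) : Prop :=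
  exists (A : 'M[R]_4) (b : 'rV[R]_4),
    [/\ forall y z, dot (y *m A) (z *m A) = dot y z,
        \det A = 1 &
        forall y, M y = y *m A + b].

(* The coordinates [u], [v] on the plane have indices 0, 1. *)

Section Plane.
Variable R : realType.
Local Notation plane := 'rV[R]_2.

Definition domain (D : set plane) : Prop := open D /\ connected D.

Definition partial (W : normedModType R) (i : 'I_2) (f : plane -> W) :
    plane -> W :=
  fun p => 'D_(delta_mx 0 i) f p.

Fixpoint Cn (n : nat) (W : normedModType R) (D : set plane) (f : plane -> W) :
    Prop :=
  if n is m.+1 then
    (forall p, D p -> differentiable f p) /\
    (forall i : 'I_2, Cn m D (partial i f))
  else forall p, D p -> {for p, continuous f}.

Definition smooth (W : normedModType R) (D : set plane) (f : plane -> W) :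
    Prop :=
  forall n, Cn n D f.

Definition hlaplacian (f : plane -> R) : plane -> R :=
  fun p => partial 0 (partial 0 f) p - partial 1 (partial 1 f) p.

(* A tangent field of a surface [x] is given by its coordinates [X]; as a field
   in the ambient space it is [fun p => 'D_(X p) x p]. *)

Definition lie_bracket (X Y : plane -> plane) : plane -> plane :=
  fun p => 'D_(X p) Y p - 'D_(Y p) X p.

Definition curvature (V : zmodType)
    (nabla : (plane -> plane) -> (plane -> V) -> plane -> V)
    (X Y : plane -> plane) (s : plane -> V) : plane -> V :=
  fun p => nabla X (nabla Y s) p - nabla Y (nabla X s) p
           - nabla (lie_bracket X Y) s p.

Section Surface.
Variable x : plane -> 'rV[R]_4.

Definition first_form (p v w : plane) : R := dot ('D_v x p) ('D_w x p).

Definition metric (p : plane) : 'M[R]_2 :=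
  \matrix_(i, j) first_form p (delta_mx 0 i) (delta_mx 0 j).

Definition christoffel (k i j : 'I_2) (p : plane) : R :=
  2^-1 * \sum_l invmx (metric p) k l *
    (partial i (fun q => metric q j l) p + partial j (fun q => metric q i l) p
     - partial l (fun q => metric q i j) p).

Definition levi_civita (X Y : plane -> plane) : plane -> plane :=
  fun p => 'D_(X p) Y p +
    \row_k \sum_i \sum_j christoffel k i j p * X p 0 i * Y p 0 j.

(* The row spaces of [tangent_space p] and [normal_space p] are the tangent plane
   and its orthogonal complement for [dot]. *)
Definition tangent_space (p : plane) : 'M[R]_4 :=
  <<\matrix_(i < 2) partial i x p>>%MS.

Definition normal_space (p : plane) : 'M[R]_4 :=
  kermx (\matrix_(k < 4, i < 2) dot (delta_mx 0 k) (partial i x p)).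

Definition normal_part (p : plane) (w : 'rV[R]_4) : 'rV[R]_4 :=
  w *m proj_mx (normal_space p) (tangent_space p).

Definition second_form (X Y : plane -> plane) : plane -> 'rV[R]_4 :=
  fun p => normal_part p ('D_(X p) (fun q => 'D_(Y q) x q) p).

Definition normal_connection (X : plane -> plane) (n : plane -> 'rV[R]_4) :
    plane -> 'rV[R]_4 :=
  fun p => normal_part p ('D_(X p) n p).

Record frame := Frame {
  fX1 : plane -> plane;
  fX2 : plane -> plane;
  fn1 : plane -> 'rV[R]_4;
  fn2 : plane -> 'rV[R]_4
}.

Definition adapted_at (F : frame) (q : plane) : Prop :=
  let X1 := fX1 F q in let X2 := fX2 F q in
  let n1 := fn1 F q in let n2 := fn2 F q in
  [/\ [/\ first_form q X1 X1 = - 1, first_form q X2 X2 = 1 &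
          first_form q X1 X2 = 0],
      (n1 <= normal_space q)%MS /\ (n2 <= normal_space q)%MS,
      [/\ dot n1 n1 = - 1, dot n2 n2 = 1 & dot n1 n2 = 0] &
      0 < \det (\matrix_(i < 4) [:: 'D_X1 x q; 'D_X2 x q; n1; n2]`_i)].

Definition adapted_near (F : frame) (p : plane) : Prop :=
  exists U : set plane,
    [/\ open U, U p,
        [/\ smooth U (fX1 F), smooth U (fX2 F), smooth U (fn1 F) &
            smooth U (fn2 F)] &
        forall q, U q -> adapted_at F q].

(* [val] takes the value [c] at [p] for every adapted frame near [p], and such
   frames exist: independent of the choice of frame, and never vacuous. *)
Definition frame_value (T : Type) (val : frame -> plane -> T) (p : plane)
    (c : T) : Prop :=
  (exists F, adapted_near F p) /\
  (forall F, adapted_near F p -> val F p = c).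

Definition is_mean_curvature : plane -> 'rV[R]_4 -> Prop :=
  frame_value (fun F p =>
    2^-1 *: (- second_form (fX1 F) (fX1 F) p + second_form (fX2 F) (fX2 F) p)).

Definition is_gauss_curvature : plane -> R -> Prop :=
  frame_value (fun F p =>
    - first_form p (curvature levi_civita (fX1 F) (fX2 F) (fX2 F) p)
                   (fX1 F p)).

Definition is_normal_curvature : plane -> R -> Prop :=
  frame_value (fun F p =>
    dot (curvature normal_connection (fX1 F) (fX2 F) (fn2 F) p) (fn1 F p)).

Definition timelike_surface (D : set plane) : Prop :=
  [/\ domain D, smooth D x,
      forall p, D p -> injective ('d x p) &
      forall p, D p ->
        (exists v, first_form p v v < 0) /\ (exists w, 0 < first_form p w w)].

Definition minimal (D : set plane) : Prop :=
  forall p, D p -> is_mean_curvature p 0.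

Definition isothermal (D : set plane) : Prop :=
  forall p, D p ->
    let xu := partial 0 x p in let xv := partial 1 x p in
    [/\ dot xu xu = - dot xv xv, dot xu xv = 0 & dot xu xu < 0].

Definition cplx (a b : 'rV[R]_4) : 'rV[dnum R]_4 :=
  map_mx (@dreal R) a + dj R *: map_mx (@dreal R) b.

Definition partialD (i : 'I_2) (F : plane -> 'rV[dnum R]_4) :
    plane -> 'rV[dnum R]_4 :=
  fun p => cplx (partial i (fun q => map_mx (@dre R) (F q)) p)
                (partial i (fun q => map_mx (@dim R) (F q)) p).

(* d/dt = (d/du + j d/dv) / 2 *)
Definition derivD (F : plane -> 'rV[dnum R]_4) : plane -> 'rV[dnum R]_4 :=
  fun p => dreal 2^-1 *: (partialD 0 F p + dj R *: partialD 1 F p).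

Definition Phi (p : plane) : 'rV[dnum R]_4 :=
  cplx (partial 0 x p) (partial 1 x p).

(* D-linear extension of [normal_part] *)
Definition normal_partD (p : plane) (w : 'rV[dnum R]_4) : 'rV[dnum R]_4 :=
  cplx (normal_part p (map_mx (@dre R) w)) (normal_part p (map_mx (@dim R) w)).

Definition Phi'_perp_sq (p : plane) : dnum R :=
  dot (normal_partD p (derivD Phi p)) (normal_partD p (derivD Phi p)).

(* The condition on [Phi'_perp_sq] does not depend on the isothermal
   coordinates; here it is read in the given ones. *)
Definition first_type (D : set plane) : Prop :=
  isothermal D /\ forall p, D p -> dpos (Phi'_perp_sq p).

Definition canonical_coords (D : set plane) : Prop :=
  isothermal D /\ forall p, D p -> Phi'_perp_sq p = 1.

Definition canonical_surface_with (D : set plane) (K kappa : plane -> R) :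
    Prop :=
  [/\ timelike_surface D, minimal D, first_type D, canonical_coords D &
      forall p, D p ->
        is_gauss_curvature p (K p) /\ is_normal_curvature p (kappa p)].

End Surface.
End Plane.

(* Main.v *)
From HB Require Import structures.
Require Import Defs.
From mathcomp Require Import all_boot all_order all_algebra.
From mathcomp Require Import all_classical all_reals all_analysis.
From mathcomp Require Import ring lra.
Import Order.TTheory GRing.Theory Num.Theory numFieldNormedType.Exports.
Local Open Scope classical_set_scope.
Local Open Scope ring_scope.

Set Implicit Arguments.
Unset Strict Implicit.
Unset Printing Implicit Defensive.

(** In the null coordinates s = u + v and r = u - v, isothermal coordinates are
    those in which x_s and x_r are null vectors with g = x_s . x_r < 0, and a
    surface is minimal exactly when x_sr = 0 (mean_value_frame).  Up to the
    tangential part, Phi' has the two components 2 x_ss and 2 x_rr, so that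
    canonical coordinates mean x_ss^2 = x_rr^2 = 1/4 (Phi_perp_sq1), and for
    every adapted frame
      K = - (g g_sr - g_s g_r) / g^3,
      kappa = - det (x_s, x_r, x_ss, x_rr) / g^3
    (gauss_value, normal_value).  The surfaces to be found are therefore the
    maps x that satisfy these equations, which are collected in null_data
    (canonical_null_data, null_data_canonical).

    Uniqueness.  The Gram determinant of x_s, x_r, x_ss, x_rr gives
    16 g^4 (K^2 - kappa^2) = 1 (conf_pow4), and as g < 0 it determines g.  Take
    the moving frame x_s, x_r, x_ss, m, where m is the vector product of the
    first three vectors.  The scalar products of the frame vectors, and those of
    their derivatives with the frame vectors, turn out to be functions of g, K,
    kappa and derivatives of these.  The only product that takes work is
    x_sss . m (xsss_m); it is here that K does not vanish.  Two frames with the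
    same products differ by a constant matrix (frame_rigidity), and this matrix
    is the linear part of the motion (motion_unique).

    Existence.  As K^2 > kappa^2, both K + kappa and K - kappa have the sign eps
    of K.  The two equations say that
      psi_1 = |K + kappa|^(-3/8) |K - kappa|^(1/8) and
      psi_2 = |K + kappa|^(1/8) |K - kappa|^(-3/8)
    solve one and the same Liouville equation psi psi_sr - psi_s psi_r = eps/4
    (liouville_psi).  For such a psi the quotient psi_ss / psi is a function of
    s alone, so psi and psi_r solve a common linear equation in s, and psi splits
    as x1(s) y2(r) - x2(s) y1(r) with constant Wronskians (liouville_factor); the
    factors are explicit in psi, and no differential equation has to be solved.
    Identify R^4_2 with the 2x2 matrices, the scalar square being minus the
    determinant.  Simple tensors are null vectors there.  If the pairs xi(s),
    rho(r) split psi_1 and the pairs eta(s), tau(r) split psi_2, the surface with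
    x_s equal to the tensor product of xi and eta, and x_r to that of rho and
    tau, is found by integrating functions of one variable (tensor_surface).  It
    has g = - psi_1 psi_2 / 2, and the values of the Wronskians make it canonical
    with curvatures K and kappa (spinor_surface). *)

Local Notation normal_space := Defs.normal_space.
Local Notation dim := Defs.dim.
Local Notation derivD := Defs.derivD.

(** * Directional derivatives in the plane *)
Section Derivatives.
Variable R : realType.
Local Notation plane := 'rV[R]_2.
Implicit Types (f g : plane -> R) (p v w : plane).

Lemma deriv_mul f g p v : differentiable f p -> differentiable g p ->
  'D_v (fun q => f q * g q) p = 'D_v f p * g p + f p * 'D_v g p.
Proof.
move=> df dg; rewrite deriveM; [|exact: diff_derivable..].
by rewrite addrC /GRing.scale /= [g p * _]mulrC.
Qed.

Lemma deriv_add (W : normedModType R) (F G : plane -> W) p v :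
  differentiable F p -> differentiable G p ->
  'D_v (fun q => F q + G q) p = 'D_v F p + 'D_v G p.
Proof. by move=> dF dG; rewrite deriveD//; exact: diff_derivable. Qed.

Lemma deriv_opp (W : normedModType R) (F : plane -> W) p v :
  differentiable F p -> 'D_v (fun q => - F q) p = - 'D_v F p.
Proof. by move=> dF; rewrite deriveN//; exact: diff_derivable. Qed.

Lemma deriv_sub (W : normedModType R) (F G : plane -> W) p v :
  differentiable F p -> differentiable G p ->
  'D_v (fun q => F q - G q) p = 'D_v F p - 'D_v G p.
Proof. by move=> dF dG; rewrite deriveB//; exact: diff_derivable. Qed.

Lemma deriv_cst (W : normedModType R) (c : W) p v : 'D_v (fun=> c) p = 0.
Proof. exact: derive_cst. Qed.

Lemma deriv_dir (W : normedModType R) (F : plane -> W) p a b v w :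
  differentiable F p ->
  'D_(a *: v + b *: w) F p = a *: 'D_v F p + b *: 'D_w F p.
Proof. by move=> dF; rewrite !deriveE// linearD !linearZ. Qed.

Lemma deriv_chain (h : R -> R) (dh : R) f p v : differentiable f p ->
  is_derive (f p) 1 h dh -> 'D_v (h \o f) p = dh * 'D_v f p.
Proof.
move=> df ih.
have dh' : differentiable h (f p) by apply/derivable1_diffP; exact: ex_derive.
have <- : 'D_1 h (f p) = dh by case: ih.
rewrite !deriveE//; last exact: differentiable_comp.
rewrite diff_comp//= -[X in 'd h _ X = _]mulr1.
by rewrite [LHS]linearZ /= mulrC.
Qed.

Lemma diff_chain (h : R -> R) (dh : R) f p : differentiable f p ->
  is_derive (f p) 1 h dh -> differentiable (h \o f) p.
Proof.
move=> df ih; apply: differentiable_comp => //.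
by apply/derivable1_diffP; exact: ex_derive.
Qed.

Lemma deriv_near (W : normedModType R) (F G : plane -> W) p v (U : set plane) :
  open U -> U p -> (forall q, U q -> F q = G q) -> 'D_v F p = 'D_v G p.
Proof.
move=> oU Up FG; apply: near_eq_derive.
by apply: filterS (open_nbhs_nbhs (conj oU Up)) => q; exact: FG.
Qed.

Lemma diff_near (W : normedModType R) (F G : plane -> W) p (U : set plane) :
  open U -> U p -> (forall q, U q -> F q = G q) ->
  differentiable F p -> differentiable G p.
Proof.
move=> oU Up FG dF.
have nU : \forall q \near p, U q by apply: open_nbhs_nbhs.
have [dc dl] := (diff_locallyP _ _).1 dF.
have key : (G \o shift p : plane -> W) = cst (G p) + 'd F p +o_ (0 : plane) id.
  apply/eqaddoP => e e0.
  have := (eqaddoP _ _ _ _).1 dl e e0.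
  have nU0 : \forall h \near (0 : plane), U (h + p).
    by move: nU; rewrite (near_shift 0) subr0.
  apply: filterS2 nU0 => h Uh /=.
  by rewrite !fctE /= -(FG _ Up) -(FG _ Uh).
apply/diff_locallyP; rewrite (diff_unique dc key); split=> //.
Qed.

Lemma deriv_entry m n (F : plane -> 'M[R]_(m, n)) p v i j :
  differentiable F p -> 'D_v F p i j = 'D_v (fun q => F q i j) p.
Proof.
by move=> dF; rewrite derive_mx ?mxE//; exact: diff_derivable.
Qed.

Lemma diff_entry m n (F : plane -> 'M[R]_(m, n)) p i j :
  differentiable F p -> differentiable (fun q => F q i j) p.
Proof.
move=> dF; have := @differentiable_comp _ _ _ _ F (fun N => N i j) p dF.
by apply; exact: differentiable_coord.
Qed.

Lemma diff_mx m n (F : plane -> 'M[R]_(m, n)) p :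
  (forall i j, differentiable (fun q => F q i j) p) -> differentiable F p.
Proof.
move=> dF.
have -> : F = fun q => \sum_(k < m) \sum_(l < n) (F q k l *: delta_mx k l).
  by apply/funext => q; rewrite -matrix_sum_delta.
have sumE k0 (h : 'I_k0 -> plane -> 'M[R]_(m, n)) :
    (fun q => \sum_k h k q) = \sum_k h k.
  by apply/funext => q; rewrite fct_sumE.
rewrite sumE; apply: differentiable_sum => k.
rewrite sumE; apply: differentiable_sum => l.
exact: differentiableZl.
Qed.
End Derivatives.

(** * Smooth functions *)
Section Smoothness.
Variable R : realType.
Local Notation plane := 'rV[R]_2.
Implicit Types (D U : set plane) (p v w : plane).

Lemma Cn_eq n (W : normedModType R) D (f g : plane -> W) : open D ->
  (forall p, D p -> f p = g p) -> Cn n D f -> Cn n D g.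
Proof.
move=> oD; elim: n f g => [|n IH] f g fg /=.
  move=> cf p Dp; rewrite /prop_for /continuous_at -fg//.
  have E : \forall q \near p, f q = g q.
    by apply: filterS (open_nbhs_nbhs (conj oD Dp)) => q; exact: fg.
  exact: cvg_trans (near_eq_cvg E) (cf _ Dp).
move=> [df cf]; split=> [p Dp|i]; first exact: (diff_near oD Dp fg (df _ Dp)).
apply: (IH (partial i f)) (cf i) => p Dp.
exact: deriv_near oD Dp fg.
Qed.

Lemma smooth_eq (W : normedModType R) D (f g : plane -> W) : open D ->
  (forall p, D p -> f p = g p) -> smooth D f -> smooth D g.
Proof. by move=> oD fg sf n; exact: Cn_eq oD fg (sf n). Qed.

Lemma smooth_sub (W : normedModType R) D U (f : plane -> W) :
  U `<=` D -> smooth D f -> smooth U f.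
Proof.
move=> UD sf n; elim: n f {sf}(sf n) => [|n IH] f /=.
  by move=> cf p /UD; exact: cf.
by move=> [df cf]; split=> [p /UD|i]; [exact: df|exact: IH].
Qed.

Lemma smooth_diff (W : normedModType R) D (f : plane -> W) p :
  smooth D f -> D p -> differentiable f p.
Proof. by move=> /(_ 1)[df _]; exact: df. Qed.

Lemma smooth_partial (W : normedModType R) D (f : plane -> W) i :
  smooth D f -> smooth D (partial i f).
Proof. by move=> sf n; have [_ cf] := sf n.+1; exact: cf. Qed.

(** A class of differentiable functions that contains, up to equality on D, the
    partial derivatives of its members consists of smooth functions.  The closure
    properties of smoothness below are instances. *)
Lemma smooth_coind (W : normedModType R) D (P : (plane -> W) -> Prop) :
  open D ->
  (forall f, P f -> (forall p, D p -> differentiable f p) /\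
    forall i, exists2 g, P g & forall p, D p -> partial i f p = g p) ->
  forall f, P f -> smooth D f.
Proof.
move=> oD HP f Pf n; elim: n f Pf => [|n IH] f Pf /=.
  by move=> p Dp; apply: differentiable_continuous; exact: (HP f Pf).1.
split=> [|i]; first exact: (HP f Pf).1.
have [g Pg fg] := (HP f Pf).2 i.
by apply: Cn_eq (IH g Pg) => // p Dp; rewrite fg.
Qed.

Lemma smooth_cst (W : normedModType R) D (c : W) : open D ->
  smooth D (fun=> c).
Proof.
move=> oD; apply: (@smooth_coind W D (fun f => exists c, f = fun=> c)) => //.
  move=> _ [{}c ->]; split=> [p _|i]; first exact: differentiable_cst.
  by exists (fun=> 0); [exists 0|move=> p _; exact: deriv_cst].
by exists c.
Qed.

(** The closure of the smooth functions under the elementary operations is stable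
    under partial derivatives, so that the rules for sums, products, inverses,
    exponentials, logarithms and roots come from a single use of [smooth_coind]. *)
Inductive elementary D : (plane -> R) -> Prop :=
| elem_smooth f : smooth D f -> elementary D f
| elem_add f g : elementary D f -> elementary D g ->
    elementary D (fun p => f p + g p)
| elem_mul f g : elementary D f -> elementary D g ->
    elementary D (fun p => f p * g p)
| elem_inv f : elementary D f -> (forall p, D p -> f p != 0) ->
    elementary D (fun p => (f p)^-1)
| elem_exp f : elementary D f -> elementary D (fun p => expR (f p))
| elem_ln f : elementary D f -> (forall p, D p -> 0 < f p) ->
    elementary D (fun p => ln (f p))
| elem_sqrt f : elementary D f -> (forall p, D p -> 0 < f p) ->
    elementary D (fun p => Num.sqrt (f p)).

Lemma deriv_inv (f : plane -> R) p v : differentiable f p -> f p != 0 ->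
  'D_v (fun q => (f q)^-1) p = - ('D_v f p * (f p)^-1 * (f p)^-1).
Proof.
move=> df f0; rewrite deriveV//; last exact: diff_derivable.
by rewrite /GRing.scale /= mulNr expr2 invfM -mulrA mulrC.
Qed.

Lemma deriv_exp (f : plane -> R) p v : differentiable f p ->
  'D_v (fun q => expR (f q)) p = 'D_v f p * expR (f p).
Proof. by move=> df; rewrite mulrC; apply: deriv_chain. Qed.

Lemma deriv_ln (f : plane -> R) p v : differentiable f p -> 0 < f p ->
  'D_v (fun q => ln (f q)) p = 'D_v f p * (f p)^-1.
Proof.
by move=> df f0; rewrite mulrC; apply: deriv_chain => //; exact: is_derive1_ln.
Qed.

Lemma deriv_sqrt (f : plane -> R) p v : differentiable f p -> 0 < f p ->
  'D_v (fun q => Num.sqrt (f q)) p = 'D_v f p * (2 * Num.sqrt (f p))^-1.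
Proof.
move=> df f0; rewrite mulrC.
by apply: deriv_chain => //; exact: is_derive1_sqrt.
Qed.

Lemma elementary_smooth D f : open D -> elementary D f -> smooth D f.
Proof.
move=> oD; apply: smooth_coind => // {}f.
elim=> {f}.
- move=> f sf; split=> [p|i]; first exact: smooth_diff.
  exists (partial i f) => //; apply: elem_smooth; exact: smooth_partial.
- move=> f g ef [df pf] eg [dg pg]; split=> [p Dp|i].
    by apply: differentiableD; [exact: df|exact: dg].
  have [f' ef' ff'] := pf i; have [g' eg' gg'] := pg i.
  exists (fun p => f' p + g' p); first exact: elem_add.
  move=> p Dp; rewrite /partial deriv_add; [|exact: df|exact: dg].
  by rewrite -ff'// -gg'.
- move=> f g ef [df pf] eg [dg pg]; split=> [p Dp|i].
    by apply: differentiableM; [exact: df|exact: dg].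
  have [f' ef' ff'] := pf i; have [g' eg' gg'] := pg i.
  exists (fun p => f' p * g p + f p * g' p).
    by apply: elem_add; exact: elem_mul.
  move=> p Dp; rewrite /partial deriv_mul; [|exact: df|exact: dg].
  by rewrite -ff'// -gg'.
- move=> f ef [df pf] f0; split=> [p Dp|i].
    by apply: differentiableV; [exact: df|exact: f0].
  have [f' ef' ff'] := pf i.
  exists (fun p => -1 * (f' p * (f p)^-1 * (f p)^-1)).
    apply: elem_mul; first by apply: elem_smooth; exact: smooth_cst.
    by apply: elem_mul; [apply: elem_mul|]=> //; apply: elem_inv.
  move=> p Dp; rewrite /partial deriv_inv; [|exact: df|exact: f0].
  by rewrite -ff'// mulN1r.
- move=> f ef [df pf]; split=> [p Dp|i].
    by apply: (@diff_chain _ expR _ f) => //; exact: df.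
  have [f' ef' ff'] := pf i.
  exists (fun p => f' p * expR (f p)).
    by apply: elem_mul => //; exact: elem_exp.
  by move=> p Dp; rewrite /partial deriv_exp; [rewrite -ff'|exact: df].
- move=> f ef [df pf] f0; split=> [p Dp|i].
    apply: (@diff_chain _ (@ln R) _ f); first exact: df.
    by apply: is_derive1_ln; exact: f0.
  have [f' ef' ff'] := pf i.
  exists (fun p => f' p * (f p)^-1).
    by apply: elem_mul => //; apply: elem_inv => // p /f0; exact: lt0r_neq0.
  by move=> p Dp; rewrite /partial deriv_ln; [rewrite -ff'|exact: df|exact: f0].
- move=> f ef [df pf] f0; split=> [p Dp|i].
    apply: (@diff_chain _ Num.sqrt _ f); first exact: df.
    by apply: is_derive1_sqrt; exact: f0.
  have [f' ef' ff'] := pf i.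
  exists (fun p => f' p * (2 * Num.sqrt (f p))^-1).
    apply: elem_mul => //; apply: elem_inv => [|p /f0 fp].
      apply: elem_mul; first by apply: elem_smooth; exact: smooth_cst.
      exact: elem_sqrt.
    by rewrite mulf_neq0// gt_eqF// sqrtr_gt0.
  move=> p Dp; rewrite /partial deriv_sqrt; [|exact: df|exact: f0].
  by rewrite -ff'.
Qed.

Section Rules.
Variable D : set plane.
Hypothesis oD : open D.

Lemma smoothD (f g : plane -> R) : smooth D f -> smooth D g ->
  smooth D (fun p => f p + g p).
Proof.
by move=> *; apply: elementary_smooth => //; apply: elem_add; exact: elem_smooth.
Qed.

Lemma smoothM (f g : plane -> R) : smooth D f -> smooth D g ->
  smooth D (fun p => f p * g p).
Proof.
by move=> *; apply: elementary_smooth => //; apply: elem_mul; exact: elem_smooth.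
Qed.

Lemma smoothN (f : plane -> R) : smooth D f -> smooth D (fun p => - f p).
Proof.
move=> sf; apply: (@smooth_eq _ _ (fun p => -1 * f p)) => //.
  by move=> p _; rewrite mulN1r.
by apply: smoothM => //; exact: smooth_cst.
Qed.

Lemma smoothB (f g : plane -> R) : smooth D f -> smooth D g ->
  smooth D (fun p => f p - g p).
Proof. by move=> sf sg; apply: smoothD => //; exact: smoothN. Qed.

Lemma smoothV (f : plane -> R) : smooth D f -> (forall p, D p -> f p != 0) ->
  smooth D (fun p => (f p)^-1).
Proof.
by move=> *; apply: elementary_smooth => //; apply: elem_inv => //; exact: elem_smooth.
Qed.

Lemma smooth_exp (f : plane -> R) : smooth D f ->
  smooth D (fun p => expR (f p)).
Proof.
by move=> *; apply: elementary_smooth => //; apply: elem_exp; exact: elem_smooth.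
Qed.

Lemma smooth_ln (f : plane -> R) : smooth D f -> (forall p, D p -> 0 < f p) ->
  smooth D (fun p => ln (f p)).
Proof.
by move=> *; apply: elementary_smooth => //; apply: elem_ln => //; exact: elem_smooth.
Qed.

Lemma smooth_sqrt (f : plane -> R) : smooth D f ->
  (forall p, D p -> 0 < f p) -> smooth D (fun p => Num.sqrt (f p)).
Proof.
by move=> *; apply: elementary_smooth => //; apply: elem_sqrt => //; exact: elem_smooth.
Qed.

Lemma smooth_sum (I : Type) (r : seq I) (f : I -> plane -> R) :
  (forall i, smooth D (f i)) -> smooth D (fun p => \sum_(i <- r) f i p).
Proof.
move=> sf; elim: r => [|i r IH].
  by apply: (smooth_eq oD _ (smooth_cst 0 oD)) => p _; rewrite big_nil.
apply: (smooth_eq oD _ (smoothD (sf i) IH)) => p _; by rewrite big_cons.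
Qed.

Lemma smooth_entry m n (F : plane -> 'M[R]_(m, n)) i j :
  smooth D F -> smooth D (fun p => F p i j).
Proof.
move=> sF; apply: (@smooth_coind R D
   (fun f => exists2 F : plane -> 'M[R]_(m, n), smooth D F &
      f = fun p => F p i j)) => //; last by exists F.
move=> _ [{sF}F sF ->]; split=> [p Dp|k].
  by apply: diff_entry; exact: smooth_diff sF Dp.
exists (fun p => partial k F p i j).
  by exists (partial k F) => //; exact: smooth_partial.
by move=> p Dp; rewrite /partial deriv_entry//; exact: smooth_diff sF Dp.
Qed.

Lemma smooth_mx m n (F : plane -> 'M[R]_(m, n)) :
  (forall i j, smooth D (fun p => F p i j)) -> smooth D F.
Proof.
apply: (@smooth_coind _ D (fun F : plane -> 'M[R]_(m, n) =>
   forall i j, smooth D (fun p => F p i j))) => // {}F sF.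
have dF p : D p -> differentiable F p.
  by move=> Dp; apply: diff_mx => i j; exact: smooth_diff (sF i j) Dp.
split=> // k; exists (partial k F) => // i j.
apply: (smooth_eq oD _ (smooth_partial k (sF i j))) => p Dp.
by rewrite /partial deriv_entry//; exact: dF.
Qed.

Lemma smooth_scale m n (f : plane -> R) (F : plane -> 'M[R]_(m, n)) :
  smooth D f -> smooth D F -> smooth D (fun p => f p *: F p).
Proof.
move=> sf sF; apply: smooth_mx => i j.
apply: (smooth_eq oD _ (smoothM sf (smooth_entry i j sF))) => p _.
by rewrite mxE.
Qed.

Lemma smooth_addmx m n (F G : plane -> 'M[R]_(m, n)) :
  smooth D F -> smooth D G -> smooth D (fun p => F p + G p).
Proof.
move=> sF sG; apply: smooth_mx => i j.
apply: (smooth_eq oD _ (smoothD (smooth_entry i j sF) (smooth_entry i j sG))).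
by move=> p _; rewrite mxE.
Qed.

Lemma smooth_deriv m n (F : plane -> 'M[R]_(m, n)) v :
  smooth D F -> smooth D (fun p => 'D_v F p).
Proof.
move=> sF.
have E p : D p -> 'D_v F p = v 0 0 *: partial 0 F p + v 0 1 *: partial 1 F p.
  move=> Dp; rewrite /partial -deriv_dir; last exact: smooth_diff sF Dp.
  congr ('D_ _ F p); apply/rowP => i; rewrite !mxE.
  by case: i => -[|[|]]//= i; rewrite ?mulr1 ?mulr0 ?addr0 ?add0r;
    congr (v _ _); apply/val_inj.
apply: (smooth_eq oD (fun p Dp => esym (E p Dp))).
by apply: smooth_addmx; apply: smooth_scale; rewrite ?smooth_cst//;
  [exact: smooth_cst|exact: smooth_partial|exact: smooth_cst|exact: smooth_partial].
Qed.

Lemma smooth_derivR (f : plane -> R) v :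
  smooth D f -> smooth D (fun p => 'D_v f p).
Proof.
move=> sf.
have s1 : smooth D (fun p => (\matrix_(i < 1, j < 1) f p : 'M[R]_1)).
  by apply: smooth_mx => i j; apply: (smooth_eq oD _ sf) => p _; rewrite mxE.
have := smooth_entry 0 0 (smooth_deriv v s1); apply: smooth_eq => // p Dp.
rewrite deriv_entry; last exact: smooth_diff s1 Dp.
by congr ('D_v _ p); apply/funext => q; rewrite mxE.
Qed.

End Rules.
End Smoothness.

(** * Mean values, connected domains and symmetry of second derivatives *)
Section Lines.
Variable R : realType.
Local Notation plane := 'rV[R]_2.
Implicit Types (D U : set plane) (p q v w : plane) (t e : R).

Lemma line_deriv (W : normedModType R) (F : plane -> W) p v t :
  differentiable F (p + t *: v) ->
  is_derive t 1 (fun s : R => F (p + s *: v)) ('D_v F (p + t *: v)).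
Proof.
move=> dF.
have dl : is_diff t (fun s : R => p + s *: v) (fun s : R => s *: v).
  apply: is_diff_eq.
  by apply/funext => s; rewrite /= add0r.
have dFl : differentiable (F \o (fun s : R => p + s *: v)) t.
  by apply: differentiable_comp => //.
apply: DeriveDef; first exact: diff_derivable.
rewrite deriveE// diff_comp//= deriveE//.
by rewrite [X in 'd F _ X](_ : _ = v)// diff_val scale1r.
Qed.

Lemma mean_value (f : plane -> R) p v t : 0 <= t ->
  (forall s, 0 <= s <= t -> differentiable f (p + s *: v)) ->
  exists2 s, 0 <= s <= t & f (p + t *: v) - f p = 'D_v f (p + s *: v) * t.
Proof.
move=> t0 df.
have dl s : s \in `]0, t[%R ->
    is_derive s 1 (fun s => f (p + s *: v)) ('D_v f (p + s *: v)).
  rewrite in_itv /= => /andP[s0 st].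
  by apply: line_deriv; apply: df; rewrite !ltW.
have cl : {within `[0, t], continuous (fun s : R => f (p + s *: v))}.
  apply: derivable_within_continuous => s; rewrite in_itv /= => s01.
  by have [] := line_deriv (df _ s01).
have [s] := MVT_segment t0 dl cl.
by rewrite in_itv /= scale0r addr0 subr0 => s0t ->; exists s.
Qed.

Lemma const_segment m n (F : plane -> 'M[R]_(m, n)) p v :
  (forall s, 0 <= s <= 1 -> differentiable F (p + s *: v)) ->
  (forall s, 0 <= s <= 1 -> 'D_v F (p + s *: v) = 0) ->
  F (p + v) = F p.
Proof.
move=> dF F0; apply/matrixP => i j; apply/eqP; rewrite -subr_eq0; apply/eqP.
have [|s s01] := @mean_value (fun q => F q i j) p v 1 ler01.
  by move=> s s01; apply: diff_entry; exact: dF.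
by rewrite scale1r => ->; rewrite -deriv_entry ?F0 ?mxE ?mul0r//; exact: dF.
Qed.

Lemma ball_segment p q e t : ball p e q -> 0 <= t <= 1 ->
  ball p e (p + t *: (q - p)).
Proof.
rewrite -!ball_normE /= => pq /andP[t0 t1].
rewrite opprD addrA subrr add0r normrN normrZ ger0_norm// distrC.
by apply: le_lt_trans pq; rewrite ler_piMl.
Qed.

Lemma const_ball m n (F : plane -> 'M[R]_(m, n)) p e q :
  (forall q', ball p e q' -> differentiable F q') ->
  (forall q' v, ball p e q' -> 'D_v F q' = 0) -> ball p e q -> F q = F p.
Proof.
move=> dF F0 pq; rewrite -[in LHS](subrKC p q).
by apply: const_segment => s s01; [apply: dF|apply: F0]; exact: ball_segment.
Qed.

(** The sets where F takes a given value and where it does not are both open. *)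
Lemma const_connected m n (F : plane -> 'M[R]_(m, n)) D : domain D ->
  (forall q, D q -> differentiable F q) ->
  (forall q v, D q -> 'D_v F q = 0) ->
  forall p q, D p -> D q -> F q = F p.
Proof.
move=> [oD cD] dF F0 p q Dp Dq.
have loc y : D y -> exists2 e : R, 0 < e & forall z, ball y e z -> D z /\ F z = F y.
  move=> Dy; have /nbhs_ballP[e e0 yeD] := open_nbhs_nbhs (conj oD Dy).
  exists e => // z yz; split; first exact: yeD.
  by apply: const_ball yz => [z' /yeD|z' v /yeD]; [exact: dF|exact: F0].
have oP (P : 'M[R]_(m, n) -> Prop) : open [set y | D y /\ P (F y)].
  rewrite openE => y [Dy Py]; have [e e0 ye] := loc y Dy.
  apply/nbhs_ballP; exists e => // z /ye[Dz Fz].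
  by split=> //; rewrite Fz.
suff E : [set y | D y /\ F y = F p] = D by move: Dq; rewrite -E => -[].
apply: cD.
- by exists p.
- exists [set y | D y /\ F y = F p]; first exact: (oP (fun X => X = F p)).
  by apply/seteqP; split=> y [] //= ? [].
- exists (~` [set y | D y /\ F y <> F p]).
    by apply: open_closedC; exact: (oP (fun X => X <> F p)).
  apply/seteqP; split=> y [/= Dy H]; split=> //.
    by case=> _; apply.
  by apply: contrapT => H'; apply: H.
Qed.

(** The second difference of f over the parallelogram spanned by h v and h w is
    the increment along h v of the first difference along h w.  The mean value
    theorem turns it into h times a difference of two values of D_v f, which the
    differentiability of D_v f at p evaluates up to o(h). *)
Lemma second_difference (f : plane -> R) D p v w : open D -> smooth D f -> D p ->
  forall e, 0 < e -> exists2 d, 0 < d & forall h, 0 < h < d ->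
   `|f (p + h *: w + h *: v) - f (p + h *: w) - (f (p + h *: v) - f p)
     - h ^+ 2 * 'D_w (fun q => 'D_v f q) p| <= e * h ^+ 2.
Proof.
move=> oD sf Dp e e0.
pose g := fun q => 'D_v f q.
have dg : differentiable g p by apply: smooth_diff Dp; exact: smooth_derivR.
pose M := 2 * `|v| + `|w| + 1.
have M0 : 0 < M by rewrite /M ltr_wpDl// addr_ge0// mulr_ge0.
have nD : \forall y \near p, D y by apply: open_nbhs_nbhs.
have nD0 : \forall y \near (0 : plane), D (y + p).
  by move: nD; rewrite (near_shift 0) subr0.
have := (eqaddoP _ _ _ _).1 (diff_locally dg) (e / 2 / M) (divr_gt0 (divr_gt0 e0 (ltr0n _ 2)) M0).
move=> nO.
have [r r0 H] : exists2 r : R, 0 < r & forall y : plane, ball (0 : plane) r y ->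
    D (y + p) /\ `|g (y + p) - (g p + 'd g p y)| <= e / 2 / M * `|y|.
  suff : nbhs (0 : plane) [set y | D (y + p) /\
      `|g (y + p) - (g p + 'd g p y)| <= e / 2 / M * `|y|].
    by move=> /nbhs_ballP[r r0 H]; exists r.
  by apply: filterS2 nD0 nO => y.
exists (r / M); first exact: divr_gt0.
move=> h /andP[h0 hr].
have small (s : R) (b : bool) : 0 <= s <= h ->
    `|s *: v + (if b then h else 0) *: w| <= h * M /\
    `|s *: v + (if b then h else 0) *: w| < r.
  move=> /andP[s0 sh].
  have A : `|s *: v + (if b then h else 0) *: w| <= h * (`|v| + `|w|).
    rewrite (le_trans (ler_normD _ _))// !normrZ mulrDr lerD//.
      by rewrite ler_wpM2r// ger0_norm.
    by case: b; [rewrite gtr0_norm|rewrite normr0 mul0r mulr_ge0// ltW].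
  have B : h * (`|v| + `|w|) <= h * M.
    rewrite ler_wpM2l ?(ltW h0)// /M -[leLHS]addr0 lerD// lerD//.
    by rewrite mulr_natl mulr2n lerDl.
  split; first exact: le_trans B.
  apply: (le_lt_trans A); apply: (le_lt_trans B).
  by rewrite -ltr_pdivlMr.
have inball (y : plane) : `|y| < r -> ball (0 : plane) r y.
  by rewrite -ball_normE /= sub0r normrN.
pose F q := f (q + h *: w) - f q.
have dsh q : D (q + h *: w) -> differentiable (fun q' => f (q' + h *: w)) q.
  move=> Dq; apply: (@differentiable_comp _ _ _ _ (fun q' => q' + h *: w)) => //.
  exact: smooth_diff sf Dq.
have Dsh q : D (q + h *: w) -> 'D_v (fun q' => f (q' + h *: w)) q = g (q + h *: w).
  move=> Dq; have dfq := smooth_diff sf Dq.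
  rewrite deriveE; last exact: dsh.
  rewrite (@diff_comp _ _ _ _ (fun q' => q' + h *: w))// /g deriveE//=.
  congr ('d f _ _).
  have di : is_diff q (fun q' : plane => q' + h *: w) (fun y : plane => y).
    by apply: is_diff_eq; apply/funext => y; rewrite /= addr0.
  by rewrite diff_val.
have Dpt s : 0 <= s <= h -> D (p + s *: v) /\ D (p + s *: v + h *: w).
  move=> sh; have [_ A] := small s false sh; have [_ B] := small s true sh.
  have [+ _] := H _ (inball _ A); have [+ _] := H _ (inball _ B).
  rewrite /= scale0r addr0 => Hb Ha.
  by split; [rewrite addrC|rewrite -addrA addrC].
have [] := @mean_value F p v h (ltW h0).
  move=> s /Dpt[A B]; apply: differentiableB; first exact: dsh.
  exact: smooth_diff sf A.
move=> s sh; have [A B] := Dpt s sh.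
rewrite /F deriv_sub; [|exact: dsh|exact: smooth_diff sf A].
rewrite Dsh// -/(g (p + s *: v)) => E.
rewrite -[p + h *: w + _]addrA [h *: w + _]addrC addrA.
have -> : f (p + h *: v + h *: w) - f (p + h *: w) - (f (p + h *: v) - f p) =
  f (p + h *: v + h *: w) - f (p + h *: v) - (f (p + h *: w) - f p) by ring.
rewrite E.
have [s1 r1] := small s true sh; have [s2 r2] := small s false sh.
have [_] := H _ (inball _ r1); have [_] := H _ (inball _ r2).
rewrite /= !scale0r !addr0.
move=> O2 O1.
have D1 : 'd g p (s *: v + h *: w) = s * 'd g p v + h * 'd g p w.
  by rewrite linearD !linearZ.
have D2 : 'd g p (s *: v) = s * 'd g p v by rewrite linearZ.
have gw : 'D_w g p = 'd g p w by rewrite deriveE.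
rewrite -/g gw.
rewrite [_ + p]addrC addrA D1 in O1.
rewrite [_ + p]addrC D2 in O2.
have eM (x : R) : x <= h * M -> e / 2 / M * x <= e / 2 * h.
  move=> xM; rewrite -[leLHS]mulrA [_^-1 * x]mulrC.
  by rewrite ler_wpM2l ?divr_ge0 ?(ltW e0)// ler_pdivrMr.
have n1 := le_trans O1 (eM _ s1).
rewrite scale0r addr0 in s2.
have n2 := le_trans O2 (eM _ s2).
set a := g (p + s *: v + h *: w) in n1 *.
set b := g (p + s *: v) in n2 *.
have -> : (a - b) * h - h ^+ 2 * 'd g p w =
   h * ((a - (g p + (s * 'd g p v + h * 'd g p w))) - (b - (g p + s * 'd g p v))).
  ring.
rewrite normrM gtr0_norm//.
have -> : e * h ^+ 2 = h * (e / 2 * h + e / 2 * h) by field.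
rewrite ler_wpM2l ?(ltW h0)//; apply: (le_trans (ler_normB _ _)).
exact: lerD.
Qed.

(** The second difference is symmetric in v and w, so that both iterated
    derivatives are its limit after division by h^2. *)
Lemma deriv_comm_entry (f : plane -> R) D p v w : open D -> smooth D f -> D p ->
  'D_w (fun q => 'D_v f q) p = 'D_v (fun q => 'D_w f q) p.
Proof.
move=> oD sf Dp; apply/eqP; rewrite -subr_eq0 -normr_eq0 eq_le normr_ge0 andbT.
apply/ler_addgt0Pl => e e0; rewrite addr0.
have e20 : 0 < e / 2 by rewrite divr_gt0.
have [d1 d10 H1] := second_difference v w oD sf Dp e20.
have [d2 d20 H2] := second_difference w v oD sf Dp e20.
pose h := Num.min d1 d2 / 2.
have m0 : 0 < Num.min d1 d2 by rewrite lt_min d10.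
have h0 : 0 < h by rewrite divr_gt0.
have hm : h < Num.min d1 d2 by rewrite ltr_pdivrMr// ltr_pMr// ltr1n.
have /andP[hd1 hd2] : (h < d1) && (h < d2) by rewrite -lt_min.
have := H1 h; rewrite h0 hd1 => /(_ isT) A1.
have := H2 h; rewrite h0 hd2 => /(_ isT) A2.
rewrite [p + h *: v + h *: w]addrAC in A2.
set s := f (p + h *: w + h *: v) in A1 A2.
set a := 'D_w _ p in A1 *; set b := 'D_v _ p in A2 *.
have h20 : 0 < h ^+ 2 by rewrite exprn_gt0.
rewrite -(ler_pM2l h20) -{1}(gtr0_norm h20) -normrM.
have -> : h ^+ 2 * (a - b) =
  (s - f (p + h *: v) - (f (p + h *: w) - f p) - h ^+ 2 * b) -
  (s - f (p + h *: w) - (f (p + h *: v) - f p) - h ^+ 2 * a) by ring.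
apply: (le_trans (ler_normB _ _)); apply: (le_trans (lerD A2 A1)).
by have -> : e / 2 * h ^+ 2 + e / 2 * h ^+ 2 = h ^+ 2 * e by field.
Qed.

Lemma deriv_comm m n (F : plane -> 'M[R]_(m, n)) D p v w :
  open D -> smooth D F -> D p ->
  'D_w (fun q => 'D_v F q) p = 'D_v (fun q => 'D_w F q) p.
Proof.
move=> oD sF Dp; apply/matrixP => i j.
have sDF u : smooth D ('D_u F : plane -> 'M[R]_(m, n)) by exact: smooth_deriv.
have dF u : differentiable ('D_u F : plane -> 'M[R]_(m, n)) p.
  exact: smooth_diff (sDF u) Dp.
apply: (etrans (deriv_entry w i j (dF v))).
apply: (etrans _ (esym (deriv_entry v i j (dF w)))).
have E u u' : 'D_u (fun q => ('D_u' F q) i j : R) p =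
    'D_u (fun q => 'D_u' (fun q' => F q' i j) q) p.
  apply: (deriv_near u oD Dp) => q Dq.
  by rewrite deriv_entry//; exact: smooth_diff sF Dq.
apply: (etrans (E w v)); apply: (etrans _ (esym (E v w))).
by apply: deriv_comm_entry Dp => //; exact: smooth_entry.
Qed.
End Lines.

(** * Null coordinates *)
(** Throughout, [false] stands for the null coordinate s = u + v and [true] for
    r = u - v; [nvec] is the direction of d/ds or d/dr, and [ncoord] is the
    component of a tangent vector along it. *)
Definition nvec (R : realType) (b : bool) : 'rV[R]_2 :=
  \row_j if j == 0 then 2^-1 else (-1) ^+ b / 2.
Arguments nvec {R} b.

Definition ncoord (R : realType) (b : bool) (p : 'rV[R]_2) : R :=
  p 0 0 + (-1) ^+ b * p 0 1.

(** The null derivatives d/ds and d/dr. *)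
HB.lock Definition Dn (R : realType) (W : normedModType R) (b : bool)
  (F : 'rV[R]_2 -> W) (p : 'rV[R]_2) : W := 'D_(nvec b) F p.

Section Null.
Variable R : realType.
Local Notation plane := 'rV[R]_2.
Implicit Types (D U : set plane) (p q v w : plane) (b : bool).

Lemma Dn_def (W : normedModType R) b (F : plane -> W) p :
  Dn b F p = 'D_(nvec b) F p.
Proof. by rewrite unlock. Qed.

Lemma rV2E v : v = v 0 0 *: delta_mx 0 0 + v 0 1 *: delta_mx 0 1.
Proof.
apply/rowP => i; rewrite !mxE.
by case: i => -[|[|]]//= i; rewrite ?mulr1 ?mulr0 ?addr0 ?add0r;
    congr (v _ _); apply/val_inj.
Qed.

Lemma ncoordD b v w : ncoord b (v + w) = ncoord b v + ncoord b w.
Proof. by rewrite /ncoord !mxE; ring. Qed.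

Lemma ncoordZ b k v : ncoord b (k *: v) = k * ncoord b v.
Proof. by rewrite /ncoord !mxE; ring. Qed.

Lemma ncoordB b v w : ncoord b (v - w) = ncoord b v - ncoord b w.
Proof. by rewrite /ncoord !mxE; ring. Qed.

Lemma ncoord_nvec b b' : ncoord b (@nvec R b') = (b == b')%:R.
Proof. by case: b; case: b'; rewrite /ncoord !mxE /=; field. Qed.

Lemma nvec_dec v : v = ncoord false v *: nvec false + ncoord true v *: nvec true.
Proof.
by rewrite [LHS]rV2E; apply/rowP => -[[|[|]]//= i];
  rewrite !mxE /ncoord /=; field.
Qed.

Lemma deriv_nvec (W : normedModType R) (F : plane -> W) p v :
  differentiable F p ->
  'D_v F p = ncoord false v *: Dn false F p + ncoord true v *: Dn true F p.
Proof. by move=> dF; rewrite !Dn_def -deriv_dir// -nvec_dec. Qed.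

Lemma partial0E (W : normedModType R) (F : plane -> W) p : differentiable F p ->
  partial 0 F p = Dn false F p + Dn true F p.
Proof.
move=> dF; rewrite /partial deriv_nvec// /ncoord !mxE /= mulr0 addr0.
by rewrite mulr0 addr0 !scale1r.
Qed.

Lemma partial1E (W : normedModType R) (F : plane -> W) p : differentiable F p ->
  partial 1 F p = Dn false F p - Dn true F p.
Proof.
move=> dF; rewrite /partial deriv_nvec// /ncoord !mxE /= !mulr1 !add0r.
by rewrite scale1r scaleN1r.
Qed.

Section Rules.
Variables (b : bool) (p : plane).

Lemma Dn_mul (f g : plane -> R) : differentiable f p -> differentiable g p ->
  Dn b (fun q => f q * g q) p = Dn b f p * g p + f p * Dn b g p.
Proof. by move=> df dg; rewrite !Dn_def deriv_mul. Qed.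

Lemma Dn_add (W : normedModType R) (F G : plane -> W) :
  differentiable F p -> differentiable G p ->
  Dn b (fun q => F q + G q) p = Dn b F p + Dn b G p.
Proof. by move=> df dg; rewrite !Dn_def deriv_add. Qed.

Lemma Dn_opp (W : normedModType R) (F : plane -> W) :
  differentiable F p -> Dn b (fun q => - F q) p = - Dn b F p.
Proof. by move=> df; rewrite !Dn_def deriv_opp. Qed.

Lemma Dn_sub (W : normedModType R) (F G : plane -> W) :
  differentiable F p -> differentiable G p ->
  Dn b (fun q => F q - G q) p = Dn b F p - Dn b G p.
Proof. by move=> df dg; rewrite !Dn_def deriv_sub. Qed.

Lemma Dn_cst (W : normedModType R) (c : W) : Dn b (fun=> c) p = 0.
Proof. by rewrite Dn_def deriv_cst. Qed.

Lemma Dn_inv (f : plane -> R) : differentiable f p -> f p != 0 ->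
  Dn b (fun q => (f q)^-1) p = - (Dn b f p * (f p)^-1 * (f p)^-1).
Proof. by move=> df f0; rewrite !Dn_def deriv_inv. Qed.

Lemma Dn_exp (f : plane -> R) : differentiable f p ->
  Dn b (fun q => expR (f q)) p = Dn b f p * expR (f p).
Proof. by move=> df; rewrite !Dn_def deriv_exp. Qed.

Lemma Dn_near (W : normedModType R) (F G : plane -> W) (U : set plane) :
  open U -> U p -> (forall q, U q -> F q = G q) -> Dn b F p = Dn b G p.
Proof. by move=> oU Up FG; rewrite !Dn_def; exact: deriv_near oU Up FG. Qed.

Lemma Dn_entry m n (F : plane -> 'M[R]_(m, n)) i j :
  differentiable F p -> Dn b F p i j = Dn b (fun q => F q i j) p.
Proof. by move=> dF; rewrite !Dn_def deriv_entry. Qed.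

Lemma diff_scale m n (f : plane -> R) (F : plane -> 'M[R]_(m, n)) :
  differentiable f p -> differentiable F p ->
  differentiable (fun q => f q *: F q) p.
Proof.
move=> df dF; apply: diff_mx => i j.
have -> : (fun q => (f q *: F q) i j) = (fun q => f q * F q i j).
  by apply/funext => q; rewrite mxE.
by apply: differentiableM => //; exact: diff_entry.
Qed.

Lemma Dn_scale m n (f : plane -> R) (F : plane -> 'M[R]_(m, n)) :
  differentiable f p -> differentiable F p ->
  Dn b (fun q => f q *: F q) p = Dn b f p *: F p + f p *: Dn b F p.
Proof.
move=> df dF; apply/matrixP => i j; rewrite Dn_entry; last exact: diff_scale.
rewrite !mxE (Dn_entry _ _ dF) -Dn_mul//; last exact: diff_entry.
by congr Dn; apply/funext => q; rewrite mxE.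
Qed.

End Rules.

Lemma smooth_Dn m n D b (F : plane -> 'M[R]_(m, n)) :
  open D -> smooth D F -> smooth D (Dn b F).
Proof. by move=> oD sF; rewrite unlock; exact: smooth_deriv. Qed.

Lemma smooth_DnR D b (f : plane -> R) :
  open D -> smooth D f -> smooth D (Dn b f).
Proof. by move=> oD sf; rewrite unlock; exact: smooth_derivR. Qed.

Lemma Dn_comm m n D b b' (F : plane -> 'M[R]_(m, n)) p :
  open D -> smooth D F -> D p -> Dn b (Dn b' F) p = Dn b' (Dn b F) p.
Proof. by move=> oD sF Dp; rewrite unlock; exact: deriv_comm oD sF Dp. Qed.

Lemma Dn_commR D b b' (f : plane -> R) p :
  open D -> smooth D f -> D p -> Dn b (Dn b' f) p = Dn b' (Dn b f) p.
Proof. by move=> oD sf Dp; rewrite unlock; exact: deriv_comm_entry oD sf Dp. Qed.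

(** A rectangle in the null coordinates: with a point it contains the projections
    of that point to the two null lines through the centre. *)
Definition diamond p (e : R) : set plane :=
  [set q | forall b, `|ncoord b (q - p)| < e].

Lemma diff_ncoord b p q : differentiable (fun q => ncoord b (q - p)) q.
Proof.
have -> : (fun q => ncoord b (q - p)) =
    fun q => (q 0 0 + (-1) ^+ b * q 0 1) - ncoord b p.
  by apply/funext => y; rewrite ncoordB.
apply: differentiableB => //; apply: differentiableD.
  exact: differentiable_coord.
by apply: differentiableM => //; exact: differentiable_coord.
Qed.

Lemma open_diamond p e : open (diamond p e).
Proof.
have -> : diamond p e =
   [set q | `|ncoord false (q - p)| < e] `&` [set q | `|ncoord true (q - p)| < e].
  by apply/seteqP; split=> q; [move=> H; split; exact: H|move=> [H1 H2] []].
have H b : open [set q | `|ncoord b (q - p)| < e].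
  have -> : [set q | `|ncoord b (q - p)| < e] =
      (fun q => ncoord b (q - p)) @^-1` ball (0 : R) e.
    by apply/seteqP; split=> q; rewrite /= -ball_normE /= sub0r normrN.
  apply: open_comp; last exact: ball_open.
  move=> q _; exact: differentiable_continuous (diff_ncoord b p q).
by apply: openI.
Qed.

Lemma diamond_center p e : 0 < e -> diamond p e p.
Proof. by move=> e0 b; rewrite subrr /ncoord !mxE mulr0 addr0 normr0. Qed.

Lemma sub_diamond p e e' : e <= e' -> diamond p e `<=` diamond p e'.
Proof. by move=> ee q Hq b; exact: lt_le_trans (Hq b) ee. Qed.

Lemma diamond_ball p e : 0 < e -> diamond p e `<=` ball p e.
Proof.
move=> e0 q Hq; rewrite -ball_normE /= distrC.
have H1 := Hq false; have H2 := Hq true.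
have E0 : (q - p) 0 0 = (ncoord false (q - p) + ncoord true (q - p)) / 2.
  by rewrite /ncoord /=; field.
have E1 : (q - p) 0 1 = (ncoord false (q - p) - ncoord true (q - p)) / 2.
  by rewrite /ncoord /=; field.
have F (x y : R) : `|x| < e -> `|y| < e -> `|(x + y) / 2| < e.
  by rewrite !ltr_norml => /andP[? ?] /andP[? ?]; lra.
rewrite [ltLHS]/Num.Def.normr/= mx_normrE (bigmax_lt _ e0)//= => -[i j] _ /=.
rewrite ord1; case: j => -[|[|]]//= j.
  by rewrite (_ : Ordinal j = 0); [rewrite E0 F|apply/val_inj].
by rewrite (_ : Ordinal j = 1); [rewrite E1 F ?normrN|apply/val_inj].
Qed.

Lemma connected_diamond p e : 0 < e -> connected (diamond p e).
Proof.
move=> e0.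
have -> : diamond p e =
   \bigcup_(q in diamond p e) ((fun t : R => p + t *: (q - p)) @` `[0, 1]).
  apply/seteqP; split=> [q Hq|q [q' Hq' [t /=]]].
    exists q => //; exists 1; first by rewrite /= in_itv /= ler01 lexx.
    by rewrite scale1r subrKC.
  rewrite in_itv /= => /andP[t0 t1] <- b.
  rewrite addrAC subrr add0r ncoordZ normrM ger0_norm//.
  by apply: le_lt_trans (Hq' b); rewrite ler_piMl.
apply: bigcup_connected.
  exists p => q Hq; exists 0; first by rewrite /= in_itv /= ler01 lexx.
  by rewrite scale0r addr0.
move=> q Hq; apply: connected_continuous_connected.
  exact: segment_connected.
apply: continuous_subspaceT => t; apply: differentiable_continuous.
by apply: differentiableD.
Qed.

End Null.

Ltac diffs := repeat first [assumption | exact: differentiable_cst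
  | apply: differentiableM | apply: differentiableD | apply: differentiableN
  | apply: differentiableB].
Ltac Dns := repeat first [rewrite Dn_cst | rewrite Dn_mul; [|by diffs..]
  | rewrite Dn_sub; [|by diffs..] | rewrite Dn_add; [|by diffs..]
  | rewrite Dn_opp; [|by diffs..]].

Ltac gen_deriv := repeat match goal with
  |- context [@derive ?K ?V ?W ?f ?p ?v] =>
    let y := fresh "y" in generalize (@derive K V W f p v) => y end.

(** * Functions of one null coordinate and their primitives *)
Section Slices.
Variable R : realType.
Local Notation plane := 'rV[R]_2.
Implicit Types (p q v w : plane) (b : bool) (e : R).

Lemma deriv_ncoord b p q v : 'D_v (fun y => ncoord b (y - p)) q = ncoord b v.
Proof.
have -> : (fun y => ncoord b (y - p)) =
    fun y : plane => (y 0 0 + (-1) ^+ b * y 0 1) - ncoord b p.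
  by apply/funext => y; rewrite ncoordB.
have dc i : differentiable (fun y : plane => y 0 i) q.
  exact: differentiable_coord.
have Dc i : 'D_v (fun y : plane => y 0 i : R) q = v 0 i.
  by rewrite -deriv_entry// derive_id.
have dm : differentiable (fun y : plane => (-1) ^+ b * y 0 1) q.
  by apply: differentiableM.
rewrite deriv_sub//; last by apply: differentiableD.
by rewrite deriv_add// deriv_mul// !deriv_cst !Dc mul0r add0r subr0.
Qed.

(** The projection to the null line through p: composing a function with [slice b p]
    freezes its other null coordinate at the value it has at p. *)
Definition slice b p q : plane := p + ncoord b (q - p) *: nvec b.

Lemma slice_diamond b p e q : diamond p e q -> diamond p e (slice b p q).
Proof.
move=> Hq b'; rewrite /slice addrAC subrr add0r ncoordZ ncoord_nvec.
case: eqP => _; rewrite ?mulr1 ?mulr0; first exact: Hq.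
by rewrite normr0; apply: le_lt_trans (Hq b).
Qed.

Lemma slice_rest b p q :
  q = slice b p q + ncoord (~~ b) (q - p) *: nvec (~~ b).
Proof.
rewrite /slice -addrA; apply/eqP; rewrite addrC -subr_eq; apply/eqP.
by rewrite [LHS]nvec_dec; case: b => //=; rewrite addrC.
Qed.

Lemma diff_slice (f : plane -> R) b p q : differentiable f (slice b p q) ->
  differentiable (fun q => f (slice b p q)) q.
Proof.
move=> df; apply: (@differentiable_comp _ _ _ _ (slice b p)) => //.
apply: differentiableD => //.
by apply: differentiableZl; exact: diff_ncoord.
Qed.

Lemma deriv_slice (f : plane -> R) b p q v : differentiable f (slice b p q) ->
  'D_v (fun q => f (slice b p q)) q = ncoord b v * Dn b f (slice b p q).
Proof.
move=> df; rewrite deriveE; last exact: diff_slice.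
have ds : differentiable (slice b p) q.
  by apply: differentiableD => //; apply: differentiableZl; exact: diff_ncoord.
rewrite (@diff_comp _ _ _ _ (slice b p))//= -[X in 'd f _ X]deriveE//.
have -> : 'D_v (slice b p) q = ncoord b v *: nvec b.
  have -> : slice b p = fun q => (fun=> p) q + (fun q => ncoord b (q - p) *: nvec b) q.
    by [].
  rewrite deriv_add//; last by apply: differentiableZl; exact: diff_ncoord.
  rewrite deriv_cst add0r.
  apply/matrixP => i j.
  rewrite deriv_entry; last by apply: differentiableZl; exact: diff_ncoord.
  have -> : (fun y => (ncoord b (y - p) *: nvec b) i j) =
     (fun y => ncoord b (y - p) * @nvec R b i j).
    by apply/funext => y; rewrite mxE.
  rewrite deriv_mul ?deriv_cst ?mulr0 ?addr0 ?deriv_ncoord ?[RHS]mxE//.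
  exact: diff_ncoord.
by rewrite linearZ /= Dn_def deriveE.
Qed.

Lemma Dn_slice (f : plane -> R) b b' p q : differentiable f (slice b p q) ->
  Dn b' (fun q => f (slice b p q)) q = (b == b')%:R * Dn b f (slice b p q).
Proof. by move=> df; rewrite [LHS]Dn_def deriv_slice// ncoord_nvec. Qed.

Lemma smooth_slice (f : plane -> R) b p e : smooth (diamond p e) f ->
  smooth (diamond p e) (fun q => f (slice b p q)).
Proof.
move=> sf; have oD := @open_diamond R p e.
apply: (@smooth_coind R R (diamond p e) (fun g => exists c (f : plane -> R),
   smooth (diamond p e) f /\ g = fun q => c * f (slice b p q))) => //; last first.
  by exists 1, f; split=> //; apply/funext => q; rewrite mul1r.
move=> _ [c [{sf}f [sf ->]]].
have df q : diamond p e q -> differentiable f (slice b p q).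
  by move=> /(slice_diamond b); exact: smooth_diff.
split=> [q /df dq|i].
  by apply: differentiableM => //; exact: diff_slice.
exists (fun q => (c * ncoord b (delta_mx 0 i)) * Dn b f (slice b p q)).
  by eexists _, (Dn b f); split; [exact: smooth_DnR|].
move=> q /df dq; rewrite /partial deriv_mul//; last exact: diff_slice.
by rewrite deriv_cst mul0r add0r deriv_slice// mulrA.
Qed.

(** A function with vanishing derivative in one null coordinate is a function of
    the other one alone. *)
Lemma slice_const (g : plane -> R) b p e q : smooth (diamond p e) g ->
  (forall y, diamond p e y -> Dn (~~ b) g y = 0) -> diamond p e q ->
  g (slice b p q) = g q.
Proof.
move=> sg g0 Hq; apply/esym/eqP; rewrite -subr_eq0; apply/eqP.
rewrite [in g q](slice_rest b p q).
set k := ncoord _ _; set a := slice b p q.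
have seg s : 0 <= s <= 1 -> diamond p e (a + s *: (k *: nvec (~~ b))).
  move=> /andP[s0 s1] b'; rewrite addrAC ncoordD !ncoordZ ncoord_nvec.
  rewrite /a /slice [p + _ - p]addrAC subrr add0r ncoordZ ncoord_nvec /k.
  have small c : `|s * ncoord c (q - p)| < e.
    by rewrite normrM ger0_norm//; apply: le_lt_trans (Hq c); rewrite ler_piMl.
  by clear -Hq small; case: b; case: b' => /=;
     rewrite !(mulr1, mulr0, addr0, add0r).
have [|s s01] := @mean_value R g a (k *: nvec (~~ b)) 1 ler01.
  by move=> s /seg; exact: smooth_diff.
rewrite scale1r => ->; rewrite mulr1 deriv_nvec; last exact: smooth_diff (seg s s01).
rewrite !ncoordZ !ncoord_nvec.
move: (g0 _ (seg s s01)); case: (b) => /= ->.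
  by rewrite mulr0 scaler0 add0r scale0r.
by rewrite mulr0 scaler0 addr0 scale0r.
Qed.

Lemma primitive_line (G : R -> R) e : 0 < e ->
  (forall t : R, `|t| <= e -> {for t, continuous G}) ->
  exists F : R -> R, forall t : R, `|t| < e -> is_derive t 1 F (G t).
Proof.
move=> e0 cG.
have cW : {within `[- e, e], continuous G}.
  apply: continuous_in_subspaceT => t; rewrite inE /= in_itv /= => te.
  by apply: cG; rewrite ler_norml.
have iG := @continuous_compact_integrable R G _ (@segment_compact _ (-e) e) cW.
exists (fun x => \int[lebesgue_measure]_(t in `[-e, x]) G t)%R => t te.
have /andP[t1 t2] : - e < t < e by rewrite -ltr_norml.
have [dF F'] := continuous_FTC1_closed t2 iG t1 (cG _ (ltW te)).
apply: DeriveDef; first exact: dF.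
exact: (etrans (esym (derive1E _ _)) F').
Qed.

(** Integration along the null line through the centre.  The larger diamond
    provides the continuity of the integrand on the closed interval from - e to e,
    whose left end is the base point of the integral. *)
Lemma primitive (g : plane -> R) b p e e' : 0 < e -> e < e' ->
  smooth (diamond p e') g ->
  (forall y, diamond p e' y -> Dn (~~ b) g y = 0) ->
  exists h : plane -> R, [/\ smooth (diamond p e) h,
    forall y, diamond p e y -> Dn b h y = g y &
    forall y, diamond p e y -> Dn (~~ b) h y = 0].
Proof.
move=> e0 ee' sg g0; have oD := @open_diamond R p e.
have sub := @sub_diamond R p _ _ (ltW ee').
have pt t : `|t| < e' -> diamond p e' (p + t *: nvec b).
  move=> te b'; rewrite addrAC subrr add0r ncoordZ ncoord_nvec.
  by case: eqP; rewrite ?mulr1// mulr0 normr0 (lt_trans e0).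
have [|F HF] := @primitive_line (fun t => g (p + t *: nvec b)) e e0.
  move=> t te; have dg : differentiable g (p + t *: nvec b).
    by apply: smooth_diff sg _; apply: pt; exact: le_lt_trans ee'.
  have [+ _] := line_deriv dg.
  by move=> /derivable1_diffP/differentiable_continuous.
pose h q := F (ncoord b (q - p)).
have dh q : diamond p e q -> differentiable h q.
  move=> Hq; apply: (@diff_chain _ F _ (fun q => ncoord b (q - p))).
    exact: diff_ncoord.
  exact: HF (Hq b).
have Dh q v : diamond p e q -> 'D_v h q = ncoord b v * g q.
  move=> Hq; rewrite mulrC -(slice_const sg g0 (sub _ Hq)).
  rewrite -[ncoord b v](deriv_ncoord b p q v).
  apply: (@deriv_chain _ F _ (fun q => ncoord b (q - p))).
    exact: diff_ncoord.
  exact: HF (Hq b).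
exists h; split.
- move=> [|n] /=.
    by move=> q /dh; exact: differentiable_continuous.
  split=> // i.
  apply: (Cn_eq oD (f := fun q => ncoord b (delta_mx 0 i) * g q)).
    by move=> q Hq; rewrite /partial Dh.
  apply: smoothM => //; first exact: smooth_cst.
  exact: smooth_sub sub sg.
- by move=> q Hq; rewrite Dn_def Dh// ncoord_nvec eqxx mul1r.
- move=> q Hq; rewrite Dn_def Dh// ncoord_nvec.
  by case: (b) => /=; rewrite mul0r.
Qed.
End Slices.

(** * Splitting a solution of the Liouville equation *)

Section Liouville.
Variable R : realType.
Local Notation plane := 'rV[R]_2.

(** Differentiating the Liouville equation along s gives psi psi_ssr = psi_ss psi_r,
    so that Q = psi_ss / psi depends on s alone, and both psi and psi_r satisfy
    y_ss = Q y.  On the line r = r0 they are two solutions with Wronskian k, and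
    for every other r Cramer's rule writes psi as their combination with
    coefficients that do not depend on s.  The constant c moves a factor between
    the two Wronskians. *)
Lemma liouville_factor (psi : plane -> R) (t0 : plane) (e k c : R) :
  k != 0 -> c != 0 ->
  smooth (diamond t0 e) psi -> (forall p, diamond t0 e p -> psi p != 0) ->
  (forall p, diamond t0 e p ->
     psi p * Dn true (Dn false psi) p - Dn false psi p * Dn true psi p = k) ->
  exists x1 x2 y1 y2 : plane -> R,
    [/\ [/\ smooth (diamond t0 e) x1, smooth (diamond t0 e) x2,
            smooth (diamond t0 e) y1 & smooth (diamond t0 e) y2],
        (forall p, diamond t0 e p -> Dn true x1 p = 0 /\ Dn true x2 p = 0),
        (forall p, diamond t0 e p -> Dn false y1 p = 0 /\ Dn false y2 p = 0),
        (forall p, diamond t0 e p -> psi p = x1 p * y2 p - x2 p * y1 p) &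
        (forall p, diamond t0 e p ->
           x1 p * Dn false x2 p - x2 p * Dn false x1 p = c * k /\
           y1 p * Dn true y2 p - y2 p * Dn true y1 p = c^-1)].
Proof.
move=> k0 c0 spsi psi0 Hk; have oD := @open_diamond R t0 e.
set D := diamond t0 e in spsi psi0 Hk oD *.
pose ps := Dn false psi; pose pr := Dn true psi.
pose pss := Dn false ps; pose psr := Dn true ps.
have sps : smooth D ps by exact: smooth_DnR.
have spr : smooth D pr by exact: smooth_DnR.
have spss : smooth D pss by exact: smooth_DnR.
have spsr : smooth D psr by exact: smooth_DnR.
have df f p : smooth D f -> D p -> differentiable (f : plane -> R) p.
  exact: smooth_diff.
pose Q p := pss p * (psi p)^-1.
have sQ : smooth D Q by apply: smoothM => //; exact: smoothV.
have prs p : D p -> Dn false pr p = psr p by move=> Dp; exact: Dn_commR oD spsi Dp.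
have pssQ p : D p -> pss p = Q p * psi p.
  by move=> Dp; rewrite /Q mulfVK// psi0.
have Qr p : D p -> Dn true Q p = 0.
  move=> Dp; have d1 := df _ _ spsi Dp; have d2 := df _ _ sps Dp.
  have d3 := df _ _ spr Dp; have d4 := df _ _ spss Dp; have d5 := df _ _ spsr Dp.
  have dV : differentiable (fun q => (psi q)^-1) p.
    by apply: differentiableV => //; exact: psi0.
  have E : Dn false (fun q => psi q * psr q - ps q * pr q) p = 0.
    by rewrite (Dn_near (G := fun=> k) false oD Dp Hk) Dn_cst.
  move: E; Dns; rewrite prs// -/ps -/pss.
  have -> : Dn false psr p = Dn true pss p by exact: Dn_commR oD sps Dp.
  move=> E; rewrite /Q; Dns; rewrite Dn_inv ?psi0// -/pr.
  have p0 := psi0 _ Dp.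
  have -> : Dn true pss p * (psi p)^-1 + pss p * - (pr p * (psi p)^-1 * (psi p)^-1) =
     (psi p * Dn true pss p - pss p * pr p) * (psi p)^-1 * (psi p)^-1 by field.
  have -> : psi p * Dn true pss p - pss p * pr p = 0 by rewrite -E; ring.
  by rewrite !mul0r.
pose sl (f : plane -> R) p := f (slice false t0 p).
have ssl f : smooth D f -> smooth D (sl f) by exact: smooth_slice.
have Dsl p : D p -> D (slice false t0 p) by exact: slice_diamond.
have slf f p : smooth D f -> D p -> Dn false (sl f) p = sl (Dn false f) p.
  by move=> sf /Dsl Dp; rewrite Dn_slice ?mul1r//; exact: df.
have slt f p : smooth D f -> D p -> Dn true (sl f) p = 0.
  by move=> sf /Dsl Dp; rewrite Dn_slice ?mul0r//; exact: df.
have Qsl p : D p -> sl Q p = Q p by move=> Dp; exact: (@slice_const R Q false t0 e p sQ Qr Dp).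
have prss p : D p -> Dn false psr p = Q p * pr p.
  move=> Dp; have -> : Dn false psr p = Dn true pss p by exact: Dn_commR oD sps Dp.
  rewrite (Dn_near true oD Dp pssQ).
  have d1 := df _ _ spsi Dp; have d2 := df _ _ sQ Dp.
  by Dns; rewrite Qr// mul0r add0r.
(* a and b are psi and psi_r on the line r = r0, and a', b' are their derivatives. *)
pose a := sl psi; pose b := sl pr; pose a' := sl ps; pose b' := sl psr.
have sa : smooth D a by exact: ssl.
have sb : smooth D b by exact: ssl.
have sa' : smooth D a' by exact: ssl.
have sb' : smooth D b' by exact: ssl.
have W p : D p -> a p * b' p - a' p * b p = k by move=> /Dsl/Hk.
have aF p : D p -> Dn false a p = a' p by move=> Dp; rewrite slf.
have bF p : D p -> Dn false b p = b' p.
  by move=> Dp; rewrite slf// /sl prs//; exact: Dsl.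
have a'F p : D p -> Dn false a' p = Q p * a p.
  by move=> Dp; rewrite slf// -(Qsl p Dp) /sl -[Dn false ps _]/(pss _) pssQ//; exact: Dsl.
have b'F p : D p -> Dn false b' p = Q p * b p.
  by move=> Dp; rewrite slf// -(Qsl p Dp) /sl prss//; exact: Dsl.
pose y1 p := k^-1 * c^-1 * (a' p * psi p - a p * ps p).
pose y2 p := k^-1 * (b' p * psi p - b p * ps p).
have scst (x : R) : smooth D (fun=> x) by exact: smooth_cst.
exists a, (fun p => c * b p), y1, y2; split.
- split=> //; first exact: smoothM.
    by apply: smoothM => //; apply: smoothB => //; exact: smoothM.
  by apply: smoothM => //; apply: smoothB => //; exact: smoothM.
- move=> p Dp; rewrite slt//; split=> //.
  have d1 := df _ _ sb Dp.
  by Dns; rewrite slt// mulr0 mul0r addr0.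
- move=> p Dp; have d1 := df _ _ spsi Dp; have d2 := df _ _ sps Dp.
  have d3 := df _ _ sa Dp; have d4 := df _ _ sb Dp.
  have d5 := df _ _ sa' Dp; have d6 := df _ _ sb' Dp.
  rewrite /y1 /y2; Dns; rewrite a'F// b'F// aF// bF// -/ps -/pss pssQ//.
  by split; ring.
- move=> p Dp; rewrite /y1 /y2.
  have -> : a p * (k^-1 * (b' p * psi p - b p * ps p)) - c * b p *
     (k^-1 * c^-1 * (a' p * psi p - a p * ps p)) =
     (a p * b' p - a' p * b p) * k^-1 * psi p by field; rewrite k0 c0.
  by rewrite W// mulfV// mul1r.
- move=> p Dp; have d1 := df _ _ spsi Dp; have d2 := df _ _ sps Dp.
  have d3 := df _ _ sa Dp; have d4 := df _ _ sb Dp.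
  have d5 := df _ _ sa' Dp; have d6 := df _ _ sb' Dp.
  rewrite /y1 /y2; Dns; rewrite aF// bF// !slt// -/pr -/psr.
  have Wp := W _ Dp; have Hp := Hk _ Dp; rewrite -/ps -/pr -/psr in Hp.
  split; first by rewrite -Wp; ring.
  transitivity (k^-1 * k^-1 * c^-1 * (a p * b' p - a' p * b p) *
    (psi p * psr p - ps p * pr p)); first by ring.
  by rewrite Wp Hp; field; rewrite k0 c0.
Qed.

End Liouville.

(** * The scalar product and determinants of four vectors *)
Section Dot.
Variable A : comNzRingType.
Implicit Types a b c d : 'rV[A]_4.

Lemma dotE a b : dot a b =
  - (a 0 0 * b 0 0) + a 0 1 * b 0 1 - a 0 2%:R * b 0 2%:R + a 0 3%:R * b 0 3%:R.
Proof.
rewrite /dot !big_ord_recl big_ord0 /=.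
have -> : lift ord0 (ord0 : 'I_3) = 1 by apply/val_inj.
have -> : lift ord0 (lift ord0 (ord0 : 'I_2)) = 2%:R by apply/val_inj.
have -> : lift ord0 (lift ord0 (lift ord0 (ord0 : 'I_1))) = 3%:R by apply/val_inj.
by rewrite /=; ring.
Qed.

Lemma dotC a b : dot a b = dot b a.
Proof. by rewrite !dotE; ring. Qed.

Lemma dotDl a b c : dot (a + b) c = dot a c + dot b c.
Proof. by rewrite !dotE !mxE; ring. Qed.

Lemma dotZl k a b : dot (k *: a) b = k * dot a b.
Proof. by rewrite !dotE !mxE; ring. Qed.

Lemma dotNl a b : dot (- a) b = - dot a b.
Proof. by rewrite !dotE !mxE; ring. Qed.

Lemma dotBl a b c : dot (a - b) c = dot a c - dot b c.
Proof. by rewrite dotDl dotNl. Qed.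

Lemma dotDr a b c : dot c (a + b) = dot c a + dot c b.
Proof. by rewrite dotC dotDl ![dot _ c]dotC. Qed.

Lemma dotZr k a b : dot b (k *: a) = k * dot b a.
Proof. by rewrite dotC dotZl dotC. Qed.

Lemma dotNr a b : dot b (- a) = - dot b a.
Proof. by rewrite dotC dotNl dotC. Qed.

Lemma dotBr a b c : dot c (a - b) = dot c a - dot c b.
Proof. by rewrite dotDr dotNr. Qed.

Lemma dot0l a : dot 0 a = 0.
Proof. by rewrite dotE !mxE; ring. Qed.

Lemma dot0r a : dot a 0 = 0.
Proof. by rewrite dotC dot0l. Qed.

Definition dot_simp := (dotDl, dotDr, dotBl, dotBr, dotNl, dotNr, dotZl, dotZr,
  dot0l, dot0r).

Definition rows4 a b c d : 'M[A]_4 := \matrix_(i < 4) [:: a; b; c; d]`_i.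
Definition det4 a b c d : A := \det (rows4 a b c d).

Lemma det4E a b c d : det4 a b c d =
  (a 0 0 * b 0 1 - a 0 1 * b 0 0) * (c 0 2%:R * d 0 3%:R - c 0 3%:R * d 0 2%:R)
- (a 0 0 * b 0 2%:R - a 0 2%:R * b 0 0) * (c 0 1 * d 0 3%:R - c 0 3%:R * d 0 1)
+ (a 0 0 * b 0 3%:R - a 0 3%:R * b 0 0) * (c 0 1 * d 0 2%:R - c 0 2%:R * d 0 1)
+ (a 0 1 * b 0 2%:R - a 0 2%:R * b 0 1) * (c 0 0 * d 0 3%:R - c 0 3%:R * d 0 0)
- (a 0 1 * b 0 3%:R - a 0 3%:R * b 0 1) * (c 0 0 * d 0 2%:R - c 0 2%:R * d 0 0)
+ (a 0 2%:R * b 0 3%:R - a 0 3%:R * b 0 2%:R) * (c 0 0 * d 0 1 - c 0 1 * d 0 0).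
Proof.
have [f F] : exists f : 'rV[A]_4 -> nat -> A, 
      forall (v : 'rV[A]_4) (i : 'I_4), v 0 i = f v (val i).
  by exists (fun v n => v 0 (inord n)) => v i; rewrite inord_val.
rewrite /det4 (expand_det_row _ 0) !big_ord_recl big_ord0 /cofactor.
rewrite !(expand_det_row _ ord0) !big_ord_recl !big_ord0 /cofactor.
rewrite !(expand_det_row _ ord0) !big_ord_recl !big_ord0 /cofactor !det_mx11.
by rewrite !mxE /= !F /= /bump /=; ring.
Qed.

(** The vector product: the vector that represents the linear form [det4 a b c]. *)
Definition cross a b c : 'rV[A]_4 :=
  \row_i ((-1) ^+ i.+1 * det4 a b c (delta_mx 0 i)).

Lemma dot_cross a b c w : dot (cross a b c) w = det4 a b c w.
Proof. by rewrite dotE !mxE !det4E !mxE /=; ring. Qed.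

(** The Gram determinant of the three factors. *)
Lemma cross_norm a b c : dot (cross a b c) (cross a b c) =
  dot a a * dot b b * dot c c + dot a b * dot b c * dot a c * 2%:R
  - dot a a * dot b c ^+ 2 - dot b b * dot a c ^+ 2 - dot c c * dot a b ^+ 2.
Proof. by rewrite !dotE !mxE !det4E !mxE /=; ring. Qed.

(** The matrix of the scalar product has determinant 1, so it can be inserted
    between the two matrices; the product then has the mutual scalar products
    for entries. *)
Lemma det4_mul a b c d a' b' c' d' :
  let G v := \row_(j < 4) dot v ([:: a'; b'; c'; d']`_j) in
  det4 a b c d * det4 a' b' c' d' = det4 (G a) (G b) (G c) (G d).
Proof.
move=> G; rewrite /det4 -[X in _ * X]det_tr.
pose eta : 'M[A]_4 := diag_mx (\row_i (-1) ^+ i.+1).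
have deta : \det eta = 1.
  by rewrite det_diag !big_ord_recl big_ord0 !mxE /= /bump /=; ring.
have -> : \det (rows4 a b c d) = \det (rows4 a b c d *m eta).
  by rewrite det_mulmx deta mulr1.
rewrite -det_mulmx; congr (\det _); apply/matrixP => i j.
have E (k : 'I_4) : [:: G a; G b; G c; G d]`_k = G ([:: a; b; c; d]`_k).
  by case: k => -[|[|[|[|]]]].
rewrite [RHS]mxE E !mxE /dot; apply: eq_bigr => k _.
by rewrite mul_mx_diag !mxE; ring.
Qed.

End Dot.

(** * The normal projection *)
Section DotCalculus.
Variable R : realType.
Local Notation plane := 'rV[R]_2.
Implicit Types (p q v w : plane) (D U : set plane) (b : bool).
Implicit Types (F G : plane -> 'rV[R]_4).

Lemma Dn_dot b F G p : differentiable F p -> differentiable G p ->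
  Dn b (fun q => dot (F q) (G q)) p = dot (Dn b F p) (G p) + dot (F p) (Dn b G p).
Proof.
move=> dF dG.
have -> : (fun q => dot (F q) (G q)) = fun q =>
    - (F q 0 0 * G q 0 0) + F q 0 1 * G q 0 1 - F q 0 2%:R * G q 0 2%:R
    + F q 0 3%:R * G q 0 3%:R.
  by apply/funext => q; rewrite dotE.
have dF' i := diff_entry 0 i dF; have dG' i := diff_entry 0 i dG.
have dM i : differentiable (fun q => F q 0 i * G q 0 i : R) p.
  exact: differentiableM.
have dN i : differentiable (fun q => - (F q 0 i * G q 0 i) : R) p.
  exact: differentiableN.
have d1 : differentiable (fun q => - (F q 0 0 * G q 0 0) + F q 0 1 * G q 0 1 : R) p.
  exact: differentiableD.
rewrite Dn_add//; last exact: differentiableB.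
rewrite Dn_sub// Dn_add// Dn_opp// !Dn_mul// !dotE.
by rewrite !(Dn_entry b _ _ dF) !(Dn_entry b _ _ dG); ring.
Qed.

Lemma smooth_dot D F G : open D -> smooth D F -> smooth D G ->
  smooth D (fun q => dot (F q) (G q)).
Proof.
move=> oD sF sG; apply: (@smooth_eq _ _ _ (fun q =>
    - (F q 0 0 * G q 0 0) + F q 0 1 * G q 0 1 - F q 0 2%:R * G q 0 2%:R
    + F q 0 3%:R * G q 0 3%:R)) => //.
  by move=> q _; rewrite dotE.
have sM i : smooth D (fun q => F q 0 i * G q 0 i).
  by apply: smoothM => //; exact: smooth_entry.
apply: smoothD => //; apply: smoothB => //; apply: smoothD => //.
exact: smoothN.
Qed.

End DotCalculus.

Lemma ord2_ind (P : 'I_2 -> Prop) : P 0 -> P 1 -> forall i, P i.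
Proof.
move=> P0 P1 -[[|[|]]//= i].
  by rewrite (_ : Ordinal i = 0)//; exact/val_inj.
by rewrite (_ : Ordinal i = 1)//; exact/val_inj.
Qed.

Section NormalPart.
Variable R : realType.
Local Notation plane := 'rV[R]_2.
Variables (x : plane -> 'rV[R]_4) (p : plane).

Lemma normal_spaceP (w : 'rV[R]_4) : (w <= normal_space x p)%MS <->
  dot w (partial 0 x p) = 0 /\ dot w (partial 1 x p) = 0.
Proof.
set M : 'M[R]_(4, 2) := \matrix_(k < 4, i < 2) dot (delta_mx 0 k) (partial i x p).
have E i : (w *m M) 0 i = dot w (partial i x p).
  rewrite mxE; under eq_bigr do rewrite mxE.
  rewrite {2}[w]row_sum_delta; apply: (big_ind2 (fun s v => s = dot v (partial i x p))).
  - by rewrite dot0l.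
  - by move=> s v s' v' -> ->; rewrite dotDl.
  - by move=> k _; rewrite dotZl.
split=> [/sub_kermxP wM|[w0 w1]].
  by rewrite -!E wM !mxE.
apply/sub_kermxP/rowP => i; rewrite E mxE; move: i.
exact: (@ord2_ind (fun i => dot w (partial i x p) = 0)).
Qed.

Lemma tangent_spaceP (w : 'rV[R]_4) : (w <= tangent_space x p)%MS <->
  exists k l, w = k *: partial 0 x p + l *: partial 1 x p.
Proof.
rewrite /tangent_space genmxE; set M := \matrix_(i < 2) _.
have ME (d : 'rV[R]_2) : d *m M = d 0 0 *: partial 0 x p + d 0 1 *: partial 1 x p.
  rewrite mulmx_sum_row !big_ord_recl big_ord0 addr0 !rowK.
  by have -> : lift ord0 ord0 = 1 :> 'I_2 by apply/val_inj.
split=> [/submxP[d ->]|[k [l ->]]].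
  by exists (d 0 0), (d 0 1).
apply/submxP; exists (\row_j if j == 0 then k else l).
by rewrite ME !mxE.
Qed.

Hypothesis dx : differentiable x p.
Let xs : 'rV[R]_4 := Dn false x p.
Let xr : 'rV[R]_4 := Dn true x p.
Hypotheses (ss : dot xs xs = 0) (rr : dot xr xr = 0) (sr : dot xs xr != 0).

Lemma normal_space_null (w : 'rV[R]_4) : (w <= normal_space x p)%MS <->
  dot w xs = 0 /\ dot w xr = 0.
Proof.
rewrite normal_spaceP partial0E// partial1E// !dot_simp -/xs -/xr.
by split=> -[H1 H2]; split; lra.
Qed.

Lemma tangent_space_null (k l : R) :
  ((k *: xs + l *: xr)%R <= tangent_space x p)%MS.
Proof.
apply: (tangent_spaceP (k *: xs + l *: xr)).2.
exists ((k + l) / 2), ((k - l) / 2).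
by rewrite partial0E// partial1E//; apply/rowP => i; rewrite !mxE; field.
Qed.

(** A tangent vector is k x_s + l x_r, and as x_s and x_r are null, k and l are
    read off from its products with x_r and x_s. *)
Lemma normal_partE (w : 'rV[R]_4) : normal_part x p w =
  w - (dot w xr / dot xs xr) *: xs - (dot w xs / dot xs xr) *: xr.
Proof.
have NT0 : (normal_space x p :&: tangent_space x p = 0)%MS.
  apply/eqP; rewrite -submx0; apply/rV_subP => v; rewrite sub_capmx.
  move=> /andP[/normal_space_null[vs vr] /tangent_spaceP[k [l vE]]].
  suff -> : v = 0 by exact: sub0mx.
  move: vs vr; rewrite vE partial0E// partial1E// -/xs -/xr !dot_simp ss rr.
  rewrite [dot xr xs]dotC; have := sr; set g := dot xs xr => /mulIf kl H1 H2.
  have k1 : k - l = 0 by apply: kl; rewrite mul0r -H1; ring.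
  have k2 : k + l = 0 by apply: kl; rewrite mul0r -H2; ring.
  have -> : k = 0 by lra.
  have -> : l = 0 by lra.
  by rewrite !scale0r addr0.
set t := (dot w xr / dot xs xr) *: xs + (dot w xs / dot xs xr) *: xr.
set n := RHS; have -> : w = n + t by rewrite /n /t -[w - _ - _]addrA -opprD subrK.
rewrite /normal_part mulmxDl proj_mx_id//; last first.
  apply/normal_space_null.
  rewrite /n !dot_simp ss rr [dot xr xs]dotC !mulr0 subr0.
  by rewrite !mulfVK// !subrr.
by rewrite proj_mx_0 ?addr0//; exact: tangent_space_null.
Qed.

End NormalPart.

(** * Vector fields and brackets *)

Section Fields.
Variable R : realType.
Local Notation plane := 'rV[R]_2.
Implicit Types (p q v w : plane) (V : set plane) (b : bool) (X Y Z : plane -> plane).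

Lemma smooth_ncoord V b X : open V -> smooth V X ->
  smooth V (fun q => ncoord b (X q)).
Proof.
move=> oV sX; apply: smoothD => //; first exact: smooth_entry.
by apply: smoothM => //; [exact: smooth_cst|exact: smooth_entry].
Qed.

Lemma ncoord_deriv b X p v : differentiable X p ->
  ncoord b ('D_v X p) = 'D_v (fun q => ncoord b (X q)) p.
Proof.
move=> dX; have d0 := diff_entry 0 0 dX; have d1 := diff_entry 0 1 dX.
rewrite /ncoord deriv_add//; last by diffs.
by rewrite deriv_mul// deriv_cst mul0r add0r -!deriv_entry.
Qed.

Lemma deriv_field m n V Y (F : plane -> 'M[R]_(m, n)) : smooth V F ->
  forall q, V q -> 'D_(Y q) F q =
    ncoord false (Y q) *: Dn false F q + ncoord true (Y q) *: Dn true F q.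
Proof. by move=> sF q Vq; rewrite deriv_nvec//; exact: smooth_diff sF Vq. Qed.

Lemma deriv_fieldR V Y (f : plane -> R) : smooth V f ->
  forall q, V q -> 'D_(Y q) f q =
    ncoord false (Y q) * Dn false f q + ncoord true (Y q) * Dn true f q.
Proof. by move=> sF q Vq; rewrite deriv_nvec//; exact: smooth_diff sF Vq. Qed.

Lemma smooth_deriv_field m n V Y (F : plane -> 'M[R]_(m, n)) : open V ->
  smooth V Y -> smooth V F -> smooth V (fun q => 'D_(Y q) F q).
Proof.
move=> oV sY sF; apply: (smooth_eq oV (fun q Vq => esym (deriv_field Y sF Vq))).
by apply: smooth_addmx => //; apply: smooth_scale => //;
  do ?[exact: smooth_ncoord|exact: smooth_Dn].
Qed.

Lemma smooth_deriv_fieldR V Y (f : plane -> R) : open V ->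
  smooth V Y -> smooth V f -> smooth V (fun q => 'D_(Y q) f q).
Proof.
move=> oV sY sF; apply: (smooth_eq oV (fun q Vq => esym (deriv_fieldR Y sF Vq))).
by apply: smoothD => //; apply: smoothM => //;
  do ?[exact: smooth_ncoord|exact: smooth_DnR].
Qed.

(** As an operator on functions the bracket is a commutator: the second
    derivatives of f cancel by symmetry. *)
Lemma lie_bracketR V X Y (f : plane -> R) p : open V -> V p ->
  smooth V X -> smooth V Y -> smooth V f ->
  'D_(X p) (fun q => 'D_(Y q) f q) p - 'D_(Y p) (fun q => 'D_(X q) f q) p =
  'D_(lie_bracket X Y p) f p.
Proof.
move=> oV Vp sX sY sf.
have second W Z : smooth V Z ->
    'D_(W p) (fun q => 'D_(Z q) f q) p =
      'D_(W p) (fun q => ncoord false (Z q)) p * Dn false f p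
      + 'D_(W p) (fun q => ncoord true (Z q)) p * Dn true f p
      + ncoord false (Z p) * (ncoord false (W p) * Dn false (Dn false f) p
           + ncoord true (W p) * Dn true (Dn false f) p)
      + ncoord true (Z p) * (ncoord false (W p) * Dn true (Dn false f) p
           + ncoord true (W p) * Dn true (Dn true f) p).
  move=> sZ; rewrite (deriv_near (W p) oV Vp (deriv_fieldR Z sf)).
  have dZ b := smooth_diff (smooth_ncoord b oV sZ) Vp.
  have df b := smooth_diff (smooth_DnR b oV sf) Vp.
  have d0 := dZ false; have d1 := dZ true.
  have d2 := df false; have d3 := df true.
  rewrite deriv_add; [|by diffs..].
  rewrite !deriv_mul; [|by diffs..].
  rewrite (deriv_fieldR W (smooth_DnR false oV sf) Vp).
  rewrite (deriv_fieldR W (smooth_DnR true oV sf) Vp).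
  rewrite (Dn_commR false true oV sf Vp); ring.
rewrite !second//.
have dX := smooth_diff sX Vp; have dY := smooth_diff sY Vp.
rewrite (deriv_nvec _ (smooth_diff sf Vp)) /lie_bracket !ncoordB !ncoord_deriv//.
rewrite /GRing.scale /=; ring.
Qed.

Lemma lie_bracketM m n V X Y (F : plane -> 'M[R]_(m, n)) p : open V -> V p ->
  smooth V X -> smooth V Y -> smooth V F ->
  'D_(X p) (fun q => 'D_(Y q) F q) p - 'D_(Y p) (fun q => 'D_(X q) F q) p =
  'D_(lie_bracket X Y p) F p.
Proof.
move=> oV Vp sX sY sF; apply/matrixP => i j.
have E W Z : smooth V Z -> 'D_(W p) (fun q => 'D_(Z q) F q) p i j =
    'D_(W p) (fun q => 'D_(Z q) (fun q' => F q' i j) q) p.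
  move=> sZ.
  have dZ : differentiable (fun q => 'D_(Z q) F q : 'M[R]_(m, n)) p.
    exact: smooth_diff (smooth_deriv_field oV sZ sF) Vp.
  apply: (etrans (deriv_entry (W p) i j dZ)).
  apply: (deriv_near (W p) oV Vp) => q Vq.
  by apply: deriv_entry; exact: smooth_diff sF Vq.
have S (A B : 'M[R]_(m, n)) : (A - B) i j = A i j - B i j by rewrite !mxE.
apply: (etrans (S _ _)).
have sub (a b c d e : R) : a = c -> b = d -> c - d = e -> a - b = e.
  by move=> -> ->.
apply: (sub _ _ _ _ _ (E X Y sY) (E Y X sX)).
apply: (etrans (lie_bracketR oV Vp sX sY (smooth_entry oV i j sF))).
by apply/esym; apply: deriv_entry; exact: smooth_diff sF Vp.
Qed.
End Fields.

(** * Surfaces with null coordinate lines *)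

Definition null_surface (R : realType) (D : set 'rV[R]_2)
    (x : 'rV[R]_2 -> 'rV[R]_4) : Prop :=
  forall p, D p -> [/\ dot (Dn false x p) (Dn false x p) = 0,
    dot (Dn true x p) (Dn true x p) = 0 &
    dot (Dn false x p) (Dn true x p) < 0].

(** As x_u = x_s + x_r and x_v = x_s - x_r, the isothermal conditions say that
    x_s^2 + x_r^2 = 0 and x_s^2 = x_r^2, and E = 2 x_s . x_r. *)
Lemma isothermal_null (R : realType) (D : set 'rV[R]_2)
    (x : 'rV[R]_2 -> 'rV[R]_4) : smooth D x ->
  isothermal x D <-> null_surface D x.
Proof.
move=> sx; split=> H p Dp; have := H p Dp; have dx := smooth_diff sx Dp;
  rewrite /= partial0E// partial1E// !dot_simp [dot (Dn true x p) (Dn false x p)]dotC.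
  by move=> [H1 H2 H3]; split; lra.
by move=> [-> -> H3]; split; lra.
Qed.

Section Surface.
Variable R : realType.
Local Notation plane := 'rV[R]_2.
Variables (D : set plane) (x : plane -> 'rV[R]_4).
Hypotheses (oD : open D) (sx : smooth D x) (nx : null_surface D x).
Implicit Types (p q v w : plane) (X Y Z : plane -> plane).

Local Notation xs := (Dn false x : plane -> 'rV[R]_4).
Local Notation xr := (Dn true x : plane -> 'rV[R]_4).
Local Notation xss := (Dn false (Dn false x) : plane -> 'rV[R]_4).
Local Notation xsr := (Dn true (Dn false x) : plane -> 'rV[R]_4).
Local Notation xrr := (Dn true (Dn true x) : plane -> 'rV[R]_4).
(** E / 2: the induced metric is 2 g ds dr. *)
Definition conf p : R := dot (Dn false x p) (Dn true x p).
Local Notation g := conf.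

Lemma smooth_x1 b : smooth D (Dn b x : plane -> 'rV[R]_4).
Proof. exact: smooth_Dn. Qed.

Lemma smooth_x2 b b' : smooth D (Dn b (Dn b' x) : plane -> 'rV[R]_4).
Proof. by apply: smooth_Dn => //; exact: smooth_Dn. Qed.

Lemma diff_x1 b p : D p -> differentiable (Dn b x : plane -> 'rV[R]_4) p.
Proof. exact: smooth_diff (smooth_x1 b). Qed.

Lemma diff_x2 b b' p : D p ->
  differentiable (Dn b (Dn b' x) : plane -> 'rV[R]_4) p.
Proof. exact: smooth_diff (smooth_x2 b b'). Qed.

Lemma smooth_conf : smooth D g.
Proof. by apply: smooth_dot => //; exact: smooth_x1. Qed.

Lemma conf_lt0 p : D p -> g p < 0.
Proof. by move=> /nx[]. Qed.

Lemma conf_neq0 p : D p -> g p != 0.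
Proof. by move=> /conf_lt0; rewrite lt_neqAle => /andP[]. Qed.

Lemma x_rs p : D p -> Dn false (Dn true x) p = xsr p.
Proof. by move=> Dp; exact: Dn_comm oD sx Dp. Qed.

Lemma dot_ss p : D p -> dot (xs p) (xs p) = 0. Proof. by move=> /nx[]. Qed.
Lemma dot_rr p : D p -> dot (xr p) (xr p) = 0. Proof. by move=> /nx[]. Qed.

Lemma dot_x2_x1 b b' p : D p -> dot (Dn b (Dn b' x) p) (Dn b' x p) = 0.
Proof.
move=> Dp.
have E : Dn b (fun q => dot (Dn b' x q) (Dn b' x q)) p = 0.
  rewrite (@Dn_near R b p _ _ (fun=> 0) D oD Dp) ?Dn_cst// => q Dq.
  by case: b'; [exact: dot_rr|exact: dot_ss].
move: E; rewrite (Dn_dot _ (diff_x1 b' Dp) (diff_x1 b' Dp)).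
rewrite [X in _ + X]dotC => E; lra.
Qed.

Lemma derivx p v : D p -> 'D_v x p = ncoord false v *: xs p + ncoord true v *: xr p.
Proof. by move=> Dp; exact: deriv_nvec (smooth_diff sx Dp). Qed.

Lemma first_formE p v w : D p -> first_form x p v w =
  g p * (ncoord false v * ncoord true w + ncoord true v * ncoord false w).
Proof.
move=> Dp; rewrite /first_form !derivx// !dot_simp dot_ss// dot_rr//.
by rewrite [dot (xr p) _]dotC /conf; ring.
Qed.

Lemma normalE p (w : 'rV[R]_4) : D p -> normal_part x p w =
  w - (dot w (xr p) / g p) *: xs p - (dot w (xs p) / g p) *: xr p.
Proof.
move=> Dp; apply: normal_partE; [exact: smooth_diff sx Dp|exact: dot_ss|
 exact: dot_rr|exact: conf_neq0].
Qed.

Lemma normal_tan p (w : 'rV[R]_4) k l : D p ->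
  normal_part x p (w + k *: xs p + l *: xr p) = normal_part x p w.
Proof.
move=> Dp; rewrite !normalE// !dot_simp dot_ss// dot_rr// [dot (xr p) _]dotC.
rewrite -/(g p); have g0 := conf_neq0 Dp.
by apply/rowP => i; rewrite !mxE; field.
Qed.

Lemma normal_id p (w : 'rV[R]_4) : D p -> dot w (xs p) = 0 -> dot w (xr p) = 0 ->
  normal_part x p w = w.
Proof. by move=> Dp w0 w1; rewrite normalE// w0 w1 !mul0r !scale0r !subr0. Qed.

Lemma normal_dot p (w n : 'rV[R]_4) : D p -> dot n (xs p) = 0 -> dot n (xr p) = 0 ->
  dot (normal_part x p w) n = dot w n.
Proof.
move=> Dp n0 n1; rewrite normalE// !dot_simp.
by rewrite [dot (xs p) n]dotC [dot (xr p) n]dotC n0 n1; ring.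
Qed.

Lemma normalP p (w : 'rV[R]_4) : D p -> (w <= normal_space x p)%MS <->
  dot w (xs p) = 0 /\ dot w (xr p) = 0.
Proof. by move=> Dp; apply: normal_space_null; exact: smooth_diff sx Dp. Qed.

Lemma normal_sr p : D p -> normal_part x p (xsr p) = xsr p.
Proof.
move=> Dp; apply: normal_id => //; first exact: dot_x2_x1.
by rewrite -x_rs//; exact: dot_x2_x1.
Qed.

Lemma second_formE V X Y p : open V -> V `<=` D -> V p -> smooth V Y ->
  second_form x X Y p = normal_part x p
    ((ncoord false (X p) * ncoord false (Y p)) *: xss p
    + (ncoord false (X p) * ncoord true (Y p)
       + ncoord true (X p) * ncoord false (Y p)) *: xsr p
    + (ncoord true (X p) * ncoord true (Y p)) *: xrr p).
Proof.
move=> oV VD Vp sY; rewrite /second_form.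
have Dp := VD _ Vp.
have -> : 'D_(X p) (fun q => 'D_(Y q) x q) p =
   'D_(X p) (fun q => ncoord false (Y q) *: xs q + ncoord true (Y q) *: xr q) p.
  by apply: (deriv_near (X p) oV Vp) => q Vq; exact: derivx (VD _ Vq).
have dY b := smooth_diff (smooth_ncoord b oV sY) Vp.
have dS b : differentiable (fun q => ncoord b (Y q) *: (Dn b x q : 'rV[R]_4)) p.
  by apply: diff_scale; [exact: dY|exact: diff_x1].
have Ds b b' : Dn b' (fun q => ncoord b (Y q) *: (Dn b x q : 'rV[R]_4)) p =
   Dn b' (fun q => ncoord b (Y q)) p *: Dn b x p +
   ncoord b (Y p) *: Dn b' (Dn b x) p.
  by apply: Dn_scale; [exact: dY|exact: diff_x1].
rewrite deriv_nvec; last exact: differentiableD (dS false) (dS true).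
rewrite (Dn_add false (dS false) (dS true)) (Dn_add true (dS false) (dS true)).
rewrite !Ds x_rs//.
set k := ncoord false (X p) * Dn false (fun q => ncoord false (Y q)) p +
   ncoord true (X p) * Dn true (fun q => ncoord false (Y q)) p.
set l := ncoord false (X p) * Dn false (fun q => ncoord true (Y q)) p +
   ncoord true (X p) * Dn true (fun q => ncoord true (Y q)) p.
rewrite -[RHS](normal_tan _ k l Dp); congr (normal_part x p _).
by apply/rowP => i; rewrite !mxE /k /l; ring.
Qed.

(** The conditions on an adapted frame in null components.  The determinant of
    the tangent part is split off from the orientation. *)
Lemma adaptedE F p : D p -> adapted_at x F p ->
  let a b := ncoord b (fX1 F p) in let c b := ncoord b (fX2 F p) in
  [/\ [/\ 2 * g p * a false * a true = -1, 2 * g p * c false * c true = 1 &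
         a false * c true + a true * c false = 0],
      [/\ dot (fn1 F p) (xs p) = 0, dot (fn1 F p) (xr p) = 0,
          dot (fn2 F p) (xs p) = 0 & dot (fn2 F p) (xr p) = 0],
      [/\ dot (fn1 F p) (fn1 F p) = -1, dot (fn2 F p) (fn2 F p) = 1 &
          dot (fn1 F p) (fn2 F p) = 0] &
      0 < (a false * c true - a true * c false)
          * det4 (xs p) (xr p) (fn1 F p) (fn2 F p)].
Proof.
move=> Dp [[H1 H2 H3] [/(normalP _ Dp)[H4 H5] /(normalP _ Dp)[H6 H7]] H8 H9] a c.
move: H1 H2 H3; rewrite !first_formE// -/(a false) -/(a true) -/(c false) -/(c true).
move=> H1 H2 H3; have g0 := conf_neq0 Dp.
split=> //.
  split; [rewrite -[RHS]H1; ring|rewrite -[RHS]H2; ring|].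
  by apply: (mulfI g0); rewrite mulr0.
move: H9; rewrite !derivx// -/(det4 _ _ _ _).
rewrite -/(a false) -/(a true) -/(c false) -/(c true).
congr (0 < _); rewrite !det4E !mxE; ring.
Qed.

Lemma adapted_localize F p : D p -> adapted_near x F p ->
  exists V, [/\ open V, V `<=` D, V p,
    [/\ smooth V (fX1 F), smooth V (fX2 F), smooth V (fn1 F) &
        smooth V (fn2 F)] & forall q, V q -> adapted_at x F q].
Proof.
move=> Dp [U [oU Up [s1 s2 s3 s4] HU]]; exists (U `&` D); split=> //.
- exact: openI.
- by split; [apply: smooth_sub s1|apply: smooth_sub s2|apply: smooth_sub s3|
    apply: smooth_sub s4] => q [].
- by move=> q [Uq _]; exact: HU.
Qed.

(** If (a, b) and (c, d) are the null components of an orthonormal tangent frame,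
    then c^2 = a^2 and d^2 = b^2.  Hence x_ss and x_rr cancel and only x_sr, which
    is normal, remains. *)
Lemma mean_value_frame F p : D p -> adapted_near x F p ->
  2^-1 *: (- second_form x (fX1 F) (fX1 F) p + second_form x (fX2 F) (fX2 F) p)
  = (g p)^-1 *: xsr p.
Proof.
move=> Dp /(adapted_localize Dp)[V [oV VD Vp [s1 s2 _ _] HV]].
have [[H1 H2 H3] _ _ _] := adaptedE Dp (HV p Vp).
rewrite (second_formE _ oV VD Vp s1) (second_formE _ oV VD Vp s2).
set a := ncoord false _ in H1 H3 *; set b := ncoord true _ in H1 H3 *.
set c := ncoord false _ in H2 H3 *; set d := ncoord true _ in H2 H3 *.
have g0 := conf_neq0 Dp.
have a0 : a != 0.
  by apply/eqP => a0; move: H1; rewrite a0 mulr0 mul0r => /eqP; rewrite eq_sym oppr_eq0 oner_eq0.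
have bE : b = - (2 * g p * a)^-1.
  apply: (@mulfI _ (2 * g p * a)); first by rewrite !mulf_neq0.
  by rewrite H1 mulrN mulfV// !mulf_neq0.
have ab : a * b = - (2 * g p)^-1 by rewrite bE; field; rewrite a0 g0.
have cd : c * d = (2 * g p)^-1.
  apply: (@mulfI _ (2 * g p)); first by rewrite !mulf_neq0.
  by rewrite mulrA H2 mulfV// mulf_neq0.
have aa : c * c = a * a.
  have : a * (c * d) + b * (c * c) = 0.
    by transitivity ((a * d + b * c) * c); [ring|rewrite H3 mul0r].
  rewrite cd bE => E.
  have : (2 * g p * a) * (a * (2 * g p)^-1 + - (2 * g p * a)^-1 * (c * c)) = 0.
    by rewrite E mulr0.
  have -> : (2 * g p * a) * (a * (2 * g p)^-1 + - (2 * g p * a)^-1 * (c * c)) =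
     a * a - c * c by field; rewrite a0 g0.
  by move=> /eqP; rewrite subr_eq0 => /eqP.
have bb : d * d = b * b.
  have : b * (c * d) + a * (d * d) = 0.
    by transitivity ((a * d + b * c) * d); [ring|rewrite H3 mul0r].
  have -> : c * d = - (a * b) by rewrite ab opprK.
  move=> E; apply: (mulfI a0).
  by apply/eqP; rewrite -subr_eq0 -[X in _ == X]E; apply/eqP; ring.
rewrite -[in RHS](normal_sr Dp) !normalE// !dot_simp.
rewrite aa bb cd ab.
have -> : b * a = - (2 * g p)^-1 by rewrite mulrC.
have -> : d * c = (2 * g p)^-1 by rewrite mulrC.
by apply/rowP => i; rewrite !mxE; field.
Qed.

Lemma minimal_sr : minimal x D -> forall p, D p -> xsr p = 0.
Proof.
move=> mx p Dp; have [[F HF] /(_ F HF)] := mx p Dp.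
rewrite mean_value_frame// => /eqP.
by rewrite scaler_eq0 invr_eq0 (negbTE (conf_neq0 Dp)) => /eqP.
Qed.

End Surface.

(** * The Gauss curvature *)

Section Curvatures.
Variable R : realType.
Local Notation plane := 'rV[R]_2.
Variables (D : set plane) (x : plane -> 'rV[R]_4).
Hypotheses (oD : open D) (sx : smooth D x) (nx : null_surface D x).
Implicit Types (p q v w : plane) (X Y Z : plane -> plane).

Local Notation xs := (Dn false x : plane -> 'rV[R]_4).
Local Notation xr := (Dn true x : plane -> 'rV[R]_4).
Local Notation xss := (Dn false (Dn false x) : plane -> 'rV[R]_4).
Local Notation xsr := (Dn true (Dn false x) : plane -> 'rV[R]_4).
Local Notation xrr := (Dn true (Dn true x) : plane -> 'rV[R]_4).
Local Notation g := (conf x).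

Lemma sum2 (V : nmodType) (F : 'I_2 -> V) : \sum_i F i = F 0 + F 1.
Proof.
rewrite !big_ord_recl big_ord0 addr0.
by have -> : lift ord0 ord0 = 1 :> 'I_2 by apply/val_inj.
Qed.

Definition lorentz (i j : 'I_2) : R :=
  if i == j then (if i == 0 then 2 else -2) else 0.

Lemma metricE p i j : D p -> metric x p i j = lorentz i j * g p.
Proof.
move=> Dp; rewrite mxE (first_formE sx nx)// /ncoord !mxE.
by move: i; apply: ord2_ind; move: j; apply: ord2_ind; rewrite /lorentz /=; ring.
Qed.

Lemma partial_metric k i j p : D p ->
  partial k (fun q => metric x q i j) p = lorentz i j * partial k g p.
Proof.
move=> Dp; rewrite /partial.
rewrite (@deriv_near R R _ (fun q => lorentz i j * g q) _ _ D oD Dp); last first.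
  by move=> q Dq; exact: metricE.
have dg := smooth_diff (smooth_conf oD sx) Dp.
by rewrite deriv_mul// deriv_cst mul0r add0r.
Qed.

Lemma invmx_metric p : D p ->
  invmx (metric x p) = \matrix_(i, j) (lorentz i j / 4 / g p).
Proof.
move=> Dp; have g0 := conf_neq0 nx Dp.
have E : metric x p *m (\matrix_(i, j) (lorentz i j / 4 / g p)) = 1%:M.
  apply/matrixP => i j; rewrite mxE sum2 !metricE// !mxE.
  by move: i; apply: ord2_ind; move: j; apply: ord2_ind; rewrite /lorentz /=;
    field.
rewrite -[LHS]mulmx1 -E mulmxA mulVmx ?mul1mx//.
by have [] := mulmx1_unit E.
Qed.

(** The Levi-Civita connection of 2 g ds dr is diagonal in null components: the
    only Christoffel symbols are the derivatives of ln |g| along s for the index s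
    and along r for the index r. *)
Lemma levi_civita_null b X Y p : D p ->
  ncoord b (levi_civita x X Y p) = ncoord b ('D_(X p) Y p) +
    Dn b g p / g p * ncoord b (X p) * ncoord b (Y p).
Proof.
move=> Dp; rewrite /levi_civita ncoordD; congr (_ + _).
have dg := smooth_diff (smooth_conf oD sx) Dp; have g0 := conf_neq0 nx Dp.
rewrite /ncoord !mxE !sum2 /christoffel !sum2 invmx_metric// !mxE.
rewrite !partial_metric// partial0E// partial1E// /lorentz /=.
case: b => /=; rewrite ?expr0 ?expr1.
all: by field.
Qed.

Definition dlog b p : R := Dn b g p / g p.

Lemma smooth_dlog b : smooth D (dlog b).
Proof.
apply: smoothM => //; first by apply: smooth_DnR => //; exact: smooth_conf.
by apply: smoothV => //; [exact: smooth_conf|exact: conf_neq0].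
Qed.

Section Local.
Variable V : set plane.
Hypotheses (oV : open V) (VD : V `<=` D).

Lemma levi_civita_line b X Y q : V q -> smooth V Y ->
  ncoord b (levi_civita x X Y q) = 'D_(X q) (fun q => ncoord b (Y q)) q +
    dlog b q * ncoord b (X q) * ncoord b (Y q).
Proof.
move=> Vq sY; rewrite levi_civita_null//; last exact: VD.
by rewrite ncoord_deriv//; exact: smooth_diff sY Vq.
Qed.

Lemma smooth_levi_civita X Y : smooth V X -> smooth V Y ->
  smooth V (levi_civita x X Y).
Proof.
move=> sX sY.
have sl b : smooth V (fun q => ncoord b (levi_civita x X Y q)).
  apply: (smooth_eq oV (fun q Vq => esym (levi_civita_line b X Vq sY))).
  have sYb := smooth_ncoord b oV sY; have sXb := smooth_ncoord b oV sX.
  apply: smoothD => //; first exact: smooth_deriv_fieldR.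
  apply: smoothM => //; apply: smoothM => //.
  exact: smooth_sub VD (smooth_dlog b).
apply: (smooth_eq oV (fun q _ => esym (nvec_dec (levi_civita x X Y q)))).
by apply: smooth_addmx => //; apply: smooth_scale => //; exact: smooth_cst.
Qed.

(** Component by component the connection has the form y |-> D_X y + omega(X) y on
    functions, and its curvature is the exterior derivative of omega. *)
Lemma curvature_line b X Y Z p : V p -> smooth V X -> smooth V Y ->
  smooth V Z ->
  ncoord b (curvature (levi_civita x) X Y Z p) =
  (ncoord b (Y p) * 'D_(X p) (dlog b) p - ncoord b (X p) * 'D_(Y p) (dlog b) p)
  * ncoord b (Z p).
Proof.
move=> Vp sX sY sZ; rewrite /curvature !ncoordB.
set z := fun q => ncoord b (Z q).
have sz : smooth V z by exact: smooth_ncoord.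
have sa : smooth V (dlog b) by exact: smooth_sub VD (smooth_dlog b).
have second U W : smooth V U -> smooth V W ->
    ncoord b (levi_civita x U (levi_civita x W Z) p) =
    'D_(U p) (fun q => 'D_(W q) z q) p
    + 'D_(U p) (dlog b) p * ncoord b (W p) * z p
    + dlog b p * 'D_(U p) (fun q => ncoord b (W q)) p * z p
    + dlog b p * ncoord b (W p) * 'D_(U p) z p
    + dlog b p * ncoord b (U p) *
       ('D_(W p) z p + dlog b p * ncoord b (W p) * z p).
  move=> sU sW; have sL := smooth_levi_civita sW sZ.
  rewrite (levi_civita_line _ _ Vp sL) (levi_civita_line b W Vp sZ); congr (_ + _).
  rewrite (deriv_near (U p) oV Vp (fun q Vq => levi_civita_line b W Vq sZ)).
  have d1 := smooth_diff (smooth_deriv_fieldR oV sW sz) Vp.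
  have d2 := smooth_diff sa Vp; have d3 := smooth_diff (smooth_ncoord b oV sW) Vp.
  have d4 := smooth_diff sz Vp.
  rewrite deriv_add//; last by diffs.
  rewrite deriv_mul//; last by diffs.
  by rewrite deriv_mul// -/z -/(z p); ring.
rewrite (second X Y sX sY) (second Y X sY sX).
rewrite (levi_civita_line b (lie_bracket X Y) Vp sZ) -/z.
rewrite -(lie_bracketR oV Vp sX sY sz) ncoordB.
have dX := smooth_diff sX Vp; have dY := smooth_diff sY Vp.
rewrite (ncoord_deriv b (X p) dY) (ncoord_deriv b (Y p) dX) -/(z p).
by gen_deriv; ring.
Qed.

(** Both components of the curvature are multiples of the mixed derivative of
    ln |g|, and the frame enters only through the square of the determinant
    ad - bc, which is 1 / g^2. *)
Lemma gauss_value F p : V p ->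
  [/\ smooth V (fX1 F), smooth V (fX2 F), smooth V (fn1 F) &
        smooth V (fn2 F)] -> adapted_at x F p ->
  - first_form x p (curvature (levi_civita x) (fX1 F) (fX2 F) (fX2 F) p)
       (fX1 F p) =
  - (g p * Dn true (Dn false g) p - Dn false g p * Dn true g p) / g p ^+ 3.
Proof.
move=> Vp [s1 s2 _ _] HF; have Dp := VD Vp.
have [[H1 H2 H3] _ _ _] := adaptedE sx nx Dp HF.
rewrite (first_formE sx nx)// !curvature_line//.
have g0 := conf_neq0 nx Dp.
have sg := smooth_conf oD sx.
have da b := smooth_diff (smooth_dlog b) Dp.
rewrite !(deriv_nvec _ (da _)) /GRing.scale /=.
have dg := smooth_diff sg Dp.
have dgb b := smooth_diff (smooth_DnR b oD sg) Dp.
have dgf := dgb false; have dgt := dgb true.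
have dV : differentiable (fun q => (g q)^-1) p by exact: differentiableV.
have E b b' : Dn b' (dlog b) p =
    (g p * Dn b' (Dn b g) p - Dn b g p * Dn b' g p) / g p ^+ 2.
  have db := dgb b; rewrite /dlog; Dns; rewrite Dn_inv//; field.
  by rewrite g0.
rewrite !E (Dn_commR false true oD sg Dp).
set a := ncoord false _ in H1 H3 *; set b := ncoord true _ in H1 H3 *.
set c := ncoord false _ in H2 H3 *; set d := ncoord true _ in H2 H3 *.
have W2 : (a * d - b * c) ^+ 2 * (g p) ^+ 2 = 1.
  transitivity (g p ^+ 2 * (a * d + b * c) ^+ 2
     - (2 * g p * a * b) * (2 * g p * c * d)); first by ring.
  by rewrite H1 H2 H3; ring.
by rewrite -[RHS]mul1r -W2; field.
Qed.

End Local.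
End Curvatures.

(** * The curvature of the normal connection *)

Section NormalCurvature.
Variable R : realType.
Local Notation plane := 'rV[R]_2.
Variables (D : set plane) (x : plane -> 'rV[R]_4).
Hypotheses (oD : open D) (sx : smooth D x) (nx : null_surface D x).
Hypothesis wave : forall p, D p -> Dn true (Dn false x) p = 0.
Implicit Types (p q v w : plane) (X Y Z : plane -> plane) (n : plane -> 'rV[R]_4).

Local Notation xs := (Dn false x : plane -> 'rV[R]_4).
Local Notation xr := (Dn true x : plane -> 'rV[R]_4).
Local Notation xss := (Dn false (Dn false x) : plane -> 'rV[R]_4).
Local Notation xrr := (Dn true (Dn true x) : plane -> 'rV[R]_4).
Local Notation g := (conf x).

Section Local.
Variable V : set plane.
Hypotheses (oV : open V) (VD : V `<=` D).

Definition normal_field n := forall q, V q ->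
  dot (n q) (xs q) = 0 /\ dot (n q) (xr q) = 0.

(** As n is normal, D n . x_s = - n . D x_s and D n . x_r = - n . D x_r.  Since
    x_sr = 0, the tangential part of D n involves only x_ss and x_rr. *)
Lemma normal_connectionE Y n q : V q -> smooth V n -> normal_field n ->
  normal_connection x Y n q = 'D_(Y q) n q
    + (ncoord true (Y q) * dot (n q) (xrr q) / g q) *: xs q
    + (ncoord false (Y q) * dot (n q) (xss q) / g q) *: xr q.
Proof.
move=> Vq sn nn; have Dq := VD Vq; have dn := smooth_diff sn Vq.
have d1 b := diff_x1 oD sx b Dq.
rewrite /normal_connection (normalE sx nx)//.
have dotn b b' : dot (Dn b n q) (Dn b' x q) = - dot (n q) (Dn b (Dn b' x) q).
  have : Dn b (fun q => dot (n q) (Dn b' x q)) q = 0.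
    rewrite (@Dn_near R b q _ _ (fun=> 0) V oV Vq) ?Dn_cst// => y /nn.
    by case: b' => -[].
  by rewrite (Dn_dot _ dn (d1 b')); lra.
rewrite deriv_nvec// !dot_simp !dotn wave// (x_rs oD sx)// wave// !dot_simp.
by apply/rowP => i; rewrite !mxE; ring.
Qed.

(** The Ricci equation.  The iterated derivatives of n itself add up to zero by
    [lie_bracketM]; the derivatives of the tangential terms of [normal_connectionE]
    contribute through the normal parts of x_ss and x_rr. *)
Lemma normal_curvature_dot X Y n m p : V p -> smooth V X -> smooth V Y ->
  smooth V n -> normal_field n ->
  dot m (xs p) = 0 -> dot m (xr p) = 0 ->
  dot (curvature (normal_connection x) X Y n p) m =
  (ncoord false (X p) * ncoord true (Y p) - ncoord true (X p) * ncoord false (Y p))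
  / g p * (dot (n p) (xrr p) * dot (xss p) m - dot (n p) (xss p) * dot (xrr p) m).
Proof.
move=> Vp sX sY sn nn ms mr; have Dp := VD Vp.
have sx1 b : smooth V (Dn b x : plane -> 'rV[R]_4) := smooth_sub VD (smooth_x1 oD sx b).
have sx2 b b' : smooth V (Dn b (Dn b' x) : plane -> 'rV[R]_4) :=
  smooth_sub VD (smooth_x2 oD sx b b').
have sV : smooth V (fun q => (g q)^-1).
  apply: smoothV => //; first exact: smooth_sub VD (smooth_conf oD sx).
  by move=> q /VD; exact: conf_neq0.
have second U W : smooth V W ->
    dot (normal_connection x U (normal_connection x W n) p) m =
    dot ('D_(U p) (fun q => 'D_(W q) n q) p) m
    + ncoord true (W p) * dot (n p) (xrr p) / g p *
        (ncoord false (U p) * dot (xss p) m)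
    + ncoord false (W p) * dot (n p) (xss p) / g p *
        (ncoord true (U p) * dot (xrr p) m).
  move=> sW; rewrite {1}/normal_connection (normal_dot sx nx)//.
  rewrite (deriv_near (U p) oV Vp (fun q Vq => normal_connectionE W Vq sn nn)).
  have sWb b := smooth_ncoord b oV sW.
  have sA : smooth V (fun q => ncoord true (W q) * dot (n q) (xrr q) / g q).
    by apply: smoothM => //; apply: smoothM => //; exact: smooth_dot.
  have sB : smooth V (fun q => ncoord false (W q) * dot (n q) (xss q) / g q).
    by apply: smoothM => //; apply: smoothM => //; exact: smooth_dot.
  have d0 : differentiable (fun q => 'D_(W q) n q : 'rV[R]_4) p :=
    smooth_diff (smooth_deriv_field oV sW sn) Vp.
  have dA := smooth_diff sA Vp; have dB := smooth_diff sB Vp.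
  have d1 b := diff_x1 oD sx b Dp.
  have dA' := diff_scale dA (d1 false); have dB' := diff_scale dB (d1 true).
  rewrite deriv_add; [|exact: (differentiableD d0 dA')|exact: dB'].
  rewrite deriv_add; [|exact: d0|exact: dA'].
  rewrite (deriv_nvec (U p) dA') (deriv_nvec (U p) dB').
  rewrite !(Dn_scale _ dA (d1 false)) !(Dn_scale _ dB (d1 true)).
  rewrite wave// (x_rs oD sx)// wave//.
  rewrite !(dotDl, dotZl, dot0l) [dot (xs p) m]dotC [dot (xr p) m]dotC ms mr.
  by rewrite !(mulr0, addr0, add0r); congr (_ + _ + _); ring.
have third : dot (normal_connection x (lie_bracket X Y) n p) m =
    dot ('D_(X p) (fun q => 'D_(Y q) n q) p) m
    - dot ('D_(Y p) (fun q => 'D_(X q) n q) p) m.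
  rewrite {1}/normal_connection (normal_dot sx nx)//.
  by rewrite -(lie_bracketM oV Vp sX sY sn) dotBl.
have split3 (u v w : 'rV[R]_4) (u' v' w' e : R) : dot u m = u' -> dot v m = v' ->
    dot w m = w' -> u' - v' - w' = e -> dot (u - v - w) m = e.
  by rewrite !dotBl => -> -> ->.
apply: (split3 _ _ _ _ _ _ _ (second X Y sY) (second Y X sX) third).
by gen_deriv; ring.
Qed.

(** The determinants Om of (x_s, x_r, n1, n2) and Delta of (x_s, x_r, x_ss, x_rr)
    have product - g^2 B, where B is the bracket of products in
    [normal_curvature_dot].  The determinant of the tangent frame is the inverse
    of Om, since their product squares to 1 and is positive by orientation. *)
Lemma normal_value F p : V p ->
  [/\ smooth V (fX1 F), smooth V (fX2 F), smooth V (fn1 F) &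
        smooth V (fn2 F)] -> (forall q, V q -> adapted_at x F q) ->
  dot (curvature (normal_connection x) (fX1 F) (fX2 F) (fn2 F) p) (fn1 F p) =
  - det4 (xs p) (xr p) (xss p) (xrr p) / g p ^+ 3.
Proof.
move=> Vp [s1 s2 _ s4] HF; have Dp := VD Vp.
have n2 : normal_field (fn2 F).
  by move=> q Vq; have [_ [_ _ H H'] _ _] := adaptedE sx nx (VD Vq) (HF q Vq).
have [[H1 H2 H3] [H4 H5 H6 H7] [H8 H9 H10] H11] := adaptedE sx nx Dp (HF p Vp).
rewrite normal_curvature_dot//.
set a := ncoord false _ in H1 H3 H11 *; set b := ncoord true _ in H1 H3 H11 *.
set c := ncoord false _ in H2 H3 H11 *; set d := ncoord true _ in H2 H3 H11 *.
set Om := det4 _ _ _ _ in H11.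
have g0 := conf_neq0 nx Dp.
have W2 : (a * d - b * c) ^+ 2 * (g p) ^+ 2 = 1.
  transitivity (g p ^+ 2 * (a * d + b * c) ^+ 2
     - (2 * g p * a * b) * (2 * g p * c * d)); first by ring.
  by rewrite H1 H2 H3; ring.
have A1 := dot_ss nx Dp; have A2 := dot_rr nx Dp.
have A3 : dot (xs p) (xr p) = g p by [].
have A4 : dot (xr p) (xs p) = g p by rewrite dotC.
have C4 : dot (xs p) (fn1 F p) = 0 by rewrite dotC.
have C5 : dot (xr p) (fn1 F p) = 0 by rewrite dotC.
have C6 : dot (xs p) (fn2 F p) = 0 by rewrite dotC.
have C7 : dot (xr p) (fn2 F p) = 0 by rewrite dotC.
have C10 : dot (fn2 F p) (fn1 F p) = 0 by rewrite dotC.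
have B1 : dot (xs p) (xss p) = 0 by rewrite dotC (dot_x2_x1 oD sx nx).
have B2 : dot (xr p) (xrr p) = 0 by rewrite dotC (dot_x2_x1 oD sx nx).
have Om2 : Om * Om = g p ^+ 2.
  rewrite /Om det4_mul det4E !mxE /=.
  by rewrite !(A1, A2, A3, A4, H4, H5, H6, H7, C4, C5, C6, C7, H8, H9, H10, C10); ring.
set Delta := det4 _ _ _ _.
set B := dot (fn2 F p) _ * _ - _.
have OmD : Om * Delta = - g p ^+ 2 * B.
  rewrite /Om /Delta det4_mul det4E !mxE /= /B.
  rewrite !(A1, A2, A3, A4, H4, H5, H6, H7, B1, B2).
  by rewrite ![dot _ (fn1 F p)]dotC; ring.
have WOm : (a * d - b * c) * Om = 1.
  have : ((a * d - b * c) * Om) ^+ 2 = 1 by rewrite -[RHS]W2 -Om2; ring.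
  move=> /eqP; rewrite sqrf_eq1 => /orP[/eqP//|/eqP E].
  by move: H11; rewrite E oppr_gt0 ltr10.
have DE : Delta = - g p ^+ 2 * B * (a * d - b * c).
  by rewrite -OmD -[LHS]mul1r -WOm; ring.
by rewrite DE; field.
Qed.

End Local.
End NormalCurvature.

(** * Canonical coordinates *)

Section Canonical.
Variable R : realType.
Local Notation plane := 'rV[R]_2.

Lemma dnum_eq (s t : dnum R) : dre s = dre t -> dim s = dim t -> s = t.
Proof. by case: s; case: t => ? ? ? ? /= -> ->. Qed.

Lemma dreD (s t : dnum R) : dre (s + t) = dre s + dre t. Proof. by []. Qed.
Lemma dimD (s t : dnum R) : dim (s + t) = dim s + dim t. Proof. by []. Qed.
Lemma dreN (s : dnum R) : dre (- s) = - dre s. Proof. by []. Qed.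
Lemma dimN (s : dnum R) : dim (- s) = - dim s. Proof. by []. Qed.
Lemma dreM (s t : dnum R) : dre (s * t) = dre s * dre t + dim s * dim t.
Proof. by []. Qed.
Lemma dimM (s t : dnum R) : dim (s * t) = dre s * dim t + dim s * dre t.
Proof. by []. Qed.
Definition dnumE := (dreD, dimD, dreN, dimN, dreM, dimM).

Lemma cplxE (a b : 'rV[R]_4) i j : cplx a b i j = DNum (a i j) (b i j).
Proof. by rewrite !mxE; apply: dnum_eq; rewrite !dnumE /=; ring. Qed.

Lemma scale_cplx k (a b c d : 'rV[R]_4) :
  dreal k *: (cplx a b + dj R *: cplx c d) = cplx (k *: (a + d)) (k *: (b + c)).
Proof.
apply/rowP => i.
transitivity (dreal k * (cplx a b 0 i + dj R * cplx c d 0 i)).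
  by rewrite [LHS]mxE [X in _ * X]mxE [X in _ * (_ + X)]mxE.
have key (A C E : dnum R) : A = DNum (a 0 i) (b 0 i) ->
    C = DNum (c 0 i) (d 0 i) ->
    E = DNum (k * (a 0 i + d 0 i)) (k * (b 0 i + c 0 i)) ->
    dreal k * (A + dj R * C) = E.
  by move=> -> -> ->; apply: dnum_eq; rewrite !dnumE /=; ring.
apply: key; rewrite cplxE//.
by congr DNum; rewrite !mxE.
Qed.

Lemma re_cplx (a b : 'rV[R]_4) : map_mx (@dre R) (cplx a b) = a.
Proof. by apply/rowP => i; rewrite mxE cplxE. Qed.

Lemma im_cplx (a b : 'rV[R]_4) : map_mx (@dim R) (cplx a b) = b.
Proof. by apply/rowP => i; rewrite mxE cplxE. Qed.

Lemma partialD_cplx i (A B : plane -> 'rV[R]_4) p :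
  partialD i (fun q => cplx (A q) (B q)) p = cplx (partial i A p) (partial i B p).
Proof.
exact: (congr2 (@cplx R)
  (congr1 (fun h => partial i h p) (funext (fun q => re_cplx (A q) (B q))))
  (congr1 (fun h => partial i h p) (funext (fun q => im_cplx (A q) (B q))))).
Qed.

Lemma derivD_cplx (A B : plane -> 'rV[R]_4) p :
  derivD (fun q => cplx (A q) (B q)) p =
  cplx (2^-1 *: (partial 0 A p + partial 1 B p))
       (2^-1 *: (partial 0 B p + partial 1 A p)).
Proof.
apply: (etrans _ (scale_cplx 2^-1 (partial 0 A p) (partial 0 B p)
  (partial 1 A p) (partial 1 B p))).
exact: (congr2 (fun u v => dreal 2^-1 *: (u + dj R *: v))
  (partialD_cplx 0 A B p) (partialD_cplx 1 A B p)).
Qed.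

Lemma dot_cplx (a b : 'rV[R]_4) :
  dot (cplx a b) (cplx a b) = DNum (dot a a + dot b b) (2 * dot a b).
Proof.
by rewrite !dotE !cplxE; apply: dnum_eq; rewrite !dnumE /=; ring.
Qed.

Variables (D : set plane) (x : plane -> 'rV[R]_4).
Hypotheses (oD : open D) (sx : smooth D x) (nx : null_surface D x).

Local Notation xs := (Dn false x : plane -> 'rV[R]_4).
Local Notation xr := (Dn true x : plane -> 'rV[R]_4).
Local Notation xss := (Dn false (Dn false x) : plane -> 'rV[R]_4).
Local Notation xsr := (Dn true (Dn false x) : plane -> 'rV[R]_4).
Local Notation xrr := (Dn true (Dn true x) : plane -> 'rV[R]_4).
Local Notation g := (conf x).

(** With the idempotents e = (1 + j)/2 and e' = (1 - j)/2 one has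
    Phi = 2 x_s e + 2 x_r e' and d/dt = e d/ds + e' d/dr, so that Phi' is
    2 x_ss e + 2 x_rr e'. *)
Lemma derivD_Phi p : D p ->
  derivD (Phi x) p = cplx (xss p + xrr p) (xss p - xrr p).
Proof.
move=> Dp; have d1 b := diff_x1 oD sx b Dp.
have P0 i : partial i (partial 0 x) p = partial i (fun q => xs q + xr q) p.
  apply: (deriv_near _ oD Dp) => q Dq.
  by rewrite partial0E//; exact: smooth_diff sx Dq.
have P1 i : partial i (partial 1 x) p = partial i (fun q => xs q - xr q) p.
  apply: (deriv_near _ oD Dp) => q Dq.
  by rewrite partial1E//; exact: smooth_diff sx Dq.
have dp : differentiable (fun q => xs q + xr q) p by exact: differentiableD (d1 false) (d1 true).
have dm : differentiable (fun q => xs q - xr q) p by exact: differentiableB (d1 false) (d1 true).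
have P00 : partial 0 (partial 0 x) p = xss p + xsr p + xsr p + xrr p.
  rewrite P0 partial0E// !(Dn_add _ (d1 false) (d1 true)) (x_rs oD sx)//.
  by rewrite !addrA.
have P11 : partial 1 (partial 1 x) p = xss p - xsr p - xsr p + xrr p.
  rewrite P1 partial1E// !(Dn_sub _ (d1 false) (d1 true)) (x_rs oD sx)//.
  by rewrite opprB addrA addrAC.
have P01 : partial 0 (partial 1 x) p = xss p - xrr p.
  rewrite P1 partial0E// !(Dn_sub _ (d1 false) (d1 true)) (x_rs oD sx)//.
  by rewrite addrA subrK.
have P10 : partial 1 (partial 0 x) p = xss p - xrr p.
  rewrite P0 partial1E// !(Dn_add _ (d1 false) (d1 true)) (x_rs oD sx)//.
  by rewrite opprD addrA addrK.
apply: (etrans (derivD_cplx (partial 0 x) (partial 1 x) p)).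
apply: (congr2 (@cplx R)); last by rewrite P01 P10; apply/rowP => i; rewrite !mxE; field.
by rewrite P00 P11; apply/rowP => i; rewrite !mxE; field.
Qed.

Lemma Phi_perp_sqE p : D p -> Phi'_perp_sq x p =
  DNum (2 * (dot (xss p) (xss p) + dot (xrr p) (xrr p)))
       (2 * (dot (xss p) (xss p) - dot (xrr p) (xrr p))).
Proof.
move=> Dp; rewrite /Phi'_perp_sq derivD_Phi// /normal_partD re_cplx im_cplx dot_cplx.
have g0 := conf_neq0 nx Dp.
have A1 := dot_ss nx Dp; have A2 := dot_rr nx Dp.
have A4 : dot (xr p) (xs p) = g p by rewrite dotC.
have A3 : dot (xs p) (xr p) = g p by [].
have B1 : dot (xss p) (xs p) = 0 by rewrite (dot_x2_x1 oD sx nx).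
have B2 : dot (xrr p) (xr p) = 0 by rewrite (dot_x2_x1 oD sx nx).
have C1 : dot (xs p) (xss p) = 0 by rewrite dotC.
have C2 : dot (xr p) (xrr p) = 0 by rewrite dotC.
rewrite (normalE sx nx (xss p + xrr p) Dp) (normalE sx nx (xss p - xrr p) Dp).
rewrite !dot_simp !(A1, A2, A3, A4, B1, B2, C1, C2).
rewrite [dot (xs p) (xrr p)]dotC [dot (xr p) (xss p)]dotC [dot (xrr p) (xss p)]dotC.
by congr DNum; field.
Qed.

Lemma Phi_perp_sq1 p : D p -> Phi'_perp_sq x p = 1 <->
  dot (xss p) (xss p) = 4^-1 /\ dot (xrr p) (xrr p) = 4^-1.
Proof.
move=> Dp; rewrite Phi_perp_sqE//; split=> [[H1 H2]|[-> ->]].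
  by split; lra.
by apply: dnum_eq => /=; field.
Qed.
End Canonical.

(** * Frames with equal scalar products *)
Section MatrixCalculus.
Variable R : realType.
Local Notation plane := 'rV[R]_2.
Variable D : set plane.
Hypothesis oD : open D.
Implicit Types p : plane.

Lemma smooth_prod (I : Type) (r : seq I) (f : I -> plane -> R) :
  (forall i, smooth D (f i)) -> smooth D (fun p => \prod_(i <- r) f i p).
Proof.
move=> sf; elim: r => [|i r IH].
  by apply: (smooth_eq oD _ (smooth_cst (1 : R) oD)) => p _; rewrite big_nil.
apply: (smooth_eq oD _ (smoothM oD (sf i) IH)) => p _; by rewrite big_cons.
Qed.

Lemma smooth_det n (F : plane -> 'M[R]_n) :
  (forall i j, smooth D (fun p => F p i j)) -> smooth D (fun p => \det (F p)).
Proof.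
move=> sF; apply: smooth_sum => // s; apply: smoothM => //.
  exact: smooth_cst.
by apply: smooth_prod => i; exact: sF.
Qed.

Lemma smooth_invmx n (F : plane -> 'M[R]_n) : smooth D F ->
  (forall p, D p -> F p \in unitmx) -> smooth D (fun p => invmx (F p)).
Proof.
move=> sF uF.
have sFe i j := smooth_entry oD i j sF.
apply: (@smooth_eq _ _ _ (fun p => (\det (F p))^-1 *: \adj (F p))) => //.
  by move=> p Dp; rewrite /invmx uF.
apply: smooth_scale => //.
  by apply: smoothV => //; [exact: smooth_det|move=> p /uF; rewrite unitmxE unitfE].
apply: smooth_mx => // i j.
apply: (@smooth_eq _ _ _ (fun p => (-1) ^+ (j + i) * \det (row' j (col' i (F p))))) => //.
  by move=> p _; rewrite mxE.
apply: smoothM => //; first exact: smooth_cst.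
apply: smooth_det => k l.
by apply: (smooth_eq oD _ (sFe (lift j k) (lift i l))) => p _; rewrite !mxE.
Qed.

Lemma smooth_mulmx m n k (F : plane -> 'M[R]_(m, n)) (H : plane -> 'M[R]_(n, k)) :
  smooth D F -> smooth D H -> smooth D (fun p => F p *m H p).
Proof.
move=> sF sH; apply: smooth_mx => // i j.
apply: (@smooth_eq _ _ _ (fun p => \sum_l F p i l * H p l j)) => //.
  by move=> p _; rewrite mxE.
by apply: smooth_sum => // l; apply: smoothM => //; exact: smooth_entry.
Qed.

Lemma Dn_sum b (I : Type) (r : seq I) (f : I -> plane -> R) p :
  (forall i, smooth D (f i)) -> D p ->
  Dn b (fun p => \sum_(i <- r) f i p) p = \sum_(i <- r) Dn b (f i) p.
Proof.
move=> sf Dp; elim: r => [|i r IH].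
  rewrite big_nil; have -> : (fun p => \sum_(i <- [::]) f i p) = fun=> 0.
    by apply/funext => q; rewrite big_nil.
  by rewrite Dn_cst.
rewrite big_cons -IH.
have -> : (fun p => \sum_(i <- i :: r) f i p) = fun p => f i p + \sum_(i <- r) f i p.
  by apply/funext => q; rewrite big_cons.
apply: Dn_add; first exact: smooth_diff (sf i) Dp.
have ss : smooth D (fun q => \sum_(j <- r) f j q) by exact: smooth_sum.
exact: smooth_diff ss Dp.
Qed.

Lemma Dn_mulmx b m n k (F : plane -> 'M[R]_(m, n)) (H : plane -> 'M[R]_(n, k)) p :
  smooth D F -> smooth D H -> D p ->
  Dn b (fun p => F p *m H p) p = Dn b F p *m H p + F p *m Dn b H p.
Proof.
move=> sF sH Dp; apply/matrixP => i j.
have dFH := smooth_diff (smooth_mulmx sF sH) Dp.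
apply: (etrans (Dn_entry b i j dFH)).
have -> : (fun q => (F q *m H q) i j) = fun q => \sum_l F q i l * H q l j.
  by apply/funext => q; rewrite mxE.
rewrite Dn_sum//; last first.
  by move=> l; apply: smoothM => //; exact: smooth_entry.
rewrite [RHS]mxE [X in X + _]mxE [X in _ + X]mxE -big_split /=.
apply: eq_bigr => l _.
have dF := smooth_diff sF Dp; have dH := smooth_diff sH Dp.
by rewrite Dn_mul ?(Dn_entry b _ _ dF) ?(Dn_entry b _ _ dH)//; exact: diff_entry.
Qed.

End MatrixCalculus.

Section Rigidity.
Variable R : realType.
Local Notation plane := 'rV[R]_2.

Definition eta : 'M[R]_4 := diag_mx (\row_i (-1) ^+ i.+1).

Lemma eta_unit : eta \in unitmx.
Proof.
by rewrite unitmxE det_diag !big_ord_recl big_ord0 !mxE /= /bump /= unitfE;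
  rewrite !exprS expr0 !mulf_neq0 ?oppr_eq0 ?oner_eq0.
Qed.

Lemma gram_rows m n (F : 'M[R]_(m, 4)) (G : 'M[R]_(n, 4)) i j :
  (F *m eta *m G^T) i j = dot (row i F) (row j G).
Proof.
rewrite mxE /dot; apply: eq_bigr => k _.
by rewrite mul_mx_diag !mxE; ring.
Qed.

Lemma dot_nondegenerate (a b c d w : 'rV[R]_4) : det4 a b c d != 0 ->
  dot a w = 0 -> dot b w = 0 -> dot c w = 0 -> dot d w = 0 -> w = 0.
Proof.
move=> H wa wb wc wd.
have uF : rows4 a b c d \in unitmx by rewrite unitmxE unitfE.
have E : rows4 a b c d *m eta *m w^T = 0.
  apply/matrixP => i j; rewrite gram_rows ord1 mxE row_id rowK.
  by case: i => -[|[|[|[|]]]].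
apply: trmx_inj; rewrite trmx0.
have := congr1 (mulmx (invmx (rows4 a b c d *m eta))) E.
by rewrite mulmx0 mulKmx// unitmx_mul uF eta_unit.
Qed.

(** Put H = F^-1 G.  Equal Gram matrices make H orthogonal; with the equality of
    the products of the derivatives this gives F' H = G'.  As F H = G, it follows
    that F H' = 0. *)
Lemma frame_rigidity (D : set plane) (F G : plane -> 'M[R]_4) :
  domain D -> D !=set0 -> smooth D F -> smooth D G ->
  (forall p, D p -> F p \in unitmx) ->
  (forall p, D p -> F p *m eta *m (F p)^T = G p *m eta *m (G p)^T) ->
  (forall p b, D p ->
     Dn b F p *m eta *m (F p)^T = Dn b G p *m eta *m (G p)^T) ->
  exists A : 'M[R]_4, A *m eta *m A^T = eta /\ forall p, D p -> G p = F p *m A.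
Proof.
move=> dD [p0 Dp0] sF sG uF HS HT; have oD := dD.1.
pose H p := invmx (F p) *m G p.
have sH : smooth D H by apply: smooth_mulmx => //; exact: smooth_invmx.
have FH p : D p -> F p *m H p = G p by move=> Dp; rewrite mulKVmx// uF.
have Heta p : D p -> H p *m eta *m (H p)^T = eta.
  move=> Dp; have := HS p Dp; rewrite -!FH// trmx_mul !mulmxA => E.
  have uFt : (F p)^T \in unitmx by rewrite unitmx_tr uF.
  have E1 : F p *m eta = F p *m (H p *m eta *m (H p)^T).
    by rewrite !mulmxA; apply: (can_inj (mulmxK uFt)).
  by have := congr1 (mulmx (invmx (F p))) E1; rewrite !mulKmx ?uF.
have uG p : D p -> G p \in unitmx.
  move=> Dp; rewrite -FH// unitmx_mul uF//=.
  have := eta_unit; rewrite -{1}(Heta p Dp) !unitmx_mul.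
  by case/andP => /andP[].
have DH b p : D p -> Dn b H p = 0.
  move=> Dp.
  have E : Dn b F p *m H p + F p *m Dn b H p = Dn b G p.
    by rewrite -(Dn_mulmx oD b sF sH Dp); exact: Dn_near oD Dp FH.
  have E2 : Dn b F p *m H p = Dn b G p.
    have ueG : eta *m (G p)^T \in unitmx.
      by rewrite unitmx_mul eta_unit unitmx_tr uG.
    have key (f h k df : 'M[R]_4) : f *m h = k -> h *m eta *m h^T = eta ->
        df *m h *m (eta *m k^T) = df *m eta *m f^T.
      by move=> <- he; rewrite -[in RHS]he trmx_mul !mulmxA.
    apply: (can_inj (mulmxK ueG)).
    by rewrite (key _ _ _ _ (FH p Dp) (Heta p Dp)) mulmxA; exact: HT.
  move: E; rewrite E2 => /eqP; rewrite -[X in _ == X]addr0 (inj_eq (addrI _)).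
  by move=> /eqP /(congr1 (mulmx (invmx (F p)))); rewrite mulKmx ?uF// mulmx0.
have cH p : D p -> H p = H p0.
  move=> Dp; apply: (const_connected dD) Dp0 Dp.
    by move=> q Dq; exact: smooth_diff sH Dq.
  move=> q v Dq; rewrite (deriv_nvec v (smooth_diff sH Dq)) !DH//.
  by rewrite !scaler0 addr0.
exists (H p0); split; first exact: Heta.
by move=> p Dp; rewrite -(cH p Dp) FH.
Qed.

End Rigidity.

(** * Canonical surfaces in null coordinates *)

Section NullData.
Variable R : realType.
Local Notation plane := 'rV[R]_2.

(** The conditions on a canonical surface with curvatures K and kappa, expressed by
    null derivatives without frames or connections. *)
Definition null_data (U : set plane) (x : plane -> 'rV[R]_4) (K kappa : plane -> R) :=
  [/\ smooth U x, null_surface U x,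
    (forall p, U p -> Dn true (Dn false x) p = 0),
    (forall p b, U p -> dot (Dn b (Dn b x) p) (Dn b (Dn b x) p) = 4^-1) &
    (forall p, U p ->
       K p = - (conf x p * Dn true (Dn false (conf x)) p
                - Dn false (conf x) p * Dn true (conf x) p) / conf x p ^+ 3 /\
       kappa p = - det4 (Dn false x p) (Dn true x p)
          (Dn false (Dn false x) p) (Dn true (Dn true x) p) / conf x p ^+ 3)].

Lemma canonical_null_data U x K kappa :
  canonical_surface_with x U K kappa -> null_data U x K kappa.
Proof.
move=> [[[oU _] sx _ _] mx _ [ix cx] HK].
have nx : null_surface U x by apply/(isothermal_null sx).
have wave := minimal_sr oU sx nx mx.
split=> //.
  move=> p b Up; have /(Phi_perp_sq1 oU sx nx Up)[H1 H2] := cx p Up.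
  by case: b.
move=> p Up; have [[[F HF] /(_ F HF) <-] [_ /(_ F HF) <-]] := HK p Up.
have [V [oV VU Vp sF aF]] := adapted_localize oU Up HF.
split; first exact: (gauss_value oU sx nx oV VU Vp sF (aF p Vp)).
exact: (normal_value oU sx nx wave oV VU Vp sF aF).
Qed.

Definition rv4 (a b c d : R) : 'rV[R]_4 := \row_j [:: a; b; c; d]`_j.

Lemma gram_rows4 (a b c d a' b' c' d' : 'rV[R]_4) :
  rows4 a b c d *m eta R *m (rows4 a' b' c' d')^T =
  let G v := rv4 (dot v a') (dot v b') (dot v c') (dot v d') in
  rows4 (G a) (G b) (G c) (G d).
Proof.
apply/matrixP => i j; rewrite gram_rows !rowK mxE /=.
by case: i => -[|[|[|[|]]]]//= ?; rewrite mxE; case: j => -[|[|[|[|]]]].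
Qed.

Lemma smooth_rows4 D (a b c d : plane -> 'rV[R]_4) : open D -> smooth D a ->
  smooth D b -> smooth D c -> smooth D d ->
  smooth D (fun p => rows4 (a p) (b p) (c p) (d p)).
Proof.
move=> oD sa sb sc sd; apply: smooth_mx => // -[i Hi] j.
apply: (@smooth_eq R R D (fun p => [:: a p; b p; c p; d p]`_i 0 j)) => //.
  by move=> p _; rewrite mxE.
by case: i Hi => [|[|[|[|]]]]//= _; exact: smooth_entry.
Qed.

Lemma Dn_rows4 D (a b c d : plane -> 'rV[R]_4) e p : open D -> smooth D a ->
  smooth D b -> smooth D c -> smooth D d -> D p ->
  Dn e (fun p => rows4 (a p) (b p) (c p) (d p)) p =
  rows4 (Dn e a p) (Dn e b p) (Dn e c p) (Dn e d p).
Proof.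
move=> oD sa sb sc sd Dp; apply/matrixP => -[i Hi] j.
have dr := smooth_diff (smooth_rows4 oD sa sb sc sd) Dp.
apply: (etrans (Dn_entry e (Ordinal Hi) j dr)).
have -> : (fun q => rows4 (a q) (b q) (c q) (d q) (Ordinal Hi) j) =
    fun q => [:: a q; b q; c q; d q]`_i 0 j.
  by apply/funext => q; rewrite mxE.
rewrite mxE /=.
case: i Hi dr => [|[|[|[|]]]]//= Hi _; apply/esym; apply: Dn_entry.
- exact: smooth_diff sa Dp.
- exact: smooth_diff sb Dp.
- exact: smooth_diff sc Dp.
- exact: smooth_diff sd Dp.
Qed.

Lemma smooth_cross D (a b c : plane -> 'rV[R]_4) : open D -> smooth D a ->
  smooth D b -> smooth D c -> smooth D (fun p => cross (a p) (b p) (c p)).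
Proof.
move=> oD sa sb sc; apply: smooth_mx => // i j.
apply: (@smooth_eq R R D (fun p =>
   (-1) ^+ j.+1 * \det (rows4 (a p) (b p) (c p) (delta_mx 0 j)))) => //.
  by move=> p _; rewrite mxE.
apply: smoothM => //; first exact: smooth_cst.
apply: smooth_det => // k l; apply: smooth_entry => //.
by apply: smooth_rows4 => //; exact: smooth_cst.
Qed.

Section OneSurface.
Variables (U : set plane) (x : plane -> 'rV[R]_4) (K kappa : plane -> R).
Hypotheses (oU : open U) (Hx : null_data U x K kappa).
Hypotheses (sk : smooth U kappa).
Hypothesis (posK : forall p, U p -> 0 < K p ^+ 2 - kappa p ^+ 2).

Local Notation xs := (Dn false x : plane -> 'rV[R]_4).
Local Notation xr := (Dn true x : plane -> 'rV[R]_4).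
Local Notation xss := (Dn false (Dn false x) : plane -> 'rV[R]_4).
Local Notation xrr := (Dn true (Dn true x) : plane -> 'rV[R]_4).
Local Notation g := (conf x).

Let sx : smooth U x. Proof. by case: Hx. Qed.
Let nx : null_surface U x. Proof. by case: Hx. Qed.
Let wave p : U p -> Dn true (Dn false x) p = 0. Proof. by case: Hx => _ _ +  _ _; apply. Qed.

Definition mvec p : 'rV[R]_4 := cross (xs p) (xr p) (xss p).
Definition Delta p : R := det4 (xs p) (xr p) (xss p) (xrr p).

Lemma Dn_conf_s p : U p -> Dn false g p = dot (xss p) (xr p).
Proof.
move=> Up; rewrite /conf (Dn_dot _ (diff_x1 oU sx _ Up) (diff_x1 oU sx _ Up)).
by rewrite (x_rs oU sx)// wave// dot0r addr0.
Qed.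

Lemma Dn_conf_r p : U p -> Dn true g p = dot (xs p) (xrr p).
Proof.
move=> Up; rewrite /conf (Dn_dot _ (diff_x1 oU sx _ Up) (diff_x1 oU sx _ Up)).
by rewrite wave// dot0l add0r.
Qed.

Lemma xssr p : U p -> Dn true (Dn false (Dn false x)) p = 0.
Proof.
move=> Up; rewrite (Dn_comm _ _ oU (smooth_x1 oU sx false) Up).
by rewrite (Dn_near (G := fun=> 0) false oU Up wave) Dn_cst.
Qed.

Lemma xrrs p : U p -> Dn false (Dn true (Dn true x)) p = 0.
Proof.
move=> Up; rewrite (Dn_comm _ _ oU (smooth_x1 oU sx true) Up).
rewrite (Dn_near (G := fun=> 0) true oU Up) ?Dn_cst// => q Uq.
by rewrite (x_rs oU sx)// wave.
Qed.

Lemma Dn_conf_sr p : U p -> Dn true (Dn false g) p = dot (xss p) (xrr p).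
Proof.
move=> Up; rewrite (Dn_near true oU Up Dn_conf_s).
rewrite (Dn_dot _ (diff_x2 oU sx _ _ Up) (diff_x1 oU sx _ Up)).
by rewrite xssr// dot0l add0r.
Qed.

(** The squared determinant of x_s, x_r, x_ss, x_rr is their Gram determinant,
    which equals - g^2 / 16 + (g g_sr - g_s g_r)^2. *)
Lemma conf_pow4 p : U p -> 16 * g p ^+ 4 * (K p ^+ 2 - kappa p ^+ 2) = 1.
Proof.
move=> Up; have [_ _ _ /(_ p) C /(_ p Up)[-> ->]] := Hx.
have A1 := dot_ss nx Up; have A2 := dot_rr nx Up.
have A3 : dot (xs p) (xr p) = g p by [].
have A4 : dot (xr p) (xs p) = g p by rewrite dotC.
have B1 : dot (xss p) (xs p) = 0 by rewrite (dot_x2_x1 oU sx nx).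
have B2 : dot (xrr p) (xr p) = 0 by rewrite (dot_x2_x1 oU sx nx).
have B3 : dot (xs p) (xss p) = 0 by rewrite dotC.
have B4 : dot (xr p) (xrr p) = 0 by rewrite dotC.
have C1 := C false Up; have C2 := C true Up.
have g0 := conf_neq0 nx Up.
have D2 : Delta p * Delta p = - g p ^+ 2 / 16 +
   (g p * Dn true (Dn false g) p - Dn false g p * Dn true g p) ^+ 2.
  rewrite Dn_conf_sr// Dn_conf_s// Dn_conf_r//.
  rewrite /Delta det4_mul det4E !mxE /=.
  rewrite !(A1, A2, A3, A4, B1, B2, B3, B4, C1, C2).
  rewrite [dot (xr p) (xss p)]dotC [dot (xrr p) (xss p)]dotC [dot (xrr p) (xs p)]dotC.
  by field.
rewrite -/(Delta p).
set L := (_ - _ * _ : R) in D2 *.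
have -> : 16 * g p ^+ 4 * ((- L / g p ^+ 3) ^+ 2 - (- Delta p / g p ^+ 3) ^+ 2) =
   16 / g p ^+ 2 * (L ^+ 2 - Delta p * Delta p) by field.
by rewrite D2; field.
Qed.

End OneSurface.
End NullData.

(** * Uniqueness *)

Section Uniqueness.
Variable R : realType.
Local Notation plane := 'rV[R]_2.

(** The products of the frame x_s, x_r, x_ss, m, and below those of its derivatives
    along s and r (by rows) with the frame (by columns). *)
Definition gram_mx (g gs : R) : 'M[R]_4 :=
  rows4 (rv4 0 g 0 0) (rv4 g 0 gs 0) (rv4 0 gs 4^-1 0) (rv4 0 0 0 (- g ^+ 2 / 4)).

Definition table_s (g gs gss mu : R) : 'M[R]_4 :=
  rows4 (rv4 0 gs 4^-1 0) (rv4 0 0 0 0) (rv4 (- 4^-1) gss 0 mu)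
    (rv4 0 0 (- mu) (- g * gs / 4)).

Definition table_r (g gr gsr Del : R) : 'M[R]_4 :=
  rows4 (rv4 0 0 0 0) (rv4 gr 0 gsr Del) (rv4 0 0 0 0)
    (rv4 0 (- Del) 0 (- g * gr / 4)).

Section OneSurface.
Variables (U : set plane) (x : plane -> 'rV[R]_4) (K kappa : plane -> R).
Hypotheses (oU : open U) (Hx : null_data U x K kappa).
Hypotheses (sk : smooth U kappa).
Hypothesis (posK : forall p, U p -> 0 < K p ^+ 2 - kappa p ^+ 2).

Local Notation xs := (Dn false x : plane -> 'rV[R]_4).
Local Notation xr := (Dn true x : plane -> 'rV[R]_4).
Local Notation xss := (Dn false (Dn false x) : plane -> 'rV[R]_4).
Local Notation xrr := (Dn true (Dn true x) : plane -> 'rV[R]_4).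
Local Notation g := (conf x).
Local Notation m := (mvec x).

Let sx : smooth U x. Proof. by case: Hx. Qed.
Let nx : null_surface U x. Proof. by case: Hx. Qed.
Let wave p : U p -> Dn true (Dn false x) p = 0. Proof. by case: Hx => _ _ +  _ _; apply. Qed.

Lemma K_neq0 p : U p -> K p != 0.
Proof.
move=> /posK; apply: contraTneq => ->.
by rewrite -leNgt expr0n /= sub0r oppr_le0 sqr_ge0.
Qed.

Lemma smooth_m : smooth U m.
Proof. by apply: smooth_cross => //; [exact: smooth_x1..|exact: smooth_x2]. Qed.

Lemma dot_m w p : dot (m p) w = det4 (xs p) (xr p) (xss p) w.
Proof. exact: dot_cross. Qed.

Lemma det4_rep1 (a b c : 'rV[R]_4) : det4 a b c a = 0.
Proof. by rewrite det4E; ring. Qed.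
Lemma det4_rep2 (a b c : 'rV[R]_4) : det4 a b c b = 0.
Proof. by rewrite det4E; ring. Qed.
Lemma det4_rep3 (a b c : 'rV[R]_4) : det4 a b c c = 0.
Proof. by rewrite det4E; ring. Qed.

Let xs_null p : U p -> dot (xs p) (xs p) = 0. Proof. exact: dot_ss. Qed.
Let xr_null p : U p -> dot (xr p) (xr p) = 0. Proof. exact: dot_rr. Qed.
Let xss_xs p : U p -> dot (xss p) (xs p) = 0.
Proof. by move=> Up; rewrite (dot_x2_x1 oU sx nx). Qed.
Let xrr_xr p : U p -> dot (xrr p) (xr p) = 0.
Proof. by move=> Up; rewrite (dot_x2_x1 oU sx nx). Qed.
Let xss_norm p : U p -> dot (xss p) (xss p) = 4^-1.
Proof. by move=> Up; have [_ _ _ /(_ p false Up)] := Hx. Qed.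
Let xrr_norm p : U p -> dot (xrr p) (xrr p) = 4^-1.
Proof. by move=> Up; have [_ _ _ /(_ p true Up)] := Hx. Qed.
Let m_xs p : dot (m p) (xs p) = 0. Proof. by rewrite dot_m det4_rep1. Qed.
Let m_xr p : dot (m p) (xr p) = 0. Proof. by rewrite dot_m det4_rep2. Qed.
Let m_xss p : dot (m p) (xss p) = 0. Proof. by rewrite dot_m det4_rep3. Qed.
Let m_xrr p : dot (m p) (xrr p) = Delta x p. Proof. by rewrite dot_m. Qed.

Let m_norm p : U p -> dot (m p) (m p) = - g p ^+ 2 / 4.
Proof.
move=> Up; rewrite cross_norm xs_null// xr_null// [dot (xs p) (xss p)]dotC xss_xs// xss_norm//.
by rewrite -/(g p); field.
Qed.

Let dm p : U p -> differentiable m p.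
Proof. by move=> Up; exact: smooth_diff smooth_m Up. Qed.

Let d1 b p : U p -> differentiable (Dn b x : plane -> 'rV[R]_4) p.
Proof. exact: diff_x1. Qed.
Let d2 b b' p : U p -> differentiable (Dn b (Dn b' x) : plane -> 'rV[R]_4) p.
Proof. exact: diff_x2. Qed.

Let Dn_ortho b (F G : plane -> 'rV[R]_4) (c : R) p : U p ->
  differentiable F p -> differentiable G p ->
  (forall q, U q -> dot (F q) (G q) = c) ->
  dot (Dn b F p) (G p) = - dot (F p) (Dn b G p).
Proof.
move=> Up dF dG FG; apply/eqP; rewrite -addr_eq0 -(Dn_dot b dF dG).
by rewrite (Dn_near (G := fun=> c) b oU Up FG) Dn_cst.
Qed.

Let Dn_mm b p : U p -> dot (Dn b m p) (m p) = - g p * Dn b g p / 4.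
Proof.
move=> Up.
have E : Dn b (fun q => dot (m q) (m q)) p = Dn b (fun q => - (g q * g q) * 4^-1) p.
  by apply: (Dn_near b oU Up) => q Uq; rewrite m_norm// expr2.
have dg := smooth_diff (smooth_conf oU sx) Up.
move: E; rewrite (Dn_dot b (dm Up) (dm Up)) [dot (m p) _]dotC.
by Dns => E; lra.
Qed.

(** The value of x_sss . m in terms of g and the curvatures; [dd] is the derivative
    of kappa g^3 along s. *)
Definition mu_of (k kp dd gg gs : R) : R :=
  (- dd + k * gg ^+ 2 * gs) / (4 * kp * gg ^+ 2).

Let DeltaE p : U p -> Delta x p = - kappa p * g p ^+ 3.
Proof.
move=> Up; have [_ _ _ _ /(_ p Up)[_ ->]] := Hx.
by rewrite -/(Delta x p); field; exact: (conf_neq0 nx Up).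
Qed.

Let frame_det p : U p -> det4 (xs p) (xr p) (xss p) (m p) != 0.
Proof.
move=> Up; rewrite -dot_m m_norm// mulNr oppr_eq0.
by rewrite !mulf_neq0 ?expf_neq0 ?invr_eq0// (conf_neq0 nx Up).
Qed.

(** The Gram matrix is invertible, so the coefficients are determined by the
    products of x_rr with the frame. *)
Let xrr_dec p : U p -> xrr p =
  (4 * K p * g p * Dn false g p) *: xs p + (Dn true g p / g p) *: xr p
  - (4 * K p * g p ^+ 2) *: xss p + (4 * kappa p * g p) *: m p.
Proof.
move=> Up; have g0 := conf_neq0 nx Up.
have [_ _ _ _ /(_ p Up)[KE _]] := Hx.
apply/eqP; rewrite -subr_eq0; apply/eqP.
have S1 : dot (xs p) (xrr p) = Dn true g p by rewrite -(Dn_conf_r oU Hx).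
have S2 : dot (xss p) (xr p) = Dn false g p by rewrite -(Dn_conf_s oU Hx).
have S3 : dot (xss p) (xrr p) = Dn true (Dn false g) p by rewrite -(Dn_conf_sr oU Hx).
have S4 : dot (xs p) (xr p) = g p by [].
apply: (dot_nondegenerate (frame_det Up)); rewrite !dot_simp.
- rewrite S1 xs_null// S4 [dot (xs p) (xss p)]dotC xss_xs// [dot (xs p) (m p)]dotC m_xs.
  by field.
- rewrite [dot (xr p) (xrr p)]dotC xrr_xr// [dot (xr p) (xs p)]dotC S4 xr_null//.
  by rewrite [dot (xr p) (xss p)]dotC S2 [dot (xr p) (m p)]dotC m_xr; ring.
- rewrite S3 xss_xs// S2 xss_norm// [dot (xss p) (m p)]dotC m_xss KE.
  by field.
- by rewrite m_xrr m_xs m_xr m_xss m_norm// DeltaE//; field.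
Qed.

Let smooth_kg : smooth U (fun q => kappa q * g q ^+ 3).
Proof.
have sg := smooth_conf oU sx.
apply: (@smooth_eq _ _ _ (fun q => kappa q * (g q * (g q * g q)))) => //.
by apply: smoothM => //; apply: smoothM => //; exact: smoothM.
Qed.

Definition mu p : R :=
  mu_of (kappa p) (K p) (Dn false (fun q => kappa q * g q ^+ 3) p) (g p) (Dn false g p).

(** As x_rrs = 0, the derivative of m . x_rr = - kappa g^3 along s is m_s . x_rr.
    Expanding x_rr in the frame turns this into a linear equation for
    x_sss . m = - m_s . x_ss, with coefficient 4 K g^2. *)
Let xsss_m p : U p -> dot (Dn false (Dn false (Dn false x)) p) (m p) = mu p.
Proof.
move=> Up; have g0 := conf_neq0 nx Up; have K0 := K_neq0 Up.
set M := dot _ _.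
have E : Dn false (fun q => dot (m q) (xrr q)) p = - Dn false (fun q => kappa q * g q ^+ 3) p.
  rewrite -Dn_opp; last exact: smooth_diff smooth_kg Up.
  by apply: (Dn_near false oU Up) => q Uq; rewrite m_xrr DeltaE// mulNr.
move: E; rewrite (Dn_dot false (dm Up) (d2 _ _ Up)) (xrrs oU Hx)// dot0r addr0.
have P1 : dot (Dn false m p) (xs p) = 0.
  by rewrite (Dn_ortho false Up (dm Up) (d1 false Up) (fun q _ => m_xs q)) m_xss oppr0.
have P2 : dot (Dn false m p) (xr p) = 0.
  rewrite (Dn_ortho false Up (dm Up) (d1 true Up) (fun q _ => m_xr q)).
  by rewrite (x_rs oU sx)// wave// dot0r oppr0.
have P3 : dot (Dn false m p) (xss p) = - M.
  by rewrite (Dn_ortho false Up (dm Up) (d2 false false Up) (fun q _ => m_xss q)) dotC.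
rewrite xrr_dec// !dot_simp P1 P2 P3 Dn_mm// /mu /mu_of => E.
have -> : Dn false (fun q => kappa q * g q ^+ 3) p =
   - (4 * K p * g p ^+ 2 * M - kappa p * g p ^+ 2 * Dn false g p).
  by apply: oppr_inj; rewrite -E; field.
by field; rewrite g0 K0.
Qed.

Definition frame_mx p : 'M[R]_4 := rows4 (xs p) (xr p) (xss p) (m p).

Lemma smooth_frame_mx : smooth U frame_mx.
Proof.
by apply: smooth_rows4 => //; [exact: smooth_x1|exact: smooth_x1|exact: smooth_x2|
  exact: smooth_m].
Qed.

Lemma det_frame_mx p : U p -> \det (frame_mx p) = - g p ^+ 2 / 4.
Proof. by move=> Up; rewrite -[LHS]dot_m m_norm. Qed.

Lemma gram_frame_mx p : U p ->
  frame_mx p *m eta R *m (frame_mx p)^T = gram_mx (g p) (Dn false g p).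
Proof.
move=> Up; rewrite gram_rows4 /gram_mx /=.
have S1 : dot (xs p) (xss p) = 0 by rewrite dotC xss_xs.
have S2 : dot (xr p) (xs p) = g p by rewrite dotC.
have S3 : dot (xr p) (xss p) = Dn false g p by rewrite dotC -(Dn_conf_s oU Hx).
have N1 : dot (xs p) (m p) = 0 by rewrite dotC m_xs.
have N2 : dot (xr p) (m p) = 0 by rewrite dotC m_xr.
have N3 : dot (xss p) (m p) = 0 by rewrite dotC m_xss.
by rewrite m_xs m_xr m_xss N1 N2 N3 m_norm// xs_null// xr_null//
   xss_norm// xss_xs// S1 S2 [dot (xss p) _]dotC S3.
Qed.

Lemma table_frame_s p : U p ->
  Dn false frame_mx p *m eta R *m (frame_mx p)^T =
  table_s (g p) (Dn false g p) (Dn false (Dn false g) p) (mu p).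
Proof.
move=> Up; rewrite (Dn_rows4 false oU (smooth_x1 oU sx _) (smooth_x1 oU sx _)
   (smooth_x2 oU sx _ _) smooth_m Up) gram_rows4 /table_s /=.
have S2 : dot (xss p) (xr p) = Dn false g p by rewrite -(Dn_conf_s oU Hx).
have N3 : dot (xss p) (m p) = 0 by rewrite dotC m_xss.
have T1 : dot (Dn false xss p) (xs p) = - 4^-1.
  by rewrite (Dn_ortho false Up (d2 _ _ Up) (d1 _ Up) xss_xs) xss_norm.
have T2 : dot (Dn false xss p) (xr p) = Dn false (Dn false g) p.
  rewrite (Dn_near false oU Up (Dn_conf_s oU Hx)).
  by rewrite (Dn_dot false (d2 _ _ Up) (d1 _ Up)) (x_rs oU sx)// wave// dot0r addr0.
have T3 : dot (Dn false xss p) (xss p) = 0.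
  have := Dn_ortho false Up (d2 false false Up) (d2 false false Up) xss_norm.
  rewrite [X in _ = - X]dotC; lra.
have P1 : dot (Dn false m p) (xs p) = 0.
  by rewrite (Dn_ortho false Up (dm Up) (d1 false Up) (fun q _ => m_xs q)) m_xss oppr0.
have P2 : dot (Dn false m p) (xr p) = 0.
  rewrite (Dn_ortho false Up (dm Up) (d1 true Up) (fun q _ => m_xr q)).
  by rewrite (x_rs oU sx)// wave// dot0r oppr0.
have P3 : dot (Dn false m p) (xss p) = - mu p.
  rewrite (Dn_ortho false Up (dm Up) (d2 false false Up) (fun q _ => m_xss q)).
  by rewrite dotC xsss_m.
rewrite P1 P2 P3 Dn_mm// T1 T2 T3 xsss_m// (x_rs oU sx)// wave// !dot0l.
by rewrite xss_xs// S2 xss_norm// N3.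
Qed.

Lemma table_frame_r p : U p ->
  Dn true frame_mx p *m eta R *m (frame_mx p)^T =
  table_r (g p) (Dn true g p) (Dn true (Dn false g) p) (- kappa p * g p ^+ 3).
Proof.
move=> Up; rewrite (Dn_rows4 true oU (smooth_x1 oU sx _) (smooth_x1 oU sx _)
   (smooth_x2 oU sx _ _) smooth_m Up) gram_rows4 /table_r /=.
have S1 : dot (xrr p) (xs p) = Dn true g p by rewrite dotC -(Dn_conf_r oU Hx).
have S3 : dot (xrr p) (xss p) = Dn true (Dn false g) p.
  by rewrite dotC -(Dn_conf_sr oU Hx).
have S4 : dot (xrr p) (m p) = - kappa p * g p ^+ 3 by rewrite dotC m_xrr DeltaE.
have P1 : dot (Dn true m p) (xs p) = 0.
  rewrite (Dn_ortho true Up (dm Up) (d1 false Up) (fun q _ => m_xs q)).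
  by rewrite wave// dot0r oppr0.
have P2 : dot (Dn true m p) (xr p) = - (- kappa p * g p ^+ 3).
  by rewrite (Dn_ortho true Up (dm Up) (d1 true Up) (fun q _ => m_xr q)) m_xrr DeltaE.
have P3 : dot (Dn true m p) (xss p) = 0.
  rewrite (Dn_ortho true Up (dm Up) (d2 false false Up) (fun q _ => m_xss q)).
  by rewrite (xssr oU Hx)// dot0r oppr0.
rewrite P1 P2 P3 Dn_mm// wave// (xssr oU Hx)// !dot0l.
by rewrite S1 xrr_xr// S3 S4.
Qed.

(** The tangent frame consists of x_u and x_v, normalized.  The normal plane is
    spanned by the time-like vector m and by the normal part of x_ss, which is
    space-like of square 1/4; the sign of n1 = (2 / g) m is the one that makes the
    frame positively oriented. *)
Lemma adapted_frame_exists p : U p -> exists F, adapted_near x F p.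
Proof.
move=> Up.
have sg := smooth_conf oU sx.
have g0 q : U q -> g q != 0 := fun Uq => conf_neq0 nx Uq.
have pos q : U q -> 0 < -2 * g q.
  by move=> /(conf_lt0 nx); lra.
pose lam q := (Num.sqrt (-2 * g q))^-1.
have scst (c : R) : smooth U (fun=> c) := smooth_cst c oU.
have slam : smooth U lam.
  apply: smoothV => //; last by move=> q /pos; rewrite -sqrtr_gt0 => /lt0r_neq0.
  by apply: smooth_sqrt => //; exact: smoothM.
have lam2 q : U q -> lam q ^+ 2 * (-2 * g q) = 1.
  move=> Uq; have := pos q Uq => c0.
  by rewrite exprVn sqr_sqrtr ?(ltW c0)// mulVf// gt_eqF.
pose F := Frame (fun q => lam q *: delta_mx 0 0) (fun q => lam q *: delta_mx 0 1)
  (fun q => (2 * (g q)^-1) *: m q)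
  (fun q => 2 *: xss q + (-2 * (Dn false g q * (g q)^-1)) *: xs q).
have sgV : smooth U (fun q => (g q)^-1) by exact: smoothV.
exists F, U; split=> //.
  split=> /=.
  - by apply: smooth_scale => //; exact: smooth_cst.
  - by apply: smooth_scale => //; exact: smooth_cst.
  - by apply: smooth_scale; [|exact: smoothM|exact: smooth_m].
  - apply: smooth_addmx => //; apply: smooth_scale => //; first exact: smooth_x2.
      apply: smoothM => //; apply: smoothM => //.
      exact: smooth_DnR.
    exact: smooth_x1.
move=> q Uq; have l2 := lam2 q Uq; have gq := g0 q Uq.
have S2 : dot (xss q) (xr q) = Dn false g q by rewrite -(Dn_conf_s oU Hx).
have N3 : dot (xss q) (m q) = 0 by rewrite dotC m_xss.
have N1 : dot (xs q) (m q) = 0 by rewrite dotC m_xs.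
have S1 : dot (xs q) (xr q) = g q by [].
have S3 : dot (xs q) (xss q) = 0 by rewrite dotC xss_xs.
split=> /=.
- rewrite !(first_formE sx nx _ _ Uq) !ncoordZ /ncoord !mxE /=.
  have E : lam q ^+ 2 * g q = - 2^-1 by lra.
  split.
  + transitivity (2 * (lam q ^+ 2 * g q)); first by ring.
    by rewrite E; field.
  + transitivity (-2 * (lam q ^+ 2 * g q)); first by ring.
    by rewrite E; field.
  + by ring.
- split; apply/(normalP sx _ Uq); rewrite !dot_simp.
    by rewrite m_xs m_xr !mulr0.
  rewrite xss_xs// xs_null// S2 S1 !mulr0 addr0; split=> //.
  by field.
- rewrite !dot_simp m_norm// m_xs m_xss xss_norm// xss_xs// S3 xs_null//.
  by split; [field|field|ring].
- rewrite !(derivx sx)// -/(det4 _ _ _ _).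
  rewrite !ncoordZ.
  have -> : det4 ((lam q * ncoord false (delta_mx 0 0)) *: xs q +
      (lam q * ncoord true (delta_mx 0 0)) *: xr q)
     ((lam q * ncoord false (delta_mx 0 1)) *: xs q +
      (lam q * ncoord true (delta_mx 0 1)) *: xr q)
     ((2 / g q) *: m q) (2 *: xss q + (-2 * (Dn false g q / g q)) *: xs q) =
     (8 * lam q ^+ 2 / g q) * det4 (xs q) (xr q) (xss q) (m q).
    by rewrite /ncoord !mxE /= !det4E !mxE; ring.
  rewrite -dot_m m_norm//.
  have -> : 8 * lam q ^+ 2 / g q * (- g q ^+ 2 / 4) = lam q ^+ 2 * (-2 * g q) by field.
  by rewrite l2.
Qed.

Lemma null_data_canonical : domain U -> canonical_surface_with x U K kappa.
Proof.
move=> dU; have iso : isothermal x U by exact/(isothermal_null sx).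
have Phi1 p : U p -> Phi'_perp_sq x p = 1.
  by move=> Up; apply/(Phi_perp_sq1 oU sx nx Up); split; [exact: xss_norm|exact: xrr_norm].
split=> //.
- split=> // p Up; have gp := conf_lt0 nx Up; have dx := smooth_diff sx Up.
    move=> v w; rewrite -!deriveE// !(derivx sx _ Up) => E.
    rewrite [v]nvec_dec [w]nvec_dec.
    have g0 := conf_neq0 nx Up.
    have Es := congr1 (dot (xs p)) E; have Er := congr1 (dot (xr p)) E.
    move: Es Er; rewrite !dot_simp xs_null// xr_null// [dot (xr p) (xs p)]dotC -/(g p).
    rewrite !mulr0 !add0r !addr0 => /(mulIf g0) -> /(mulIf g0) ->.
    by [].
  split.
    exists (nvec false + nvec true).
    by rewrite (first_formE sx nx _ _ Up) !ncoordD !ncoord_nvec /=; lra.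
  exists (nvec false - nvec true).
  by rewrite (first_formE sx nx _ _ Up) !ncoordB !ncoord_nvec /=; lra.
- move=> p Up; split; first exact: adapted_frame_exists.
  by move=> F HF; rewrite (mean_value_frame oU sx nx Up HF) wave// scaler0.
- split=> // p /Phi1 ->; by split; rewrite /dnormsq ?mul1r /= ltr01.
- move=> p Up; have [_ _ _ _ /(_ p Up)[-> ->]] := Hx.
  split; split; [exact: adapted_frame_exists| |exact: adapted_frame_exists|] => F HF;
    have [V [oV VU Vp sF aF]] := adapted_localize oU Up HF.
    exact: (gauss_value oU sx nx oV VU Vp sF (aF p Vp)).
  exact: (normal_value oU sx nx wave oV VU Vp sF aF).
Qed.

End OneSurface.

Lemma motion_unique (U : set plane) (x y : plane -> 'rV[R]_4)
    (K kappa : plane -> R) : domain U -> U !=set0 -> smooth U kappa ->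
  (forall p, U p -> 0 < K p ^+ 2 - kappa p ^+ 2) ->
  null_data U x K kappa -> null_data U y K kappa ->
  exists M : 'rV[R]_4 -> 'rV[R]_4,
    proper_motion M /\ forall p, U p -> y p = M (x p).
Proof.
move=> dU [p0 Up0] sk posK Hx Hy; have oU := dU.1.
have [sx nx _ _ _] := Hx; have [sy ny _ _ _] := Hy.
have Eg p : U p -> conf y p = conf x p.
  move=> Up; have gx := conf_lt0 nx Up; have gy := conf_lt0 ny Up.
  have Ex := conf_pow4 oU Hx Up; have Ey := conf_pow4 oU Hy Up.
  have c0 : 16 * (K p ^+ 2 - kappa p ^+ 2) != 0.
    by rewrite mulf_neq0 ?gt_eqF ?posK.
  have E4 : (- conf y p) ^+ 4 = (- conf x p) ^+ 4.
    apply: (mulfI c0); transitivity (1 : R); first by rewrite -[RHS]Ey; ring.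
    by rewrite -[LHS]Ex; ring.
  apply: oppr_inj; apply/eqP.
  by rewrite -(@eqrXn2 _ 4) ?oppr_ge0 ?(ltW gx) ?(ltW gy) ?E4.
have Eg1 b p : U p -> Dn b (conf y) p = Dn b (conf x) p.
  by move=> Up; exact: (Dn_near b oU Up Eg).
have Eg2 b b' p : U p -> Dn b (Dn b' (conf y)) p = Dn b (Dn b' (conf x)) p.
  by move=> Up; exact: (Dn_near b oU Up (Eg1 b')).
have Emu p : U p -> mu y K kappa p = mu x K kappa p.
  move=> Up; rewrite /mu Eg// Eg1//; congr (mu_of _ _ _ _ _).
  by apply: (Dn_near false oU Up) => q Uq; rewrite Eg.
have det0 z p : null_data U z K kappa -> U p -> - conf z p ^+ 2 / 4 != 0.
  move=> [_ nz _ _ _] Up.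
  by rewrite mulf_neq0 ?invr_eq0// oppr_eq0 expf_neq0// (conf_neq0 nz).
have [A [AA FA]] : exists A : 'M[R]_4, A *m eta R *m A^T = eta R /\
    forall p, U p -> frame_mx y p = frame_mx x p *m A.
  apply: (frame_rigidity dU).
  - by exists p0.
  - exact: smooth_frame_mx oU Hx.
  - exact: smooth_frame_mx oU Hy.
  - by move=> p Up; rewrite unitmxE unitfE (det_frame_mx oU Hx Up) det0.
  - move=> p Up; rewrite (gram_frame_mx oU Hx Up) (gram_frame_mx oU Hy Up).
    by rewrite Eg// Eg1.
  - move=> p [] Up.
      rewrite (table_frame_r oU Hx Up) (table_frame_r oU Hy Up).
      by rewrite Eg// Eg1// Eg2.
    rewrite (table_frame_s oU Hx sk posK Up) (table_frame_s oU Hy sk posK Up).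
    by rewrite Eg// Eg1// Eg2// Emu.
have row_A (b : bool) p : U p -> Dn b y p = Dn b x p *m A.
  move=> Up; have := FA p Up.
  pose i : 'I_4 := if b then 1 else 0.
  move=> /(congr1 (row i)); rewrite row_mul !rowK /i.
  by case: (b).
pose f p := y p - x p *m A.
have sxA : smooth U (fun p => x p *m A).
  by apply: smooth_mulmx => //; exact: smooth_cst.
have dy p : U p -> differentiable y p by exact: smooth_diff.
have dxA p : U p -> differentiable (fun p => x p *m A) p by exact: smooth_diff.
have Df b p : U p -> Dn b f p = 0.
  move=> Up; rewrite /f (Dn_sub b (dy p Up) (dxA p Up)) row_A//.
  have sA : smooth U (fun=> A) := smooth_cst A oU.
  rewrite (Dn_mulmx oU b sx sA Up) Dn_cst mulmx0 addr0.
  by rewrite subrr.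
have df p : U p -> differentiable f p.
  by move=> Up; exact: differentiableB (dy p Up) (dxA p Up).
have fc p : U p -> f p = f p0.
  move=> Up; apply: (const_connected dU) Up0 Up => [q|q v] Uq; first exact: df.
  by rewrite (deriv_nvec v (df q Uq)) !Df// !scaler0 addr0.
exists (fun v => v *m A + f p0); split; last first.
  by move=> p Up; rewrite -(fc p Up) /f subrKC.
exists A, (f p0); split=> //.
- move=> v w.
  have E (a b : 'rV[R]_4) : dot a b = (a *m eta R *m b^T) 0 0.
    by rewrite gram_rows !row_id.
  rewrite !E trmx_mul !mulmxA -[v *m A *m _]mulmxA -[v *m _ *m A^T]mulmxA.
  by rewrite AA.
- have := congr1 determinant (FA p0 Up0).
  rewrite det_mulmx (det_frame_mx oU Hx Up0) (det_frame_mx oU Hy Up0) Eg//.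
  rewrite -[LHS]mulr1; move/(mulfI (det0 x p0 Hx Up0)).
  by [].
Qed.
End Uniqueness.

(** * Simple tensors and the surfaces they generate *)

Section Spinors.
Variable R : realType.
Local Notation plane := 'rV[R]_2.

(** The tensor product of (a1, a2) and (b1, b2), as an element of R^4_2 identified
    with the 2x2 matrices so that the scalar square is minus the determinant.  The
    sign of the first coordinate fixes the orientation, hence the sign of kappa. *)
Definition tens (a1 a2 b1 b2 : R) : 'rV[R]_4 :=
  \row_i [:: (a1 * b2 - a2 * b1) / 2; (a1 * b2 + a2 * b1) / 2;
             (a1 * b1 + a2 * b2) / 2; (a2 * b2 - a1 * b1) / 2]`_i.

Lemma tens0l (u v : R) : tens 0 0 u v = 0.
Proof. by apply/rowP => -[[|[|[|[|]]]]//= i]; rewrite !mxE /=; ring. Qed.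

Lemma tens0r (u v : R) : tens u v 0 0 = 0.
Proof. by apply/rowP => -[[|[|[|[|]]]]//= i]; rewrite !mxE /=; ring. Qed.

Lemma dot_tens a1 a2 b1 b2 c1 c2 d1 d2 :
  dot (tens a1 a2 b1 b2) (tens c1 c2 d1 d2) =
  - 2^-1 * (a1 * c2 - a2 * c1) * (b1 * d2 - b2 * d1).
Proof. by rewrite dotE !mxE /=; field. Qed.

Lemma det_tens a1 a2 b1 b2 c1 c2 d1 d2 a1' a2' b1' b2' c1' c2' d1' d2' :
  det4 (tens a1 a2 b1 b2) (tens c1 c2 d1 d2)
    (tens a1' a2' b1 b2 + tens a1 a2 b1' b2')
    (tens c1' c2' d1 d2 + tens c1 c2 d1' d2') =
  4^-1 * ((a1 * a2' - a2 * a1') * (c1 * c2' - c2 * c1') * (b1 * d2 - b2 * d1) ^+ 2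
   - (b1 * b2' - b2 * b1') * (d1 * d2' - d2 * d1') * (a1 * c2 - a2 * c1) ^+ 2).
Proof. by rewrite det4E !mxE /=; field. Qed.

Lemma smooth_tens D (a1 a2 b1 b2 : plane -> R) : open D -> smooth D a1 ->
  smooth D a2 -> smooth D b1 -> smooth D b2 ->
  smooth D (fun p => tens (a1 p) (a2 p) (b1 p) (b2 p)).
Proof.
move=> oD s1 s2 s3 s4; have sc : smooth D (fun=> 2^-1 : R) by exact: smooth_cst.
apply: smooth_mx => // i [j Hj].
apply: (@smooth_eq R R D (fun p => [:: (a1 p * b2 p - a2 p * b1 p) / 2;
     (a1 p * b2 p + a2 p * b1 p) / 2;
     (a1 p * b1 p + a2 p * b2 p) / 2; (a2 p * b2 p - a1 p * b1 p) / 2]`_j)) => //.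
  by move=> p _; rewrite mxE.
by case: j Hj => [|[|[|[|]]]]//= _; apply: smoothM => //;
  (apply: smoothB => // || apply: smoothD => //); exact: smoothM.
Qed.

Lemma Dn_tens e (a1 a2 b1 b2 : plane -> R) p : differentiable a1 p ->
  differentiable a2 p -> differentiable b1 p -> differentiable b2 p ->
  Dn e (fun p => tens (a1 p) (a2 p) (b1 p) (b2 p)) p =
  tens (Dn e a1 p) (Dn e a2 p) (b1 p) (b2 p) +
  tens (a1 p) (a2 p) (Dn e b1 p) (Dn e b2 p).
Proof.
move=> d1 d2 d3 d4.
pose f j := fun p => [:: (a1 p * b2 p - a2 p * b1 p) / 2;
     (a1 p * b2 p + a2 p * b1 p) / 2;
     (a1 p * b1 p + a2 p * b2 p) / 2; (a2 p * b2 p - a1 p * b1 p) / 2]`_j.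
have df j : (j < 4)%N -> differentiable (f j : plane -> R) p.
  by case: j => [|[|[|[|]]]]//= _; rewrite /f /=; diffs.
have dt : differentiable (fun p => tens (a1 p) (a2 p) (b1 p) (b2 p)) p.
  apply: diff_mx => i j.
  have -> : (fun q => tens (a1 q) (a2 q) (b1 q) (b2 q) i j) = f j.
    by apply/funext => q; rewrite mxE.
  exact: df.
apply/matrixP => i [j Hj]; apply: (etrans (Dn_entry e i _ dt)).
have -> : (fun q => tens (a1 q) (a2 q) (b1 q) (b2 q) i (Ordinal Hj)) = f j.
  by apply/funext => q; rewrite mxE.
rewrite !mxE /=.
by case: j Hj => [|[|[|[|]]]]//= _; rewrite /f /=; Dns; ring.
Qed.
End Spinors.

Section Existence.
Variable R : realType.
Local Notation plane := 'rV[R]_2.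

(** The prescribed x_s depends on s alone and the prescribed x_r on r alone, so x is
    the sum of two curves obtained by integration. *)
Lemma tensor_surface (t0 : plane) (e e' : R) (x1 x2 y1 y2 : bool -> plane -> R) :
  0 < e -> e < e' ->
  (forall c, [/\ smooth (diamond t0 e') (x1 c), smooth (diamond t0 e') (x2 c),
     smooth (diamond t0 e') (y1 c) & smooth (diamond t0 e') (y2 c)]) ->
  (forall c p, diamond t0 e' p -> Dn true (x1 c) p = 0 /\ Dn true (x2 c) p = 0) ->
  (forall c p, diamond t0 e' p -> Dn false (y1 c) p = 0 /\ Dn false (y2 c) p = 0) ->
  exists x : plane -> 'rV[R]_4, [/\ smooth (diamond t0 e) x,
    forall p, diamond t0 e p -> Dn false x p =
       tens (x1 false p) (x2 false p) (x1 true p) (x2 true p) &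
    forall p, diamond t0 e p -> Dn true x p =
       tens (y1 false p) (y2 false p) (y1 true p) (y2 true p)].
Proof.
move=> e0 ee' sm Hx Hy; have oD := @open_diamond R t0 e; have oD' := @open_diamond R t0 e'.
have sub := @sub_diamond R t0 _ _ (ltW ee').
pose a p := tens (x1 false p) (x2 false p) (x1 true p) (x2 true p).
pose b p := tens (y1 false p) (y2 false p) (y1 true p) (y2 true p).
have sa : smooth (diamond t0 e') a.
  by have [? ? _ _] := sm false; have [? ? _ _] := sm true; exact: smooth_tens.
have sb : smooth (diamond t0 e') b.
  by have [_ _ ? ?] := sm false; have [_ _ ? ?] := sm true; exact: smooth_tens.
have a0 p : diamond t0 e' p -> Dn true a p = 0.
  move=> Dp; have [s1 s2 _ _] := sm false; have [s3 s4 _ _] := sm true.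
  rewrite Dn_tens; try exact: smooth_diff Dp.
  have [-> ->] := Hx false p Dp; have [-> ->] := Hx true p Dp.
  by rewrite tens0l tens0r addr0.
have b0 p : diamond t0 e' p -> Dn false b p = 0.
  move=> Dp; have [_ _ s1 s2] := sm false; have [_ _ s3 s4] := sm true.
  rewrite Dn_tens; try exact: smooth_diff Dp.
  have [-> ->] := Hy false p Dp; have [-> ->] := Hy true p Dp.
  by rewrite tens0l tens0r addr0.
have /choice[h Hh] : forall i : 'I_4, exists h : plane -> R,
    [/\ smooth (diamond t0 e) h,
      forall y, diamond t0 e y -> Dn false h y = a y 0 i &
      forall y, diamond t0 e y -> Dn true h y = 0].
  move=> i; apply: (@primitive R (fun y => a y 0 i) false t0 e e' e0 ee').
    exact: smooth_entry.
  move=> y Dy; rewrite -(Dn_entry true 0 i (smooth_diff sa Dy)) /= a0//.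
  by rewrite mxE.
have /choice[k Hk] : forall i : 'I_4, exists h : plane -> R,
    [/\ smooth (diamond t0 e) h,
      forall y, diamond t0 e y -> Dn true h y = b y 0 i &
      forall y, diamond t0 e y -> Dn false h y = 0].
  move=> i; apply: (@primitive R (fun y => b y 0 i) true t0 e e' e0 ee').
    exact: smooth_entry.
  move=> y Dy; rewrite -(Dn_entry false 0 i (smooth_diff sb Dy)) /= b0//.
  by rewrite mxE.
pose x p : 'rV[R]_4 := \row_i (h i p + k i p).
have xE i j : (fun q => x q i j) = fun q => h j q + k j q.
  by apply/funext => q; rewrite mxE.
have sx : smooth (diamond t0 e) x.
  apply: smooth_mx => // i j; rewrite xE; have [sh _ _] := Hh j.
  by have [sk _ _] := Hk j; exact: smoothD.
exists x; split=> // p Dp; apply/rowP => j;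
  apply: (etrans (Dn_entry _ 0 j (smooth_diff sx Dp))); rewrite xE;
  have [sh hs hr] := Hh j; have [sk kr ks] := Hk j;
  rewrite Dn_add; try exact: smooth_diff Dp.
  by rewrite hs// ks// addr0.
by rewrite hr// kr// add0r.
Qed.

End Existence.

(** * From the curvature equations to the Liouville equation *)

Section Liouville.
Variable R : realType.
Local Notation plane := 'rV[R]_2.

Lemma hlaplacian_near (V : set plane) (f h : plane -> R) p : open V -> V p ->
  (forall q, V q -> f q = h q) -> hlaplacian f p = hlaplacian h p.
Proof.
move=> oV Vp fh; rewrite /hlaplacian.
have E i j : partial i (partial j f) p = partial i (partial j h) p.
  apply: (deriv_near _ oV Vp) => q Vq.
  exact: (deriv_near _ oV Vq fh).
by rewrite !E.
Qed.

Lemma hlaplacianE (V : set plane) (f : plane -> R) p : open V -> V p ->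
  smooth V f -> hlaplacian f p = 4 * Dn true (Dn false f) p.
Proof.
move=> oV Vp sf.
have d1 b : differentiable (Dn b f) p := smooth_diff (smooth_DnR b oV sf) Vp.
have E0 : partial 0 (partial 0 f) p = partial 0 (fun q => Dn false f q + Dn true f q) p.
  by apply: (deriv_near _ oV Vp) => q Vq; rewrite partial0E//; exact: smooth_diff sf Vq.
have E1 : partial 1 (partial 1 f) p = partial 1 (fun q => Dn false f q - Dn true f q) p.
  by apply: (deriv_near _ oV Vp) => q Vq; rewrite partial1E//; exact: smooth_diff sf Vq.
rewrite /hlaplacian E0 E1.
rewrite (partial0E (differentiableD (d1 false) (d1 true))).
rewrite (partial1E (differentiableB (d1 false) (d1 true))).
rewrite !(Dn_add _ (d1 false) (d1 true)) !(Dn_sub _ (d1 false) (d1 true)).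
by rewrite (Dn_commR false true oV sf Vp); ring.
Qed.

Section PDE.
Variables (V : set plane) (K kappa : plane -> R) (eps : R).
Hypotheses (oV : open V) (sK : smooth V K) (sk : smooth V kappa).
Hypotheses (eps2 : eps * eps = 1) (posK : forall p, V p -> 0 < eps * K p).
Hypothesis (posKk : forall p, V p -> 0 < K p ^+ 2 - kappa p ^+ 2).
Hypothesis (eqK : forall p, V p ->
     `|K p ^+ 2 - kappa p ^+ 2| `^ 4^-1
       * hlaplacian (fun q => ln `|K q ^+ 2 - kappa q ^+ 2|) p
     = - 8 * K p).
Hypothesis (eqkappa : forall p, V p ->
     `|K p ^+ 2 - kappa p ^+ 2| `^ 4^-1
       * hlaplacian (fun q => ln `|(K q + kappa q) / (K q - kappa q)|) p
     = - 4 * kappa p).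

Let P p := eps * (K p + kappa p).
Let N p := eps * (K p - kappa p).

Let PN p : P p * N p = K p ^+ 2 - kappa p ^+ 2.
Proof.
transitivity (eps * eps * (K p ^+ 2 - kappa p ^+ 2)); first by rewrite /P /N; ring.
by rewrite eps2 mul1r.
Qed.

Let posPN p : V p -> 0 < P p /\ 0 < N p.
Proof.
move=> Vp; have := posKk Vp; have := posK Vp; rewrite -PN => K0 PN0.
have S : 0 < P p + N p.
  have -> : P p + N p = 2 * (eps * K p) by rewrite /P /N; ring.
  by rewrite mulr_gt0.
have [p0|p0] := ltP 0 (P p).
  by split=> //; move: PN0; rewrite pmulr_rgt0.
have n0 : 0 < N p by lra.
by move: PN0; rewrite pmulr_lgt0// ltNge p0.
Qed.

Let A p := ln (P p).
Let B p := ln (N p).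

Let sP : smooth V P.
Proof. by apply: smoothM => //; [exact: smooth_cst|exact: smoothD]. Qed.
Let sN : smooth V N.
Proof. by apply: smoothM => //; [exact: smooth_cst|exact: smoothB]. Qed.
Let sA : smooth V A.
Proof. by apply: smooth_ln => // p /posPN[]. Qed.
Let sB : smooth V B.
Proof. by apply: smooth_ln => // p /posPN[]. Qed.

(** The logarithms of psi_1 ([false]) and psi_2 ([true]): these combinations of
    A = ln |K + kappa| and B = ln |K - kappa| decouple the two equations. *)
Definition log_psi (b : bool) p : R :=
  if b then 8^-1 * A p - 3 / 8 * B p else 8^-1 * B p - 3 / 8 * A p.
Local Notation u1 := (log_psi false).
Local Notation u2 := (log_psi true).

Lemma smooth_log_psi b : smooth V (log_psi b).
Proof.
have sc (c : R) : smooth V (fun=> c) by exact: smooth_cst.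
by case: b; apply: smoothB => //; exact: smoothM.
Qed.

Lemma exp_log_psi p : V p ->
  K p + kappa p = eps * expR (- (3 * u1 p + u2 p)) /\
  K p - kappa p = eps * expR (- (u1 p + 3 * u2 p)).
Proof.
move=> Vp; have [P0 N0] := posPN Vp; rewrite /log_psi.
have -> : - (3 * (8^-1 * B p - 3 / 8 * A p) + (8^-1 * A p - 3 / 8 * B p)) = A p by field.
have -> : - (8^-1 * B p - 3 / 8 * A p + 3 * (8^-1 * A p - 3 / 8 * B p)) = B p by field.
by rewrite /A /B !lnK ?posrE// /P /N !mulrA eps2 !mul1r.
Qed.

Lemma log_psi_wave p : V p ->
  4 * Dn true (Dn false u1) p = (K p + kappa p) * expR (u1 p + u2 p) /\
  4 * Dn true (Dn false u2) p = (K p - kappa p) * expR (u1 p + u2 p).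
Proof.
move=> Vp.
have EAB q : V q -> ln `|K q ^+ 2 - kappa q ^+ 2| = A q + B q.
  move=> Vq; have [P0 N0] := posPN Vq.
  by rewrite gtr0_norm ?posKk// -PN lnM ?posrE.
have EAmB q : V q -> ln `|(K q + kappa q) / (K q - kappa q)| = A q - B q.
  move=> Vq; have [P0 N0] := posPN Vq.
  have e0 : eps != 0.
    by apply/eqP => e0; move: eps2; rewrite e0 mul0r => /esym/eqP; rewrite oner_eq0.
  have -> : (K q + kappa q) / (K q - kappa q) = P q / N q.
    by rewrite /P /N invfM mulrACA mulfV// mul1r.
  by rewrite gtr0_norm ?divr_gt0// ln_div ?posrE.
have Epow : `|K p ^+ 2 - kappa p ^+ 2| `^ 4^-1 = expR (- (u1 p + u2 p)).
  by rewrite /powR normr_eq0 gt_eqF ?posKk// EAB// /log_psi; congr expR; field.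
have := eqK Vp; have := eqkappa Vp.
rewrite (hlaplacian_near oV Vp EAB) (hlaplacian_near oV Vp EAmB) Epow.
rewrite (hlaplacianE oV Vp (smoothD oV sA sB)) (hlaplacianE oV Vp (smoothB oV sA sB)).
have d0 b (f : plane -> R) q : smooth V f -> V q -> differentiable (Dn b f) q.
  by move=> sf Vq; exact: smooth_diff (smooth_DnR b oV sf) Vq.
have d (f : plane -> R) q : smooth V f -> V q -> differentiable f q.
  by move=> sf Vq; exact: smooth_diff sf Vq.
have lin (c1 c2 : R) : Dn true (Dn false (fun q => c1 * A q + c2 * B q)) p =
   c1 * Dn true (Dn false A) p + c2 * Dn true (Dn false B) p.
  have E q : V q -> Dn false (fun q => c1 * A q + c2 * B q) q =
     c1 * Dn false A q + c2 * Dn false B q.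
    move=> Vq; have dA := d _ _ sA Vq; have dB := d _ _ sB Vq.
    by Dns; rewrite !mul0r !add0r.
  rewrite (Dn_near true oV Vp E).
  have dA := d0 false _ _ sA Vp; have dB := d0 false _ _ sB Vp.
  by Dns; rewrite !mul0r !add0r.
have -> : (fun q => A q + B q) = (fun q => 1 * A q + 1 * B q).
  by apply/funext => q; rewrite !mul1r.
have -> : (fun q => A q - B q) = (fun q => 1 * A q + -1 * B q).
  by apply/funext => q; rewrite mul1r mulN1r.
have -> : u1 = (fun q => - (3 / 8) * A q + 8^-1 * B q).
  by apply/funext => q; rewrite /log_psi; ring.
have -> : u2 = (fun q => 8^-1 * A q + - (3 / 8) * B q).
  by apply/funext => q; rewrite /log_psi; ring.
rewrite !lin.
set a := Dn true (Dn false A) p; set b := Dn true (Dn false B) p.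
set c := - (3 / 8) * A p + 8^-1 * B p + (8^-1 * A p + - (3 / 8) * B p).
rewrite expRN => H2 H1; have c0 : expR c != 0 by rewrite gt_eqF// expR_gt0.
have {}H1 : 4 * (a + b) = -8 * K p * expR c.
  by rewrite -H1; field.
have {}H2 : 4 * (a - b) = -4 * kappa p * expR c.
  by rewrite -H2; field.
split.
  transitivity (- 8^-1 * (4 * (a + b)) - 4^-1 * (4 * (a - b))); first by field.
  by rewrite H1 H2; field.
transitivity (- 8^-1 * (4 * (a + b)) + 4^-1 * (4 * (a - b))); first by field.
by rewrite H1 H2; field.
Qed.

(** For psi = exp w the left-hand side is w_sr psi^2. *)
Lemma liouville_psi b p : V p ->
  let psi q := expR (log_psi b q) in
  psi p * Dn true (Dn false psi) p - Dn false psi p * Dn true psi p = eps / 4.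
Proof.
move=> Vp psi; have su := smooth_log_psi b.
have du q : V q -> differentiable (log_psi b) q := smooth_diff su.
have E c q : V q -> Dn c psi q = Dn c (log_psi b) q * psi q.
  by move=> Vq; rewrite Dn_exp//; exact: du.
rewrite (Dn_near true oV Vp (E false)) !E//.
have d1 : differentiable (Dn false (log_psi b)) p := smooth_diff (smooth_DnR false oV su) Vp.
have dpsi : differentiable psi p := smooth_diff (smooth_exp oV su) Vp.
Dns; rewrite E//.
transitivity (4^-1 * (4 * Dn true (Dn false (log_psi b)) p) * (psi p * psi p)).
  by field.
have [H1 H2] := log_psi_wave Vp; have [K1 K2] := exp_log_psi Vp.
rewrite /psi; case: (b).
  have E1 : expR (- (u1 p + 3 * u2 p)) * expR (u1 p + u2 p) *
      (expR (u2 p) * expR (u2 p)) = 1.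
    by rewrite -!expRD -[RHS]expR0; congr expR; ring.
  by rewrite H2 K2 -[RHS]mulr1 -[X in _ = _ * X]E1; ring.
have E1 : expR (- (3 * u1 p + u2 p)) * expR (u1 p + u2 p) *
    (expR (u1 p) * expR (u1 p)) = 1.
  by rewrite -!expRD -[RHS]expR0; congr expR; ring.
by rewrite H1 K1 -[RHS]mulr1 -[X in _ = _ * X]E1; ring.
Qed.

End PDE.
End Liouville.

(** * Existence *)

Section SpinorSurface.
Variable R : realType.
Local Notation plane := 'rV[R]_2.
Variables (t0 : plane) (r : R) (K kappa : plane -> R) (eps : R).
Local Notation V := (diamond t0 r).
Hypotheses (r0 : 0 < r) (sK : smooth V K) (sk : smooth V kappa).
Hypotheses (eps2 : eps * eps = 1) (posK : forall p, V p -> 0 < eps * K p).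
Hypothesis (posKk : forall p, V p -> 0 < K p ^+ 2 - kappa p ^+ 2).
Hypothesis (eqK : forall p, V p ->
     `|K p ^+ 2 - kappa p ^+ 2| `^ 4^-1
       * hlaplacian (fun q => ln `|K q ^+ 2 - kappa q ^+ 2|) p
     = - 8 * K p).
Hypothesis (eqkappa : forall p, V p ->
     `|K p ^+ 2 - kappa p ^+ 2| `^ 4^-1
       * hlaplacian (fun q => ln `|(K q + kappa q) / (K q - kappa q)|) p
     = - 4 * kappa p).

Let u (b : bool) : plane -> R := log_psi K kappa eps b.

(** Both functions psi are split with Wronskians eps / 2 along s and 1 / 2 along r.
    This makes x_ss^2 = x_rr^2 = 1/4 and g = - psi_1 psi_2 / 2, and [det_tens]
    turns kappa into half the difference of eps / (psi_1^3 psi_2) = K + kappa and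
    eps / (psi_1 psi_2^3) = K - kappa. *)
Lemma spinor_surface : exists x, null_data (diamond t0 (r / 2)) x K kappa.
Proof.
have oV := @open_diamond R t0 r.
have su b : smooth V (u b) by exact: smooth_log_psi.
have eps0 : eps != 0.
  by apply/eqP => e0; move: eps2; rewrite e0 mul0r => /esym/eqP; rewrite oner_eq0.
have k0 : eps / 4 != 0 by rewrite mulf_neq0.
have n2 : (2 : R) != 0 by [].
have factor b := @liouville_factor R (fun q => expR (u b q)) t0 r (eps / 4) 2 k0 n2
  (smooth_exp oV (su b)) (fun p _ => lt0r_neq0 (expR_gt0 (u b p)))
  (fun p Vp => liouville_psi oV sK sk eps2 posK posKk eqK eqkappa b Vp).
have [x1 [x2 [y1 [y2 [S1 Hx1 Hy1 Hf1 HW1]]]]] := factor false.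
have [z1 [z2 [w1 [w2 [S2 Hx2 Hy2 Hf2 HW2]]]]] := factor true.
have r20 : 0 < r / 2 by rewrite divr_gt0.
have r2r : r / 2 < r by rewrite ltr_pdivrMr// ltr_pMr// ltr1n.
have [x [sx xsE xrE]] : exists x : plane -> 'rV[R]_4,
    [/\ smooth (diamond t0 (r / 2)) x,
      forall p, diamond t0 (r / 2) p -> Dn false x p =
         tens (x1 p) (x2 p) (z1 p) (z2 p) &
      forall p, diamond t0 (r / 2) p -> Dn true x p =
         tens (y1 p) (y2 p) (w1 p) (w2 p)].
  apply: (@tensor_surface R t0 (r / 2) r
    (fun b => if b then z1 else x1) (fun b => if b then z2 else x2)
    (fun b => if b then w1 else y1) (fun b => if b then w2 else y2) r20 r2r).
  - by case.
  - by case.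
  - by case.
exists x; set U := diamond t0 (r / 2) in sx xsE xrE *.
have oU : open U by exact: open_diamond.
have UV : U `<=` V by exact: sub_diamond (ltW r2r).
have [sx1 sx2 sy1 sy2] := S1; have [sz1 sz2 sw1 sw2] := S2.
have d (f : plane -> R) p : smooth V f -> U p -> differentiable f p.
  by move=> sf /UV; exact: smooth_diff.
have DxE c p : U p -> Dn c (Dn false x) p =
    tens (Dn c x1 p) (Dn c x2 p) (z1 p) (z2 p) +
    tens (x1 p) (x2 p) (Dn c z1 p) (Dn c z2 p).
  move=> Up; rewrite (Dn_near c oU Up xsE).
  exact: (Dn_tens c (d _ _ sx1 Up) (d _ _ sx2 Up) (d _ _ sz1 Up) (d _ _ sz2 Up)).
have DyE p : U p -> Dn true (Dn true x) p =
    tens (Dn true y1 p) (Dn true y2 p) (w1 p) (w2 p) +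
    tens (y1 p) (y2 p) (Dn true w1 p) (Dn true w2 p).
  move=> Up; rewrite (Dn_near true oU Up xrE).
  exact: (Dn_tens true (d _ _ sy1 Up) (d _ _ sy2 Up) (d _ _ sw1 Up) (d _ _ sw2 Up)).
have confE p : U p -> conf x p = - 2^-1 * expR (u false p + u true p).
  move=> Up; have Vp := UV _ Up.
  by rewrite /conf xsE// xrE// dot_tens -Hf1// -Hf2// expRD mulrA.
split=> //.
- move=> p Up; rewrite -/(conf x p) confE// xsE// xrE// !dot_tens; split.
  + by ring.
  + by ring.
  + by rewrite mulNr oppr_lt0 mulr_gt0 ?expR_gt0.
- move=> p Up; have Vp := UV _ Up; rewrite DxE//.
  have [-> ->] := Hx1 p Vp; have [-> ->] := Hx2 p Vp.
  by rewrite tens0l tens0r addr0.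
- move=> p c Up; have Vp := UV _ Up.
  have [E1 E2] := HW1 p Vp; have [E3 E4] := HW2 p Vp.
  case: c; [rewrite DyE//|rewrite DxE//]; rewrite !dot_simp !dot_tens.
    transitivity ((y1 p * Dn true y2 p - y2 p * Dn true y1 p) *
      (w1 p * Dn true w2 p - w2 p * Dn true w1 p)); first by field.
    by rewrite E2 E4; field.
  transitivity ((x1 p * Dn false x2 p - x2 p * Dn false x1 p) *
      (z1 p * Dn false z2 p - z2 p * Dn false z1 p)); first by field.
  rewrite E1 E3; transitivity (eps * eps * 4^-1); first by field.
  by rewrite eps2 mul1r.
- move=> p Up; have Vp := UV _ Up.
  have [H1 H2] := log_psi_wave oV sK sk eps2 posK posKk eqK eqkappa Vp.
  have [K1 K2] := exp_log_psi eps2 posK posKk Vp.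
  split.
    pose v q := u false q + u true q.
    have sv : smooth V v by exact: smoothD.
    have dv q : U q -> differentiable v q by exact: d.
    have gE c q : U q -> Dn c (conf x) q = Dn c v q * conf x q.
      move=> Uq; rewrite (Dn_near c oU Uq confE).
      have dE : differentiable (fun q => expR (v q)) q.
        by apply: d => //; exact: smooth_exp.
      Dns; rewrite Dn_exp; last exact: dv.
      by rewrite confE// -/(v q); ring.
    have sg : smooth U (conf x).
      have sc : smooth U (fun=> - 2^-1 : R) by exact: smooth_cst.
      apply: (smooth_eq oU (fun q Uq => esym (confE q Uq))).
      apply: smoothM => //; apply: smooth_exp => //.
      exact: smooth_sub UV sv.
    have dg := smooth_diff sg Up.
    have dvf : differentiable (Dn false v) p by apply: d => //; exact: smooth_DnR.
    have g0 : conf x p != 0.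
      by rewrite confE// mulNr oppr_eq0 mulf_neq0// gt_eqF// expR_gt0.
    have gsr : Dn true (Dn false (conf x)) p =
       Dn true (Dn false v) p * conf x p + Dn false v p * Dn true v p * conf x p.
      by rewrite (Dn_near true oU Up (gE false)); Dns; rewrite gE//; ring.
    have vsr : 4 * Dn true (Dn false v) p = 2 * K p * expR (v p).
      have E q : V q -> Dn false v q = Dn false (u false) q + Dn false (u true) q.
        by move=> Vq; apply: Dn_add; exact: smooth_diff (su _) Vq.
      rewrite (Dn_near true oV Vp E) Dn_add; last 2 first.
        exact: smooth_diff (smooth_DnR false oV (su _)) Vp.
        exact: smooth_diff (smooth_DnR false oV (su _)) Vp.
      by rewrite mulrDr H1 H2 -/(u false p) -/(u true p) -/(v p); ring.
    rewrite !gE// gsr.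
    have -> : - (conf x p * (Dn true (Dn false v) p * conf x p +
        Dn false v p * Dn true v p * conf x p) -
        Dn false v p * conf x p * (Dn true v p * conf x p)) / conf x p ^+ 3 =
      - (4 * Dn true (Dn false v) p) / (4 * conf x p) by field.
    rewrite vsr confE// -/(v p).
    by field; rewrite gt_eqF// expR_gt0.
  rewrite DxE// DyE// xsE// xrE// det_tens.
  have [E1 E2] := HW1 p Vp; have [E3 E4] := HW2 p Vp.
  rewrite E1 E2 E3 E4 -Hf1// -Hf2// confE// (expRD (u false p) (u true p)).
  transitivity (2^-1 * ((K p + kappa p) - (K p - kappa p))); first by field.
  have {}K1 : K p + kappa p = eps / (expR (u false p) ^+ 3 * expR (u true p)).
    rewrite K1 -/(u false p) -/(u true p); move: (u false p) (u true p) => a b.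
    by rewrite expRN expRD (expRM_natl 3).
  have {}K2 : K p - kappa p = eps / (expR (u false p) * expR (u true p) ^+ 3).
    rewrite K2 -/(u false p) -/(u true p); move: (u false p) (u true p) => a b.
    by rewrite expRN expRD (expRM_natl 3).
  rewrite K1 K2.
  have p1 : expR (u false p) != 0 by rewrite gt_eqF// expR_gt0.
  have p2 : expR (u true p) != 0 by rewrite gt_eqF// expR_gt0.
  by field; rewrite p1 p2.
Qed.

End SpinorSurface.

Theorem theorem7p6 (R : realType) (D : set 'rV[R]_2) (K kappa : 'rV[R]_2 -> R)
  (domD : domain D) (smoothK : smooth D K) (smoothkappa : smooth D kappa)
  (posKk : forall p, D p -> 0 < K p ^+ 2 - kappa p ^+ 2)
  (eqK : forall p, D p ->
     `|K p ^+ 2 - kappa p ^+ 2| `^ 4^-1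
       * hlaplacian (fun q => ln `|K q ^+ 2 - kappa q ^+ 2|) p
     = - 8 * K p)
  (eqkappa : forall p, D p ->
     `|K p ^+ 2 - kappa p ^+ 2| `^ 4^-1
       * hlaplacian (fun q => ln `|(K q + kappa q) / (K q - kappa q)|) p
     = - 4 * kappa p)
  (t0 : 'rV[R]_2) (Dt0 : D t0) :
  (exists (U : set 'rV[R]_2) (x : 'rV[R]_2 -> 'rV[R]_4),
     [/\ U t0, U `<=` D & canonical_surface_with x U K kappa])
  /\
  (forall (U : set 'rV[R]_2) (x y : 'rV[R]_2 -> 'rV[R]_4),
     U t0 -> U `<=` D ->
     canonical_surface_with x U K kappa ->
     canonical_surface_with y U K kappa ->
     exists M : 'rV[R]_4 -> 'rV[R]_4,
       proper_motion M /\ forall p, U p -> y p = M (x p)).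
Proof.
split; last first.
  move=> U x y Ut0 UD Hx Hy; have [[dU _ _ _] _ _ _ _] := Hx.
  apply: (motion_unique dU).
  - by exists t0.
  - exact: smooth_sub UD smoothkappa.
  - by move=> p /UD; exact: posKk.
  - exact: canonical_null_data.
  - exact: canonical_null_data.
have K0 : K t0 != 0 := K_neq0 posKk Dt0.
pose eps : R := Num.sg (K t0).
have eps2 : eps * eps = 1 by rewrite -expr2 sqr_sg K0.
have epsK : 0 < eps * K t0 by rewrite /eps -normrEsg normr_gt0.
have [r r0 rV] : exists2 r : R, 0 < r & ball t0 r `<=` [set p | D p /\ 0 < eps * K p].
  have cK : {for t0, continuous (fun p => eps * K p)}.
    apply: differentiable_continuous; apply: differentiableM => //.
    exact: smooth_diff smoothK Dt0.
  have nD : nbhs t0 D by exact: open_nbhs_nbhs (conj domD.1 Dt0).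
  have nK : nbhs t0 [set p | 0 < eps * K p].
    have nP : nbhs (eps * K t0) [set y : R | 0 < y].
      by apply: open_nbhs_nbhs; split; [exact: open_gt|exact: epsK].
    exact: cK nP.
  have /nbhs_ballP[r r0 rV] : nbhs t0 [set p | D p /\ 0 < eps * K p].
    exact: filterS2 nD nK.
  by exists r.
have VV p : diamond t0 r p -> D p /\ 0 < eps * K p.
  by move=> /(diamond_ball r0)/rV.
have VD : diamond t0 r `<=` D by move=> p /VV[].
have [x Hx] : exists x, null_data (diamond t0 (r / 2)) x K kappa.
  apply: (@spinor_surface R t0 r K kappa eps) => //.
  - exact: smooth_sub VD smoothK.
  - exact: smooth_sub VD smoothkappa.
  - by move=> p /VV[].
  - by move=> p /VD; exact: posKk.
  - by move=> p /VD; exact: eqK.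
  - by move=> p /VD; exact: eqkappa.
have r20 : 0 < r / 2 by rewrite divr_gt0.
have UD : diamond t0 (r / 2) `<=` D.
  apply: subset_trans VD; apply: sub_diamond.
  by rewrite ler_pdivrMr// ler_pMr// ler1n.
exists (diamond t0 (r / 2)), x; split=> //; first exact: diamond_center.
have oU := @open_diamond R t0 (r / 2).
apply: (null_data_canonical oU Hx).
by split=> //; exact: connected_diamond.
Qed.
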